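(* Let $A$ and $B$ be finite dimensional $k$-algebras and $\Lambda:=A\otimes_k B$. The category $\mathsf{Mon}(B, A\text{-}\mathsf{Gproj})$ is a Frobenius exact category whose projective-injective objects are the projective $\Lambda$-modules. Moreover, the following are equivalent: (1) the exact category $\mathsf{Mon}(B,A)$ is Frobenius; (2) $A$ is a selfinjective algebra; (3) $\mathsf{Mon}(B,A)=\mathsf{Mon}(B,A\text{-}\mathsf{Gproj})$.
   Context: $k$ is a fixed field; all algebras are nonzero finite dimensional $k$-algebras; $\otimes=\otimes_k$; modules are finitely generated left modules unless stated otherwise. $D=\mathrm{Hom}_k(-,k)$. Subcategories are full and closed under isomorphism. Extension-closed full subcategories of $\Lambda\text{-mod}$ are regarded as exact categories with the short exact sequences of $\Lambda\text{-mod}$ having all terms in the subcategory. An exact category is Frobenius if it has enough projective and enough injective objects and these two classes of objects coincide. A $\Gamma$-module $G$ is Gorenstein projective if there is an exact complex $P^\bullet=(\cdots\to P^{i}\xrightarrow{d^i}P^{i+1}\to\cdots)$ of finitely generated projective $\Gamma$-modules with $G=\mathrm{Ker}\,d^1$ such that $\mathrm{Hom}_\Gamma(P^\bullet,{}_\Gamma\Gamma)$ is exact; $\Gamma\text{-}\mathsf{Gproj}$ is the full subcategory of $\Gamma\text{-mod}$ of Gorenstein projective modules. $\mathsf{Mon}(B,A)$ is the full subcategory of $\Lambda\text{-mod}$ consisting of the modules $X$ with $\mathrm{Tor}_i^{\Lambda}(A\otimes D(S),X)=0$ for all $i\ge 1$ and all simple left $B$-modules $S$. For a full additive subcategory $\mathscr{L}$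 of $A\text{-mod}$, $\mathsf{Mon}(B,\mathscr{L})$ is the full subcategory of those $X\in\mathsf{Mon}(B,A)$ such that the left $A$-module $(A\otimes V)\otimes_\Lambda X$ lies in $\mathscr{L}$ for every finitely generated right $B$-module $V$. *)

(* Defs.v *)
From HB Require Import structures.
From mathcomp Require Import all_boot all_order all_algebra falgebra.

Set Implicit Arguments.
Unset Strict Implicit.
Unset Printing Implicit Defensive.

Import GRing.Theory VectorInternalTheory.
Local Open Scope ring_scope.

(* V (x)_k W is modelled by matrices in the coordinates [v2r] of V and W, with
   v (x) w the outer product.  The name [tens] keeps it apart from the matrix
   ring 'M_n when V and W have the same dimension. *)
Definition tens (k : fieldType) (V W : vectType k) : Type :=
  'M[k]_(dim V, dim W).

HB.instance Definition _ (k : fieldType) (V W : vectType k) :=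
  Vector.copy (tens V W) 'M[k]_(dim V, dim W).

Section TensorSpaces.
Variable k : fieldType.
Implicit Types V W U : vectType k.

Definition pure V W (v : V) (w : W) : tens V W := (v2r v)^T *m v2r w.

Definition vbase V (i : 'I_(dim V)) : V := r2v (delta_mx 0 i).

Definition tlift V W U (f : V -> W -> U) (x : tens V W) : U :=
  \sum_i \sum_j x i j *: f (vbase i) (vbase j).

Definition tmap V V' W W' (f : 'Hom(V, V')) (g : 'Hom(W, W')) :
    'Hom(tens V W, tens V' W') :=
  linfun (tlift (fun v w => pure (f v) (g w))).

Definition bilin V W U (f : V -> W -> U) :=
  (forall w, linear (f^~ w)) /\ (forall v, linear (f v)).

Lemma vbaseE V (v : V) : v = \sum_i v2r v 0 i *: vbase i.
Proof.
rewrite -{1}(v2rK v) {1}[v2r v]row_sum_delta linear_sum.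
by apply: eq_bigr => i _; rewrite linearZ.
Qed.

Lemma bilin_pure V W : bilin (@pure V W).
Proof.
split=> [w c u v|v c u w]; rewrite /pure.
  by rewrite linearP /= linearP /= mulmxDl -scalemxAl.
by rewrite linearP /= mulmxDr -scalemxAr.
Qed.

Lemma pureDl V W (u v : V) (w : W) : pure (u + v) w = pure u w + pure v w.
Proof. by have := (bilin_pure V W).1 w 1 u v; rewrite !scale1r. Qed.

Lemma pureDr V W (v : V) (u w : W) : pure v (u + w) = pure v u + pure v w.
Proof. by have := (bilin_pure V W).2 v 1 u w; rewrite !scale1r. Qed.

Lemma pureZl V W c (v : V) (w : W) : pure (c *: v) w = c *: pure v w.
Proof. by rewrite /pure linearZ /= linearZ /= -scalemxAl. Qed.

Lemma pureZr V W c (v : V) (w : W) : pure v (c *: w) = c *: pure v w.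
Proof. by rewrite /pure linearZ /= -scalemxAr. Qed.

Lemma tlift_linear V W U (f : V -> W -> U) : linear (tlift f).
Proof.
move=> c x y; rewrite /tlift scaler_sumr -big_split /=.
apply: eq_bigr => i _; rewrite scaler_sumr -big_split /=.
by apply: eq_bigr => j _; rewrite !mxE scalerDl scalerA.
Qed.

HB.instance Definition _ V W U (f : V -> W -> U) :=
  GRing.isLinear.Build k (tens V W) U _ (tlift f) (tlift_linear f).

Lemma tlift_pure V W U (f : V -> W -> U) (v : V) (w : W) :
  bilin f -> tlift f (pure v w) = f v w.
Proof.
case=> fl fr; rewrite {2}(vbaseE v) {2}(vbaseE w) /tlift.
pose F := HB.pack_for {linear V -> U} (f^~ (\sum_i v2r w 0 i *: vbase i))
   (GRing.isLinear.Build k V U _ _ (fl _)).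
rewrite -[RHS]/(F _) linear_sum; apply: eq_bigr => i _; rewrite linearZ /=.
pose G := HB.pack_for {linear W -> U} (f (vbase i))
   (GRing.isLinear.Build k W U _ _ (fr _)).
rewrite -[f _ _]/(G _) linear_sum scaler_sumr; apply: eq_bigr => j _.
by rewrite linearZ /= scalerA /pure mxE big_ord1 !mxE.
Qed.

Lemma tmap_bilin V V' W W' (f : 'Hom(V, V')) (g : 'Hom(W, W')) :
  bilin (fun v w => pure (f v) (g w)).
Proof.
split=> [w c u v|v c u w].
  by rewrite linearP pureDl pureZl.
by rewrite linearP pureDr pureZr.
Qed.

Lemma tmap_pure V V' W W' (f : 'Hom(V, V')) (g : 'Hom(W, W')) v w :
  tmap f g (pure v w) = pure (f v) (g w).
Proof. by rewrite lfunE /= tlift_pure //; apply: tmap_bilin. Qed.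

Lemma tens_sum V W (x : tens V W) :
  x = \sum_i \sum_j x i j *: pure (vbase i) (vbase j).
Proof.
rewrite {1}[x]matrix_sum_delta; apply: eq_bigr => i _; apply: eq_bigr => j _.
by rewrite /pure /vbase !r2vK trmx_delta mul_delta_mx.
Qed.

Lemma tens_ext V W U (f g : {linear tens V W -> U}) :
  (forall v w, f (pure v w) = g (pure v w)) -> f =1 g.
Proof.
move=> fg x; rewrite (tens_sum x) !linear_sum; apply: eq_bigr => i _.
by rewrite !linear_sum; apply: eq_bigr => j _; rewrite !linearZ fg.
Qed.

Lemma tens_lfunP V W U (f g : 'Hom(tens V W, U)) :
  (forall v w, f (pure v w) = g (pure v w)) -> f = g.
Proof. by move=> fg; apply/lfunP; apply: tens_ext. Qed.

Lemma tmap1 V W : tmap \1%VF \1%VF = \1%VF :> 'End(tens V W).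
Proof. by apply: tens_lfunP => v w; rewrite tmap_pure !id_lfunE. Qed.

Lemma tmap_comp V1 V2 V3 W1 W2 W3 (f : 'Hom(V2, V3)) (f' : 'Hom(V1, V2))
    (g : 'Hom(W2, W3)) (g' : 'Hom(W1, W2)) :
  (tmap f g \o tmap f' g' = tmap (f \o f') (g \o g'))%VF.
Proof. by apply: tens_lfunP => v w; rewrite comp_lfunE !tmap_pure !comp_lfunE. Qed.

Lemma tmap_is_bilin V V' W W' : bilin (@tmap V V' W W').
Proof.
split=> [g c f f'|f c g g']; apply: tens_lfunP => v w.
  by rewrite add_lfunE scale_lfunE !tmap_pure add_lfunE scale_lfunE pureDl pureZl.
by rewrite add_lfunE scale_lfunE !tmap_pure add_lfunE scale_lfunE pureDr pureZr.
Qed.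

Lemma pure_eq0 V W (v : V) (w : W) :
  (pure v w == 0) = (v == 0) || (w == 0).
Proof.
apply/eqP/orP=> [vw0|[]/eqP->]; last 2 first.
- by have := pureZl 0 (0 : V) w; rewrite !scale0r.
- by have := pureZr 0 v (0 : W); rewrite !scale0r.
case: (eqVneq v 0) => [|v0]; [by left | right].
have /rV0Pn[i vi] : v2r v != 0 by rewrite (can2_eq v2rK r2vK) linear0.
apply/eqP/v2r_inj; rewrite linear0; apply/rowP=> j; rewrite !mxE.
have := congr1 (fun x : 'M_(_, _) => x i j) vw0.
by rewrite /pure !mxE big_ord1 !mxE => /eqP; rewrite mulf_eq0 (negPf vi) => /eqP.
Qed.

Definition lfun2 V W U (f : V -> W -> U) : 'Hom(V, 'Hom(W, U)) :=
  linfun (fun v => linfun (f v)).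

Lemma lfun2E V W U (f : V -> W -> U) v w : bilin f -> lfun2 f v w = f v w.
Proof.
case=> fl fr.
have fE u : linfun (f u) =1 f u.
  pose F := HB.pack_for {linear W -> U} (f u)
    (GRing.isLinear.Build k W U _ _ (fr u)).
  exact: (lfunE F).
have fL : linear (fun v => linfun (f v)).
  move=> c a b; apply/lfunP=> x.
  by rewrite add_lfunE scale_lfunE !fE; apply: fl.
pose G := HB.pack_for {linear V -> 'Hom(W, U)} (fun v => linfun (f v))
  (GRing.isLinear.Build k V 'Hom(W, U) _ _ fL).
by rewrite /lfun2 (lfunE G) /= fE.
Qed.

End TensorSpaces.

Definition talg (k : fieldType) (A B : falgType k) : Type := tens A B.

HB.instance Definition _ (k : fieldType) (A B : falgType k) :=
  Vector.copy (talg A B) (tens A B).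

Section TensorAlgebra.
Variables (k : fieldType) (A B : falgType k).

Definition tamul : tens A B -> 'End(tens A B) :=
  tlift (fun a b => tmap (amull a) (amull b)).

Definition talg_mul (x y : talg A B) : talg A B := tamul x y.
Definition talg_one : talg A B := pure 1 1.

Lemma talg_mul_pure a b a' b' :
  talg_mul (pure a b) (pure a' b') = pure (a * a') (b * b').
Proof.
rewrite /talg_mul /tamul tlift_pure ?tmap_pure ?lfunE ?lfunE //=.
split=> [w c u v|v c u w]; rewrite linearP.
  by rewrite (tmap_is_bilin _ _ _ _).1.
by rewrite (tmap_is_bilin _ _ _ _).2.
Qed.

Lemma talg_mulPl (z : talg A B) : linear (talg_mul^~ z).
Proof. by move=> c x y; rewrite /talg_mul /tamul linearP add_lfunE scale_lfunE. Qed.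

Lemma talg_mulPr (z : talg A B) : linear (talg_mul z).
Proof. by move=> c x y; rewrite /talg_mul linearP. Qed.

HB.instance Definition _ z :=
  GRing.isLinear.Build k (talg A B) (talg A B) _ (talg_mul z) (talg_mulPr z).

Definition talg_mulr z x := talg_mul x z.
HB.instance Definition _ z :=
  GRing.isLinear.Build k (talg A B) (talg A B) _ (talg_mulr z) (talg_mulPl z).

Lemma talg_ext (U : vectType k) (f g : {linear talg A B -> U}) :
  (forall a b, f (pure a b) = g (pure a b)) -> f =1 g.
Proof.
by move=> fg; apply: (@tens_ext k A B U f g).
Qed.

Lemma talg_mul1l : left_id talg_one talg_mul.
Proof.
by apply: (@talg_ext _ (talg_mul _) idfun) => a b /=; rewrite talg_mul_pure !mul1r.
Qed.

Lemma talg_mul1r : right_id talg_one talg_mul.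
Proof.
by apply: (@talg_ext _ (talg_mulr _) idfun) => a b; rewrite /= /talg_mulr talg_mul_pure !mulr1.
Qed.

Lemma talg_mulA : associative talg_mul.
Proof.
move=> x y z; move: x.
apply: (@talg_ext _ (talg_mulr (talg_mul y z)) (talg_mulr z \o talg_mulr y)) => a b.
rewrite /= /talg_mulr; move: y.
apply: (@talg_ext _ (talg_mul (pure a b) \o talg_mulr z)
                    (talg_mulr z \o talg_mul (pure a b))) => a' b'.
rewrite /= /talg_mulr; move: z.
apply: (@talg_ext _ (talg_mul (pure a b) \o talg_mul (pure a' b'))
                    (talg_mul (talg_mul (pure a b) (pure a' b')))) => a'' b''.
by rewrite /= !talg_mul_pure !mulrA.
Qed.

Lemma talg_mulDl : left_distributive talg_mul +%R.
Proof. by move=> x y z; rewrite -!/(talg_mulr z _) linearD. Qed.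

Lemma talg_mulDr : right_distributive talg_mul +%R.
Proof. by move=> x y z; rewrite linearD. Qed.

Lemma talg_one_neq0 : talg_one != 0.
Proof. by rewrite pure_eq0 !oner_eq0. Qed.

HB.instance Definition _ := GRing.Zmodule_isNzRing.Build (talg A B)
  talg_mulA talg_mul1l talg_mul1r talg_mulDl talg_mulDr talg_one_neq0.

Lemma talg_scaleAl c (x y : talg A B) : c *: (x * y) = (c *: x) * y.
Proof. by rewrite -[RHS]/(talg_mulr y _) linearZ. Qed.

HB.instance Definition _ :=
  GRing.Lmodule_isLalgebra.Build k (talg A B) talg_scaleAl.

Lemma talg_scaleAr c (x y : talg A B) : c *: (x * y) = x * (c *: y).
Proof. by rewrite -[RHS]/(talg_mul x _) linearZ. Qed.

HB.instance Definition _ :=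
  GRing.Lalgebra_isAlgebra.Build k (talg A B) talg_scaleAr.

HB.instance Definition _ := Algebra_isFalgebra.Build k (talg A B).

Lemma talg_pureM a b a' b' :
  (pure a b : talg A B) * pure a' b' = pure (a * a') (b * b').
Proof. exact: talg_mul_pure. Qed.

End TensorAlgebra.

(* Over a finite dimensional algebra, a module is finitely generated iff it is
   finite dimensional over k: the carrier is a [vectType k], and the algebra
   acts by k-linear endomorphisms. *)
Record module (k : fieldType) (A : falgType k) := Module {
  mod_sort :> vectType k;
  act : 'Hom(A, 'End(mod_sort));
  act1 : act 1 = \1%VF;
  actM : forall a b, act (a * b) = (act a \o act b)%VF }.

Record rmodule (k : fieldType) (A : falgType k) := RModule {
  rmod_sort :> vectType k;
  ract : 'Hom(A, 'End(rmod_sort));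
  ract1 : ract 1 = \1%VF;
  ractM : forall a b, ract (a * b) = (ract b \o ract a)%VF }.

Record bimodule (k : fieldType) (A L : falgType k) := Bimodule {
  bimod_rmod :> rmodule L;
  lact : 'Hom(A, 'End(bimod_rmod));
  lact1 : lact 1 = \1%VF;
  lactM : forall a b, lact (a * b) = (lact a \o lact b)%VF;
  lactC : forall a l, (lact a \o ract bimod_rmod l = ract bimod_rmod l \o lact a)%VF }.

Section Builders.
Variables (k : fieldType) (A : falgType k) (V : vectType k).

Section Left.
Variable e : A -> V -> V.
Hypotheses (eL : bilin e) (e1 : forall v, e 1 v = v).
Hypothesis eM : forall a b v, e (a * b) v = e a (e b v).

Lemma mkmodule1 : lfun2 e 1 = \1%VF.
Proof. by apply/lfunP=> v; rewrite lfun2E // e1 id_lfunE. Qed.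

Lemma mkmoduleM a b : lfun2 e (a * b) = (lfun2 e a \o lfun2 e b)%VF.
Proof. by apply/lfunP=> v; rewrite comp_lfunE !lfun2E // eM. Qed.

Definition mkmodule : module A := Module mkmodule1 mkmoduleM.
End Left.

Section Right.
Variable e : A -> V -> V.
Hypotheses (eL : bilin e) (e1 : forall v, e 1 v = v).
Hypothesis eM : forall a b v, e (a * b) v = e b (e a v).

Lemma mkrmodule1 : lfun2 e 1 = \1%VF.
Proof. exact: mkmodule1. Qed.

Lemma mkrmoduleM a b : lfun2 e (a * b) = (lfun2 e b \o lfun2 e a)%VF.
Proof. by apply/lfunP=> v; rewrite comp_lfunE !lfun2E // eM. Qed.

Definition mkrmodule : rmodule A := RModule mkrmodule1 mkrmoduleM.
End Right.

End Builders.

Section Modules.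
Variables (k : fieldType) (A : falgType k).
Implicit Types G I L M N P S : module A.

Definition is_hom M N (f : 'Hom(M, N)) : Prop :=
  forall a x, f (act M a x) = act N a (f x).

Lemma mul_bilin : bilin (@GRing.mul A).
Proof.
split=> [w c u v|v c u w].
  by rewrite mulrDl scalerAl.
by rewrite mulrDr scalerAr.
Qed.

Definition regular : module A :=
  mkmodule mul_bilin (@mul1r A) (fun a b c => esym (mulrA a b c)).

Definition injective_hom M N (f : 'Hom(M, N)) : Prop :=
  is_hom f /\ lker f = 0%VS.
Definition surjective_hom M N (f : 'Hom(M, N)) : Prop :=
  is_hom f /\ limg f = fullv.

Definition short_exact L M N (f : 'Hom(L, M)) (g : 'Hom(M, N)) : Prop :=
  [/\ injective_hom f, surjective_hom g & limg f = lker g].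

Definition projective P : Prop :=
  forall M N (g : 'Hom(M, N)) (f : 'Hom(P, N)),
    surjective_hom g -> is_hom f ->
    exists h : 'Hom(P, M), is_hom h /\ (g \o h)%VF = f.

Definition injective_module I : Prop :=
  forall M N (g : 'Hom(M, N)) (f : 'Hom(M, I)),
    injective_hom g -> is_hom f ->
    exists h : 'Hom(N, I), is_hom h /\ (h \o g)%VF = f.

Definition simple_module S : Prop :=
  (fullv : {vspace S}) <> 0%VS /\
  forall U : {vspace S}, (forall a, (act S a @: U <= U)%VS) ->
    U = 0%VS \/ U = fullv.

Definition isomorphic M N : Prop :=
  exists f : 'Hom(M, N), injective_hom f /\ surjective_hom f.

(* The modules P^i, the exactness of P and of Hom_A(P, A), and an identification
   u of G with Ker d^1. *)
Definition gorenstein_projective G : Prop :=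
  exists (P : int -> module A) (d : forall i, 'Hom(P i, P (i + 1))),
    [/\ forall i, projective (P i) /\ is_hom (d i),
        forall i, limg (d i) = lker (d (i + 1)),
        forall i (f : 'Hom(P (i + 1), regular)), is_hom f ->
          ((f \o d i)%VF = 0 <->
           exists g : 'Hom(P (i + 1 + 1), regular),
             is_hom g /\ f = (g \o d (i + 1))%VF)
      & exists u : 'Hom(G, P 1), injective_hom u /\ limg u = lker (d 1)].

End Modules.

(* left selfinjective; for finite dimensional algebras this is the same as right
   selfinjective *)
Definition selfinjective (k : fieldType) (A : falgType k) : Prop :=
  injective_module (regular A).

Section Quotient.
Variables (k : fieldType) (V : vectType k) (U : {vspace V}).

(* V / U, realised on the chosen complement of U *)
Definition quotv : vectType k := subvs_of (U^C)%VS.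
Definition quotv_pi : 'Hom(V, quotv) := (linfun (vsproj (U^C)%VS) \o (\1 - projv U))%VF.
Definition quotv_repr : 'Hom(quotv, V) := linfun vsval.

Lemma lker_quotv_pi : lker quotv_pi = U.
Proof.
apply/vspaceP=> v; rewrite memv_ker /quotv_pi comp_lfunE lfunE /=.
rewrite add_lfunE opp_lfunE id_lfunE; apply/eqP/idP=> [/(congr1 vsval)|Uv].
  rewrite vsprojK ?memv_projC // linear0 => /eqP.
  by rewrite subr_eq0 => /eqP->; apply: memv_proj.
by rewrite projv_id // subrr linear0.
Qed.

Lemma quotv_reprK q : quotv_pi (quotv_repr q) = q.
Proof.
apply: val_inj; rewrite /= /quotv_pi comp_lfunE lfunE /= add_lfunE opp_lfunE id_lfunE.
rewrite vsprojK ?memv_projC // lfunE /=.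
suff /eqP-> : projv U (vsval q) == 0 by rewrite subr0.
by rewrite -memv_ker lker_proj subvsP.
Qed.

Lemma quotv_pi_eq u v : (quotv_pi u == quotv_pi v) = (u - v \in U).
Proof.
suff -> : (u - v \in U) = (u - v \in lker quotv_pi).
  by rewrite memv_ker linearB subr_eq0.
by rewrite lker_quotv_pi.
Qed.

Lemma quotv_piK v : quotv_repr (quotv_pi v) - v \in U.
Proof. by rewrite -quotv_pi_eq quotv_reprK. Qed.

Lemma limg_quotv_pi : limg quotv_pi = fullv.
Proof.
by apply/vspaceP=> q; rewrite memvf; apply/memv_imgP;
   exists (quotv_repr q); rewrite ?memvf ?quotv_reprK.
Qed.

End Quotient.

Section QuotientMap.
Variables (k : fieldType) (V W : vectType k).
Variables (U : {vspace V}) (U' : {vspace W}).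

Definition quotv_map (f : 'Hom(V, W)) : 'Hom(quotv U, quotv U') :=
  (quotv_pi U' \o f \o quotv_repr U)%VF.

Lemma quotv_mapE f v : (f @: U <= U')%VS ->
  quotv_map f (quotv_pi U v) = quotv_pi U' (f v).
Proof.
move=> /subvP sUU'; rewrite [LHS]comp_lfunE [LHS]comp_lfunE.
by apply/eqP; rewrite quotv_pi_eq -linearB; apply/sUU'/memv_img/quotv_piK.
Qed.

Lemma quotv_lfunP (X : vectType k) (f g : 'Hom(quotv U, X)) :
  (forall v, f (quotv_pi U v) = g (quotv_pi U v)) -> f = g.
Proof. by move=> fg; apply/lfunP=> q; rewrite -(quotv_reprK q). Qed.

End QuotientMap.

Section BalancedTensor.
Variables (k : fieldType) (L : falgType k).
Implicit Types (M N : rmodule L) (X Y : module L).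

(* spanned by all  m l (x) x - m (x) l x ; basis elements l suffice *)
Definition balance M X : {vspace tens M X} :=
  (\sum_i limg (tmap (ract M (vbase i)) \1 - tmap \1 (act X (vbase i))))%VS.

Definition rtens M X : vectType k := quotv (balance M X).

Definition rpure M X (m : M) (x : X) : rtens M X :=
  quotv_pi (balance M X) (pure m x).

Definition rtens_map M X Y (f : 'Hom(X, Y)) : 'Hom(rtens M X, rtens M Y) :=
  quotv_map (balance M X) (balance M Y) (tmap \1 f).

Lemma balanceP M X l (m : M) (x : X) :
  pure (ract M l m) x - pure m (act X l x) \in balance M X.
Proof.
rewrite [l]vbaseE !linear_sum !sum_lfunE.
have -> : pure (\sum_i ract M (v2r l 0 i *: vbase i) m) x
        = \sum_i v2r l 0 i *: pure (ract M (vbase i) m) x.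
  elim/big_rec2: _ => [|i y1 y2 _ <-].
    by apply/eqP; rewrite pure_eq0 eqxx.
  by rewrite pureDl linearZ /= scale_lfunE pureZl.
have -> : pure m (\sum_i act X (v2r l 0 i *: vbase i) x)
        = \sum_i v2r l 0 i *: pure m (act X (vbase i) x).
  elim/big_rec2: _ => [|i y1 y2 _ <-].
    by apply/eqP; rewrite pure_eq0 eqxx orbT.
  by rewrite pureDr linearZ /= scale_lfunE pureZr.
rewrite -sumrB; apply: memv_suml => i _; rewrite -scalerBr memvZ //.
apply: (subvP (sumv_sup i _ (subvv _))) => //.
apply/memv_imgP; exists (pure m x); first exact: memvf.
by rewrite add_lfunE opp_lfunE !tmap_pure !id_lfunE.
Qed.

Lemma rpure_balanced M X l (m : M) (x : X) :
  rpure (ract M l m) x = rpure m (act X l x).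
Proof.
by apply/eqP; rewrite quotv_pi_eq balanceP.
Qed.

Lemma balance_sub M X (U : vectType k) (f : 'Hom(tens M X, U)) :
    (forall l m x, f (pure (ract M l m) x) = f (pure m (act X l x))) ->
  (balance M X <= lker f)%VS.
Proof.
move=> fb; apply/subv_sumP=> i _; apply/subvP=> _ /memv_imgP[y _ ->].
rewrite memv_ker -comp_lfunE; apply/eqP; rewrite -[RHS](zero_lfunE _ y).
congr (fun_of_lfun _ y); apply: tens_lfunP => m x.
by rewrite comp_lfunE add_lfunE opp_lfunE !tmap_pure !id_lfunE linearB /= fb subrr zero_lfunE.
Qed.

Lemma balance_map M N X Y (f : 'Hom(M, N)) (g : 'Hom(X, Y)) :
    (forall l m, f (ract M l m) = ract N l (f m)) -> is_hom g ->
  (tmap f g @: balance M X <= balance N Y)%VS.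
Proof.
move=> fh gh; apply/subvP=> _ /memv_imgP[y By ->].
suff /subvP/(_ y By) : (balance M X <=
    lker (quotv_pi (balance N Y) \o tmap f g))%VS.
  by rewrite memv_ker comp_lfunE -(linear0 (quotv_pi (balance N Y)))
             quotv_pi_eq subr0.
apply: balance_sub => l m x.
rewrite [LHS]comp_lfunE [RHS]comp_lfunE !tmap_pure fh gh.
exact: rpure_balanced.
Qed.

Lemma rtens_map_pure M X Y (f : 'Hom(X, Y)) m x :
  is_hom f -> rtens_map M f (rpure m x) = rpure m (f x).
Proof.
move=> fh; rewrite /rtens_map /rpure quotv_mapE ?tmap_pure ?id_lfunE //.
by apply: balance_map => // l m'; rewrite !id_lfunE.
Qed.

End BalancedTensor.

Section BimoduleTensor.
Variables (k : fieldType) (A L : falgType k) (M : bimodule A L) (X : module L).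

Definition btens_mul (a : A) : rtens M X -> rtens M X :=
  quotv_map (balance M X) (balance M X) (tmap (lact M a) \1).

Lemma btens_mulE a v :
  btens_mul a (quotv_pi _ v) = quotv_pi _ (tmap (lact M a) \1 v).
Proof.
rewrite /btens_mul quotv_mapE //; apply: balance_map => [l m|l m].
  by have /lfunP/(_ m) := lactC M a l; rewrite !comp_lfunE.
by rewrite !id_lfunE.
Qed.

Lemma btens_mul_bilin : bilin btens_mul.
Proof.
split=> [q c a b|a c u v]; last by rewrite /btens_mul linearP.
rewrite -(quotv_reprK q) !btens_mulE -linearP.
by rewrite [lact M _]linearP (tmap_is_bilin _ _ _ _).1 add_lfunE scale_lfunE.
Qed.

Lemma btens_mul1 q : btens_mul 1 q = q.
Proof. by rewrite -(quotv_reprK q) btens_mulE lact1 tmap1 id_lfunE. Qed.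

Lemma btens_mulM a b q : btens_mul (a * b) q = btens_mul a (btens_mul b q).
Proof.
rewrite -(quotv_reprK q) !btens_mulE -[in RHS]comp_lfunE tmap_comp.
by rewrite lactM comp_lfun1l.
Qed.

Definition btens : module A := mkmodule btens_mul_bilin btens_mul1 btens_mulM.

End BimoduleTensor.

Section AtensV.
Variables (k : fieldType) (A B : falgType k) (V : rmodule B).

(* (a (x) v) (a' (x) b') = a a' (x) v b' *)
Definition AV_rmul (l : talg A B) (x : tens A V) : tens A V :=
  tlift (fun a b => tmap (amulr a) (ract V b)) l x.

(* a' (a (x) v) = a' a (x) v *)
Definition AV_lmul (a : A) (x : tens A V) : tens A V := tmap (amull a) \1 x.

Lemma AV_rmul_bilin : bilin AV_rmul.
Proof.
by split=> [x c u v|l c u v]; rewrite /AV_rmul linearP ?add_lfunE ?scale_lfunE.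
Qed.

Lemma AV_lmul_bilin : bilin AV_lmul.
Proof.
split=> [x c u v|l c u v]; rewrite /AV_lmul linearP //.
by rewrite (tmap_is_bilin _ _ _ _).1 add_lfunE scale_lfunE.
Qed.

Lemma AV_rmul_pure a b x : AV_rmul (pure a b) x = tmap (amulr a) (ract V b) x.
Proof.
congr (fun_of_lfun _ x); rewrite tlift_pure //.
split=> [w c u v|v c u w]; rewrite linearP.
  by rewrite (tmap_is_bilin _ _ _ _).1.
by rewrite (tmap_is_bilin _ _ _ _).2.
Qed.

Lemma AV_rmul1 x : AV_rmul 1 x = x.
Proof.
rewrite -[1]/(pure 1 1) AV_rmul_pure ract1.
suff -> : amulr 1 = \1%VF :> 'End(A) by rewrite tmap1 id_lfunE.
by apply/lfunP=> a; rewrite lfunE /= mulr1 id_lfunE.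
Qed.

Lemma AV_rmulM l1 l2 x : AV_rmul (l1 * l2) x = AV_rmul l2 (AV_rmul l1 x).
Proof.
have bl := AV_rmul_bilin; have [bl1 bl2] := bl.
pose R z : {linear tens A V -> tens A V} :=
  HB.pack_for {linear tens A V -> tens A V} (AV_rmul z)
    (GRing.isLinear.Build k _ _ _ (AV_rmul z) (bl2 z)).
pose E y : {linear talg A B -> tens A V} :=
  HB.pack_for {linear talg A B -> tens A V} (AV_rmul^~ y)
    (GRing.isLinear.Build k _ _ _ (AV_rmul^~ y) (bl1 y)).
move: l1; apply: (@talg_ext _ _ _ _ (E x \o talg_mulr l2) (R l2 \o E x)) => a1 b1.
rewrite /= /talg_mulr; move: l2.
apply: (@talg_ext _ _ _ _ (E x \o talg_mul (pure a1 b1))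
          (E (AV_rmul (pure a1 b1) x))) => a2 b2.
rewrite /= talg_mul_pure !AV_rmul_pure -comp_lfunE tmap_comp ractM.
congr (fun_of_lfun (tmap _ _) x).
by apply/lfunP=> a; rewrite comp_lfunE !lfunE /= mulrA.
Qed.

Lemma AV_lmul1 x : AV_lmul 1 x = x.
Proof. by rewrite /AV_lmul amull1 tmap1 id_lfunE. Qed.

Lemma AV_lmulM a b x : AV_lmul (a * b) x = AV_lmul a (AV_lmul b x).
Proof. by rewrite /AV_lmul -comp_lfunE tmap_comp comp_lfun1l amullM. Qed.

Lemma AV_lrmulC a l x : AV_lmul a (AV_rmul l x) = AV_rmul l (AV_lmul a x).
Proof.
have [bl1 _] := AV_rmul_bilin.
pose E y : {linear talg A B -> tens A V} :=
  HB.pack_for {linear talg A B -> tens A V} (AV_rmul^~ y)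
    (GRing.isLinear.Build k _ _ _ (AV_rmul^~ y) (bl1 y)).
move: l; apply: (@talg_ext _ _ _ _ (tmap (amull a) \1 \o E x)
                  (E (AV_lmul a x))) => a' b /=.
rewrite /AV_lmul !AV_rmul_pure -!comp_lfunE !tmap_comp comp_lfun1l comp_lfun1r.
congr (fun_of_lfun (tmap _ _) x).
by apply/lfunP=> y; rewrite !comp_lfunE !lfunE /= mulrA.
Qed.

Definition AV_rmodule : rmodule (talg A B) :=
  mkrmodule AV_rmul_bilin AV_rmul1 AV_rmulM.

Lemma AV_lact1 : lfun2 AV_lmul 1 = \1%VF.
Proof. exact: mkmodule1 AV_lmul_bilin AV_lmul1. Qed.

Lemma AV_lactM a b :
  lfun2 AV_lmul (a * b) = (lfun2 AV_lmul a \o lfun2 AV_lmul b)%VF.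
Proof. exact: mkmoduleM AV_lmul_bilin AV_lmulM a b. Qed.

Lemma AV_lactC a l :
  (lfun2 AV_lmul a \o lfun2 AV_rmul l = lfun2 AV_rmul l \o lfun2 AV_lmul a)%VF.
Proof.
apply/lfunP=> x; rewrite !comp_lfunE.
rewrite !(lfun2E _ _ AV_rmul_bilin) !(lfun2E _ _ AV_lmul_bilin).
exact: AV_lrmulC.
Qed.

Definition AtensV : bimodule A (talg A B) :=
  @Bimodule k A (talg A B) AV_rmodule (lfun2 AV_lmul) AV_lact1 AV_lactM AV_lactC.

End AtensV.

Section Dual.
Variables (k : fieldType) (B : falgType k) (S : module B).

Definition dual_mul (b : B) (f : 'Hom(S, k^o)) : 'Hom(S, k^o) :=
  (f \o act S b)%VF.

Lemma dual_mul_bilin : bilin dual_mul.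
Proof.
split=> [f c a b|b c f g]; rewrite /dual_mul.
  by rewrite linearP comp_lfunDr comp_lfunZr.
by rewrite comp_lfunDl comp_lfunZl.
Qed.

Lemma dual_mul1 f : dual_mul 1 f = f.
Proof. by rewrite /dual_mul act1 comp_lfun1r. Qed.

Lemma dual_mulM a b f : dual_mul (a * b) f = dual_mul b (dual_mul a f).
Proof. by rewrite /dual_mul actM comp_lfunA. Qed.

(* D(S) = Hom_k(S, k), with (f b)(s) = f(b s) *)
Definition dual : rmodule B := mkrmodule dual_mul_bilin dual_mul1 dual_mulM.

End Dual.

Record proj_resolution (k : fieldType) (L : falgType k) (X : module L) :=
  ProjResolution {
    res_obj : nat -> module L;
    res_d : forall n, 'Hom(res_obj n.+1, res_obj n);
    res_aug : 'Hom(res_obj 0, X);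
    res_proj : forall n, projective (res_obj n);
    res_d_hom : forall n, is_hom (res_d n);
    res_aug_surj : surjective_hom res_aug;
    res_exact0 : limg (res_d 0) = lker res_aug;
    res_exact : forall n, limg (res_d n.+1) = lker (res_d n) }.

(* Tor_i^L(M, X) = 0, that is H_i(M (x)_L P) = 0 for a projective resolution P
   of X; this does not depend on the choice of P. *)
Definition Tor_zero (k : fieldType) (L : falgType k) (i : nat)
    (M : rmodule L) (X : module L) : Prop :=
  exists P : proj_resolution X,
    match i with
    | 0 => limg (rtens_map M (res_d P 0)) = fullv
    | n.+1 => limg (rtens_map M (res_d P n.+1)) = lker (rtens_map M (res_d P n))
    end.

Section ExactCategory.
Variables (k : fieldType) (L : falgType k).
Implicit Types (C : module L -> Prop) (X Y Z : module L).

Definition exact_subcategory C : Prop :=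
  [/\ forall X, (fullv : {vspace X}) = 0%VS -> C X,
      forall X Y, isomorphic X Y -> C X -> C Y
    & forall X Y Z (f : 'Hom(X, Y)) (g : 'Hom(Y, Z)),
        short_exact f g -> C X -> C Z -> C Y].

Definition conflation C X Y Z (f : 'Hom(X, Y)) (g : 'Hom(Y, Z)) : Prop :=
  [/\ C X, C Y, C Z & short_exact f g].

Definition projective_object C P : Prop :=
  C P /\
  forall X Y Z (f : 'Hom(X, Y)) (g : 'Hom(Y, Z)) (u : 'Hom(P, Z)),
    conflation C f g -> is_hom u ->
    exists v : 'Hom(P, Y), is_hom v /\ (g \o v)%VF = u.

Definition injective_object C I : Prop :=
  C I /\
  forall X Y Z (f : 'Hom(X, Y)) (g : 'Hom(Y, Z)) (u : 'Hom(X, I)),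
    conflation C f g -> is_hom u ->
    exists v : 'Hom(Y, I), is_hom v /\ (v \o f)%VF = u.

Definition enough_projectives C : Prop :=
  forall Z, C Z -> exists X Y (f : 'Hom(X, Y)) (g : 'Hom(Y, Z)),
    conflation C f g /\ projective_object C Y.

Definition enough_injectives C : Prop :=
  forall X, C X -> exists Y Z (f : 'Hom(X, Y)) (g : 'Hom(Y, Z)),
    conflation C f g /\ injective_object C Y.

Definition frobenius C : Prop :=
  [/\ exact_subcategory C, enough_projectives C, enough_injectives C
    & forall X, projective_object C X <-> injective_object C X].

End ExactCategory.

Section Mon.
Variables (k : fieldType) (B A : falgType k).

Definition Mon (X : module (talg A B)) : Prop :=
  forall S : module B, simple_module S ->
  forall i : nat, (1 <= i)%N -> Tor_zero i (AtensV A (dual S)) X.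

Definition MonL (C : module A -> Prop) (X : module (talg A B)) : Prop :=
  Mon X /\ forall V : rmodule B, C (btens (AtensV A V) X).

End Mon.

Arguments Mon {k} B A X.
Arguments MonL {k} B {A} C X.

(* Main.v *)
From HB Require Import structures.
Require Import Defs.
From mathcomp Require Import all_boot all_order all_algebra falgebra.
From mathcomp Require Import boolp.

(* The module (A (x) V) (x)_Lambda X is V (x)_B X, and Tor_i^Lambda(A (x) V, X) =
   Tor_i^B(V, X); as D(S) runs through the simple right B-modules, Mon(B, A)
   consists of the X that are projective over B.

   V (x)_B - is left adjoint to Hom_k(V, -) : A-mod -> Lambda-mod.  Since
   Lambda = Hom_k(D(B), A), maps from X to a projective Lambda-module are
   A-maps from D(B) (x)_B X to a projective A-module, so they extend along
   inflations of Mon(B, A-Gproj).  If D(B) (x)_B X embeds into a projective A-module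
   Q with Gorenstein projective cokernel, the adjoint X -> Hom_k(D(B), Q) is split
   over B, and its cokernel is again in Mon(B, A-Gproj).

   If Mon(B, A) is Frobenius, or equal to Mon(B, A-Gproj), then
   Hom_k(D(B), A) is injective in it; testing this on Hom_k(D(B), M) ->
   Hom_k(D(B), N) for M -> N injective shows that A is injective.  Conversely, if A
   is injective as a left module, every module embeds into a free one: a
   nonzero module without maps to A would give an infinite strictly descending
   chain of two-sided ideals. *)

Set Implicit Arguments.
Unset Strict Implicit.
Unset Printing Implicit Defensive.

Import GRing.Theory VectorInternalTheory.
Local Open Scope ring_scope.

(** * Modules *)

(** [Mon] tests Tor against the modules D(S) only. For a first syzygy K -> P of X, injectivity of
    D(S) (x)_B K -> D(S) (x)_B P passes along a composition series of K to D(K); the evaluation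
    pairing D(K) (x)_B K -> k then extends to P, which amounts to a B-linear retraction P -> K.

    The cokernel Z of X -> Hom_k(D(B), Q) has to be tested against every V, although Q was chosen
    for V = D(B). Since V embeds into copies of D(B), a map V (x)_B X -> A is first extended to
    these copies, by the condition on X for the cokernel of that embedding, and then along D(B)
    (x)_B X -> Q.

    Selfinjectivity is assumed on the left, so it gives annihilator identities on one side: rann
    (lann I) = I for right ideals I, and rann (L cap L') = rann L + rann L' for left ideals. The
    missing fact is that a proper left ideal has a nonzero right annihilator. By the second identity
    the left ideals with a given right annihilator are closed under intersection, and the smallest
    ones provide the ideals of the descending chain. *)

Section LinearAlgebra.
Variable k : fieldType.
Implicit Types V W U : vectType k.

Lemma lfun_ex V W (f : V -> W) :
  linear f -> exists F : 'Hom(V, W), forall x, F x = f x.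
Proof.
move=> fL; pose G := HB.pack_for {linear V -> W} f
  (GRing.isLinear.Build k V W _ _ fL).
by exists (linfun G) => x; rewrite (lfunE G).
Qed.

Lemma linfunE V W (f : V -> W) : linear f -> linfun f =1 f.
Proof. by case/lfun_ex=> F /funext<- x; rewrite fun_of_lfunK. Qed.

(** Vectors satisfying [P] are adjoined one at a time; the codimension bounds the number of rounds.
    This turns kernels, images and annihilators given by formulas into subspaces. *)
Lemma subspace_ex V (P : V -> Prop) :
    P 0 -> (forall c x y, P x -> P y -> P (c *: x + y)) ->
  exists U : {vspace V}, forall x, x \in U <-> P x.
Proof.
move=> P0 PL.
suff H n (U : {vspace V}) : (\dim {:V} - \dim U <= n)%N ->
    (forall x, x \in U -> P x) ->
    exists U' : {vspace V}, forall x, x \in U' <-> P x.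
  apply: (H (\dim {:V}) 0%VS); first by rewrite dimv0 subn0.
  by move=> x; rewrite memv0 => /eqP->.
elim: n U => [|n IHn] U dU UP.
  exists U => x; split=> [/UP//|_]; suff -> : U = fullv by rewrite memvf.
  by apply/eqP; rewrite eqEdim subvf -subn_eq0 -leqn0.
have [[x Px xU]|nex] := pselect (exists2 x, P x & x \notin U); last first.
  by exists U => x; split=> [/UP//|Px]; apply: contrapT => /negP xU; case: nex; exists x.
apply: (IHn (U + <[x]>)%VS); last first.
  move=> y /memv_addP[u uU [_ /vlineP[c ->] ->]].
  by rewrite addrC; apply: PL => //; apply: UP.
have : (\dim U < \dim (U + <[x]>))%N.
  rewrite (ltn_leqif (dimv_leqif_sup (addvSl U _))); apply: contra xU => /subvP; apply.
  by apply: (subvP (addvSr U _)); apply: memv_line.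
move=> lt; move: dU; rewrite !leq_subLR => dU.
by apply: leq_trans dU _; rewrite addnS -addSn leq_add2r.
Qed.

Lemma lfun_injP V W (f : 'Hom(V, W)) :
  lker f = 0%VS <-> forall x, f x = 0 -> x = 0.
Proof.
split=> [k0 x /eqP|H]; first by rewrite -memv_ker k0 memv0 => /eqP.
by apply/eqP; rewrite -subv0; apply/subvP=> x; rewrite memv_ker memv0 => /eqP/H->.
Qed.

Lemma lfun_surjP V W (f : 'Hom(V, W)) :
  limg f = fullv <-> forall y, exists x, f x = y.
Proof.
split=> [fS y|H].
  have /memv_imgP[x _ ->] : y \in limg f by rewrite fS memvf.
  by exists x.
apply/vspaceP=> y; rewrite memvf; have [x <-] := H y.
by rewrite memv_img ?memvf.
Qed.

Lemma limgP V W (f : 'Hom(V, W)) y : y \in limg f <-> exists x, f x = y.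
Proof.
split=> [/memv_imgP[x _ ->]|[x <-]]; first by exists x.
by rewrite memv_img ?memvf.
Qed.

Lemma lfun_section V W (f : 'Hom(V, W)) : (forall y, exists x, f x = y) ->
  exists s : 'Hom(W, V), forall y, f (s y) = y.
Proof.
move=> /lfun_surjP fS; exists (f^-1)%VF => y.
by apply: limg_lfunVK; rewrite fS memvf.
Qed.

Lemma lfun_retraction V W (f : 'Hom(V, W)) : (forall x, f x = 0 -> x = 0) ->
  exists r : 'Hom(W, V), forall x, r (f x) = x.
Proof.
by move=> /lfun_injP fI; exists (f^-1)%VF; apply: lker0_lfunK; apply/eqP.
Qed.

Lemma vzeroP V : (fullv : {vspace V}) = 0%VS <-> forall x : V, x = 0.
Proof.
split=> [V0 x|H]; first by apply/eqP; rewrite -memv0 -V0 memvf.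
by apply/eqP; rewrite -subv0; apply/subvP=> x _; rewrite (H x) mem0v.
Qed.

End LinearAlgebra.

Section ModuleTools.
Variables (k : fieldType) (A : falgType k).
Implicit Types E K L M N P Q G : module A.

Lemma act1E M x : act M 1 x = x.
Proof. by rewrite act1 id_lfunE. Qed.

Lemma actME M a b x : act M (a * b) x = act M a (act M b x).
Proof. by rewrite actM comp_lfunE. Qed.

Lemma act_bilin M : bilin (fun a x => act M a x).
Proof.
by split=> [x c a b|a c x y]; rewrite linearP // add_lfunE scale_lfunE.
Qed.

Lemma mkmoduleE (V : vectType k) (e : A -> V -> V) (eL : bilin e) e1 eM a v :
  act (mkmodule eL e1 eM) a v = e a v.
Proof. exact: lfun2E. Qed.

Lemma regularE (a b : A) : act (regular A) a b = a * b.
Proof. exact: mkmoduleE. Qed.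

Lemma is_hom1 M : is_hom (\1%VF : 'Hom(M, M)).
Proof. by move=> a x; rewrite !id_lfunE. Qed.

Lemma is_hom_comp L M N (g : 'Hom(M, N)) (f : 'Hom(L, M)) :
  is_hom g -> is_hom f -> is_hom (g \o f)%VF.
Proof. by move=> gH fH a x; rewrite !comp_lfunE fH gH. Qed.

Lemma is_hom0 M N : is_hom (0 : 'Hom(M, N)).
Proof. by move=> a x; rewrite !zero_lfunE linear0. Qed.

Lemma is_homD M N (f g : 'Hom(M, N)) : is_hom f -> is_hom g -> is_hom (f + g).
Proof. by move=> fH gH a x; rewrite !add_lfunE fH gH linearD. Qed.

Lemma is_homB M N (f g : 'Hom(M, N)) : is_hom f -> is_hom g -> is_hom (f - g).
Proof. by move=> fH gH a x; rewrite !add_lfunE !opp_lfunE fH gH linearB. Qed.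

Lemma is_hom_sum M N (I : finType) (f : I -> 'Hom(M, N)) :
  (forall i, is_hom (f i)) -> is_hom (\sum_i f i).
Proof.
move=> fH; elim/big_rec: _ => [|i g _ gH]; first exact: is_hom0.
exact: is_homD.
Qed.

Lemma hom_ex M N (f : M -> N) : linear f ->
    (forall a x, f (act M a x) = act N a (f x)) ->
  exists F : 'Hom(M, N), is_hom F /\ forall x, F x = f x.
Proof.
by move=> /lfun_ex[F FE] fH; exists F; split=> // a x; rewrite !FE fH.
Qed.

Lemma short_exactP L M N (f : 'Hom(L, M)) (g : 'Hom(M, N)) :
  short_exact f g <->
  [/\ is_hom f, is_hom g, forall x, f x = 0 -> x = 0,
      forall z, exists y, g y = z & forall y, g y = 0 <-> exists x, f x = y].
Proof.
split=> [[[fH /lfun_injP fI] [gH /lfun_surjP gS] fg]|[fH gH fI gS fg]].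
  by split=> // y; rewrite -limgP fg memv_ker; split=> [->|/eqP].
split; [by split=> //; apply/lfun_injP|by split=> //; apply/lfun_surjP|].
apply/vspaceP=> y; rewrite memv_ker; apply/idP/eqP=> [/limgP/fg|/fg/limgP]//.
Qed.

Lemma short_exact0 L M N (f : 'Hom(L, M)) (g : 'Hom(M, N)) x :
  short_exact f g -> g (f x) = 0.
Proof. by move=> /short_exactP[_ _ _ _ fg]; apply/fg; exists x. Qed.

Section Submodule.
Variables (M : module A) (U : {vspace M}).
Hypothesis UA : forall a x, x \in U -> act M a x \in U.

Definition sub_act (a : A) (x : subvs_of U) : subvs_of U :=
  vsproj U (act M a (vsval x)).

Lemma sub_actE a x : vsval (sub_act a x) = act M a (vsval x).
Proof. by rewrite vsprojK // UA ?subvsP. Qed.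

Lemma sub_act_bilin : bilin sub_act.
Proof.
split=> [x c a b|a c x y]; apply: val_inj.
  rewrite [RHS]linearP /= !sub_actE (act_bilin M).1 //.
by rewrite [RHS]linearP /= !sub_actE !linearP.
Qed.

Lemma sub_act1 x : sub_act 1 x = x.
Proof. by apply: val_inj; rewrite /= sub_actE act1E. Qed.

Lemma sub_actM a b x : sub_act (a * b) x = sub_act a (sub_act b x).
Proof. by apply: val_inj; rewrite /= !sub_actE actME. Qed.

Definition submodule : module A := mkmodule sub_act_bilin sub_act1 sub_actM.

End Submodule.

Lemma submodule_ex M (P : M -> Prop) :
    P 0 -> (forall c x y, P x -> P y -> P (c *: x + y)) ->
    (forall a x, P x -> P (act M a x)) ->
  exists (K : module A) (i : 'Hom(K, M)),
    [/\ is_hom i, forall x, i x = 0 -> x = 0 & forall y, P y <-> exists x, i x = y].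
Proof.
move=> P0 PL PA; have [U UP] := subspace_ex P0 PL.
have UA a x : x \in U -> act M a x \in U by move=> /UP/(PA a)/UP.
exists (submodule UA); exists (linfun (vsval : subvs_of U -> M)).
have iE (x : subvs_of U) : linfun (vsval : subvs_of U -> M) x = vsval x by rewrite lfunE.
split=> [a x|x|y]; first by rewrite !iE mkmoduleE sub_actE.
  by rewrite iE => x0; apply: val_inj; rewrite /= x0.
rewrite -UP; split=> [yU|[x <-]]; last by rewrite iE subvsP.
by exists (vsproj U y); rewrite iE vsprojK.
Qed.

Section QuotientModule.
Variables (M : module A) (U : {vspace M}).
Hypothesis UA : forall a x, x \in U -> act M a x \in U.

Definition quot_act (a : A) (q : quotv U) : quotv U :=
  quotv_pi U (act M a (quotv_repr U q)).

Lemma quot_actE a x : quot_act a (quotv_pi U x) = quotv_pi U (act M a x).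
Proof. by apply/eqP; rewrite quotv_pi_eq -linearB UA ?quotv_piK. Qed.

Lemma quot_act_bilin : bilin quot_act.
Proof.
split=> [q c a b|a c x y]; last by rewrite /quot_act !linearP.
by rewrite /quot_act linearP add_lfunE scale_lfunE linearP.
Qed.

Lemma quot_act1 q : quot_act 1 q = q.
Proof. by rewrite -(quotv_reprK q) quot_actE act1E. Qed.

Lemma quot_actM a b q : quot_act (a * b) q = quot_act a (quot_act b q).
Proof. by rewrite -(quotv_reprK q) !quot_actE actME. Qed.

Definition quotient_module : module A :=
  mkmodule quot_act_bilin quot_act1 quot_actM.

End QuotientModule.

Lemma quotient_ex M (P : M -> Prop) :
    P 0 -> (forall c x y, P x -> P y -> P (c *: x + y)) ->
    (forall a x, P x -> P (act M a x)) ->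
  exists (C : module A) (p : 'Hom(M, C)),
    [/\ is_hom p, forall z, exists y, p y = z & forall y, p y = 0 <-> P y].
Proof.
move=> P0 PL PA; have [U UP] := subspace_ex P0 PL.
have UA a x : x \in U -> act M a x \in U by move=> /UP/(PA a)/UP.
exists (quotient_module UA); exists (quotv_pi U).
split=> [a x|z|y]; first by rewrite mkmoduleE quot_actE.
  by exists (quotv_repr U z); rewrite quotv_reprK.
by rewrite -UP -{2}[y]subr0 -quotv_pi_eq linear0; split=> /eqP.
Qed.

Lemma kernel_ex M N (g : 'Hom(M, N)) : is_hom g ->
  exists (K : module A) (i : 'Hom(K, M)),
    [/\ is_hom i, forall x, i x = 0 -> x = 0 & forall y, g y = 0 <-> exists x, i x = y].
Proof.
move=> gH; apply: submodule_ex => [|c x y gx gy|a x gx].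
- exact: linear0.
- by rewrite linearP /= gx gy scaler0 addr0.
by rewrite gH gx linear0.
Qed.

Lemma kernel_ses M N (g : 'Hom(M, N)) : is_hom g ->
    (forall z, exists y, g y = z) ->
  exists (K : module A) (i : 'Hom(K, M)), short_exact i g.
Proof.
move=> gH gS; have [K [i [iH iI iE]]] := kernel_ex gH.
by exists K, i; apply/short_exactP; split.
Qed.

Lemma cokernel_ses M N (f : 'Hom(M, N)) : is_hom f ->
    (forall x, f x = 0 -> x = 0) ->
  exists (C : module A) (p : 'Hom(N, C)), short_exact f p.
Proof.
move=> fH fI.
have [||a _ [x <-]|C [p [pH pS pE]]] := @quotient_ex N (fun y => exists x, f x = y).
- by exists 0; rewrite linear0.
- by move=> c _ _ [x <-] [y <-]; exists (c *: x + y); rewrite linearP.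
- by exists (act _ a x); rewrite fH.
by exists C, p; apply/short_exactP; split.
Qed.

Lemma image_ex M N (f : 'Hom(M, N)) : is_hom f ->
  exists (I : module A) (q : 'Hom(M, I)) (i : 'Hom(I, N)),
    [/\ is_hom q, is_hom i, forall y, exists x, q x = y,
        forall x, i x = 0 -> x = 0 & forall x, i (q x) = f x].
Proof.
move=> fH.
have [||a _ [x <-]|I [i [iH iI iE]]] := @submodule_ex N (fun y => exists x, f x = y).
- by exists 0; rewrite linear0.
- by move=> c _ _ [x <-] [y <-]; exists (c *: x + y); rewrite linearP.
- by exists (act _ a x); rewrite fH.
have inj x y : i x = i y -> x = y.
  by move=> e; apply/eqP; rewrite -subr_eq0; apply/eqP/iI; rewrite linearB /= e subrr.
have [r ri] := lfun_retraction iI.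
have irf x : i (r (f x)) = f x.
  by have [|y <-] := (iE (f x)).1; [exists x|rewrite ri].
exists I, (r \o f)%VF, i; split=> // [a x|y|x].
- by apply: inj; rewrite iH !comp_lfunE !irf fH.
- have [|x e] := (iE (i y)).2; first by exists y.
  by exists x; rewrite comp_lfunE e ri.
by rewrite comp_lfunE irf.
Qed.

Lemma factor_surj M N L (g : 'Hom(M, N)) (h : 'Hom(M, L)) :
    is_hom g -> is_hom h -> (forall z, exists y, g y = z) ->
    (forall x, g x = 0 -> h x = 0) ->
  exists h' : 'Hom(N, L), is_hom h' /\ forall x, h' (g x) = h x.
Proof.
move=> gH hH gS gh; have [s gs] := lfun_section gS.
have E x : h (s (g x)) = h x.
  by apply/eqP; rewrite -subr_eq0 -linearB; apply/eqP/gh; rewrite linearB /= gs subrr.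
exists (h \o s)%VF; split=> [a x|x]; last by rewrite comp_lfunE E.
have [y <-] := gS x.
by rewrite -gH !comp_lfunE !E hH.
Qed.

Lemma lfun_inj_eq (V W : vectType k) (f : 'Hom(V, W)) :
  (forall x, f x = 0 -> x = 0) -> injective f.
Proof.
move=> fI x y e; apply/eqP; rewrite -subr_eq0; apply/eqP/fI.
by rewrite linearB /= e subrr.
Qed.

Lemma factor_inj L M N (f : 'Hom(L, M)) (h : 'Hom(N, M)) :
    is_hom f -> is_hom h -> (forall x, f x = 0 -> x = 0) ->
    (forall z, exists x, f x = h z) ->
  exists h' : 'Hom(N, L), is_hom h' /\ forall x, f (h' x) = h x.
Proof.
move=> fH hH fI fh; have [r rf] := lfun_retraction fI.
have E z : f (r (h z)) = h z by have [x <-] := fh z; rewrite rf.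
exists (r \o h)%VF; split=> [a x|x]; last by rewrite comp_lfunE E.
by apply: (lfun_inj_eq fI); rewrite fH !comp_lfunE !E hH.
Qed.

Lemma iso_inverse M N : isomorphic M N ->
  exists (f : 'Hom(M, N)) (g : 'Hom(N, M)),
    [/\ is_hom f, is_hom g, cancel f g & cancel g f].
Proof.
case=> f [[fH /lfun_injP fI] [_ /lfun_surjP fS]].
have [|g [gH gE]] := factor_inj fH (@is_hom1 N) fI.
  by move=> z; rewrite id_lfunE.
have fg : cancel g f by move=> y; rewrite gE id_lfunE.
by exists f, g; split=> // x; apply: (lfun_inj_eq fI).
Qed.

(** [N] is the preimage of [L] under [q], hence an extension of [L] by [K], the kernel of [q]. *)
Lemma ses_kernel_comp K E P L M (i : 'Hom(K, P)) (q : 'Hom(P, E))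
    (l : 'Hom(L, E)) (m : 'Hom(E, M)) :
    short_exact i q -> short_exact l m ->
  exists N (j : 'Hom(N, P)) (a : 'Hom(K, N)) (b : 'Hom(N, L)),
    [/\ short_exact j (m \o q)%VF, short_exact a b & forall x, j (a x) = i x].
Proof.
move=> iq lm.
have [lH mH lI mS lmE] := (short_exactP _ _).1 lm.
have [iH qH iI qS iqE] := (short_exactP _ _).1 iq.
have [|z|N [j jm]] := @kernel_ses _ _ (m \o q)%VF.
- exact: is_hom_comp.
- have [y <-] := mS z; have [x <-] := qS y.
  by exists x; rewrite comp_lfunE.
have [jH _ jI _ jE] := (short_exactP _ _).1 jm.
have [a [aH aE]] : exists a : 'Hom(K, N), is_hom a /\ forall x, j (a x) = i x.
  apply: factor_inj => // x; apply/jE.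
  by rewrite comp_lfunE (short_exact0 x iq) linear0.
have [b [bH bE]] : exists b : 'Hom(N, L), is_hom b /\
    forall x, l (b x) = (q \o j)%VF x.
  apply: factor_inj => // [|x]; first exact: is_hom_comp.
  by apply/lmE; have := short_exact0 x jm; rewrite !comp_lfunE.
exists N, j, a, b; split=> //; apply/short_exactP; split=> // [x x0|z|y].
- by apply: iI; rewrite -aE x0 linear0.
- have [y qy] := qS (l z); have [|x jx] := (jE y).1.
    by rewrite comp_lfunE qy (short_exact0 z lm).
  by exists x; apply: (lfun_inj_eq lI); rewrite bE comp_lfunE jx.
split=> [y0|[x <-]]; last first.
  by apply: lI; rewrite bE comp_lfunE aE (short_exact0 x iq).
have [|x ix] := (iqE (j y)).1; first by rewrite -comp_lfunE -bE y0 linear0.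
by exists x; apply: (lfun_inj_eq jI); rewrite aE.
Qed.

(** Viewing L and E as submodules of P, [N] is P / L, an extension of P / E = [G] by E / L = [M]. *)
Lemma ses_cokernel_comp L E M P G (l : 'Hom(L, E)) (m : 'Hom(E, M))
    (i : 'Hom(E, P)) (q : 'Hom(P, G)) :
    short_exact l m -> short_exact i q ->
  exists N (p : 'Hom(P, N)) (a : 'Hom(M, N)) (b : 'Hom(N, G)),
    [/\ short_exact (i \o l)%VF p & short_exact a b].
Proof.
move=> lm iq.
have [lH mH lI mS lmE] := (short_exactP _ _).1 lm.
have [iH qH iI qS iqE] := (short_exactP _ _).1 iq.
have [|x|N [p ip]] := @cokernel_ses _ _ (i \o l)%VF.
- exact: is_hom_comp.
- by rewrite comp_lfunE => /iI/lI.
have [_ pH _ pS pE] := (short_exactP _ _).1 ip.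
have [||a [aH aE]] := factor_surj mH (is_hom_comp pH iH).
- by [].
- move=> _ /lmE[x <-]; rewrite comp_lfunE -(comp_lfunE i l).
  exact: short_exact0 ip.
have [||b [bH bE]] := factor_surj pH qH.
- by [].
- by move=> _ /pE[x <-]; rewrite comp_lfunE (short_exact0 _ iq).
exists N, p, a, b; split=> //; apply/short_exactP; split=> // [z|z|y].
- have [x <-] := mS z; rewrite aE comp_lfunE => /pE[y]; rewrite comp_lfunE.
  by move=> /(lfun_inj_eq iI) <-; rewrite (short_exact0 _ lm).
- by have [y <-] := qS z; exists (p y); rewrite bE.
have [x <-] := pS y; rewrite bE; split=> [/iqE[z <-]|[z e]].
  by exists (m z); rewrite aE comp_lfunE.
have [w mw] := mS z; rewrite -bE -e -mw aE comp_lfunE bE.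
exact: short_exact0 iq.
Qed.

Section Product.
Variables M N : module A.

Definition prod_act (a : A) (x : M * N) : M * N := (act M a x.1, act N a x.2).

Lemma prod_act_bilin : bilin prod_act.
Proof.
split=> [x c a b|a c x y]; rewrite /prod_act /=.
  by congr pair; rewrite linearP add_lfunE scale_lfunE.
by congr pair; rewrite linearP.
Qed.

Lemma prod_act1 x : prod_act 1 x = x.
Proof. by case: x => x y; rewrite /prod_act /= !act1E. Qed.

Lemma prod_actM a b x : prod_act (a * b) x = prod_act a (prod_act b x).
Proof. by rewrite /prod_act /= !actME. Qed.

Definition prod_module : module A :=
  mkmodule prod_act_bilin prod_act1 prod_actM.

Lemma prod_actE a (x : prod_module) : act prod_module a x = (act M a x.1, act N a x.2).
Proof. exact: mkmoduleE. Qed.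

End Product.

Lemma pair_hom_ex L M N (f : 'Hom(L, M)) (g : 'Hom(L, N)) :
    is_hom f -> is_hom g ->
  exists h : 'Hom(L, prod_module M N), is_hom h /\ forall x, h x = (f x, g x).
Proof.
move=> fH gH; apply: hom_ex => [c x y|a x]; first by rewrite !linearP.
by rewrite prod_actE /= fH gH.
Qed.

Lemma copair_hom_ex L M N (f : 'Hom(M, L)) (g : 'Hom(N, L)) :
    is_hom f -> is_hom g ->
  exists h : 'Hom(prod_module M N, L), is_hom h /\ forall x y, h (x, y) = f x + g y.
Proof.
move=> fH gH.
have [|a x|h [hH hE]] := @hom_ex (prod_module M N) L (fun x => f x.1 + g x.2).
- by move=> c x y; rewrite /= !linearP scalerDr addrACA.
- by rewrite prod_actE /= fH gH linearD.
by exists h; split=> // x y; rewrite hE.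
Qed.

Lemma prod_ses M N : exists (i : 'Hom(M, prod_module M N))
  (p : 'Hom(prod_module M N, N)),
  [/\ short_exact i p, forall x, i x = (x, 0) & forall x, p x = x.2].
Proof.
have [i [iH iE]] := pair_hom_ex (@is_hom1 M) (@is_hom0 M N).
have [p [pH pE]] := copair_hom_ex (@is_hom0 M N) (@is_hom1 N).
have iE' x : i x = (x, 0) by rewrite iE id_lfunE zero_lfunE.
have pE' x : p x = x.2 by case: x => x y; rewrite pE id_lfunE zero_lfunE add0r.
exists i, p; split=> //; apply/short_exactP; split=> // [x|z|y].
- by rewrite iE' => -[].
- by exists (0, z); rewrite pE'.
rewrite pE'; split=> [y0|[x <-]]; last by rewrite iE'.
by exists y.1; rewrite iE' -y0 -surjective_pairing.
Qed.

End ModuleTools.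

(** * Projective modules and vanishing of Ext *)

Section Projective.
Variables (k : fieldType) (A : falgType k).
Implicit Types K L M N P Q G I : module A.

Lemma projectiveP P : projective P <->
  forall M N (g : 'Hom(M, N)) (f : 'Hom(P, N)), is_hom g ->
    (forall z, exists y, g y = z) -> is_hom f ->
    exists h : 'Hom(P, M), is_hom h /\ forall x, g (h x) = f x.
Proof.
split=> [PP M N g f gH gS fH|H M N g f [gH /lfun_surjP gS] fH].
  have [||h [hH hE]] := PP M N g f; [|done|].
    by split=> //; apply/lfun_surjP.
  by exists h; split=> // x; rewrite -hE comp_lfunE.
have [h [hH hE]] := H M N g f gH gS fH; exists h; split=> //.
by apply/lfunP=> x; rewrite comp_lfunE hE.
Qed.

Lemma projective_retract P Q (i : 'Hom(P, Q)) (p : 'Hom(Q, P)) :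
    is_hom i -> is_hom p -> (forall x, p (i x) = x) ->
  projective Q -> projective P.
Proof.
move=> iH pH pi /projectiveP QP; apply/projectiveP=> M N g f gH gS fH.
have [h [hH hE]] := QP M N g (f \o p)%VF gH gS (is_hom_comp fH pH).
exists (h \o i)%VF; split=> [|x]; first exact: is_hom_comp.
by rewrite comp_lfunE hE comp_lfunE pi.
Qed.

Lemma projective_prod P Q :
  projective P -> projective Q -> projective (prod_module P Q).
Proof.
move=> /projectiveP PP /projectiveP QP; apply/projectiveP=> M N g f gH gS fH.
have [i [iH iE]] := pair_hom_ex (@is_hom1 _ _ P) (@is_hom0 _ _ P Q).
have [j [jH jE]] := pair_hom_ex (@is_hom0 _ _ Q P) (@is_hom1 _ _ Q).
have [u [uH uE]] := PP M N g _ gH gS (is_hom_comp fH iH).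
have [v [vH vE]] := QP M N g _ gH gS (is_hom_comp fH jH).
have [h [hH hE]] := copair_hom_ex uH vH.
exists h; split=> // -[x y]; rewrite hE linearD /= uE vE !comp_lfunE -linearD /=.
by rewrite iE jE !id_lfunE !zero_lfunE; congr (f _); congr pair; rewrite ?addr0 ?add0r.
Qed.

Lemma projective_section K M P (f : 'Hom(K, M)) (g : 'Hom(M, P)) :
  short_exact f g -> projective P ->
  exists t : 'Hom(P, M), is_hom t /\ forall x, g (t x) = x.
Proof.
move=> /short_exactP[_ gH _ gS _] /projectiveP PP.
have [t [tH tE]] := PP _ _ g _ gH gS (@is_hom1 _ _ P).
by exists t; split=> // x; rewrite tE id_lfunE.
Qed.

Lemma section_retraction K M N (f : 'Hom(K, M)) (g : 'Hom(M, N)) (t : 'Hom(N, M)) :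
    short_exact f g -> is_hom t -> (forall x, g (t x) = x) ->
  exists r : 'Hom(M, K), [/\ is_hom r, forall x, r (f x) = x &
    forall y, f (r y) + t (g y) = y].
Proof.
move=> fg tH gt; have [fH gH fI gS fgE] := (short_exactP _ _).1 fg.
have [r [rH rE]] : exists r : 'Hom(M, K), is_hom r /\
    forall y, f (r y) = (\1 - (t \o g))%VF y.
  apply: factor_inj => // [|y].
    by apply: is_homB; [apply: is_hom1|apply: is_hom_comp].
  by apply/fgE; rewrite add_lfunE opp_lfunE id_lfunE comp_lfunE linearB /= gt subrr.
have frE y : f (r y) = y - t (g y).
  by rewrite rE add_lfunE opp_lfunE id_lfunE comp_lfunE.
exists r; split=> // [x|y]; last by rewrite frE subrK.
by apply: (lfun_inj_eq fI); rewrite frE (short_exact0 x fg) linear0 subr0.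
Qed.

Lemma retraction_section K M N (f : 'Hom(K, M)) (g : 'Hom(M, N)) (r : 'Hom(M, K)) :
    short_exact f g -> is_hom r -> (forall x, r (f x) = x) ->
  exists t : 'Hom(N, M), is_hom t /\ forall x, g (t x) = x.
Proof.
move=> fg rH rf; have [fH gH fI gS fgE] := (short_exactP _ _).1 fg.
have [||t [tH tE]] := @factor_surj _ _ _ _ _ g (\1 - (f \o r))%VF gH _ gS.
- by apply: is_homB; [apply: is_hom1|apply: is_hom_comp].
- move=> _ /fgE[x <-].
  by rewrite add_lfunE opp_lfunE id_lfunE comp_lfunE rf subrr.
exists t; split=> // x; have [y <-] := gS x.
rewrite tE add_lfunE opp_lfunE id_lfunE comp_lfunE linearB /=.
by rewrite (short_exact0 _ fg) subr0.
Qed.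

Lemma projective_extension K M N (f : 'Hom(K, M)) (g : 'Hom(M, N)) :
  short_exact f g -> projective K -> projective N -> projective M.
Proof.
move=> fg KP NP; have [t [tH gt]] := projective_section fg NP.
have [r [rH rf E]] := section_retraction fg tH gt.
have [fH gH _ _ _] := (short_exactP _ _).1 fg.
have [i [iH iE]] := pair_hom_ex rH gH.
have [p [pH pE]] := copair_hom_ex fH tH.
apply: (projective_retract iH pH) (projective_prod KP NP) => x.
by rewrite iE pE.
Qed.

Section Free.
Variable W : vectType k.

Definition free_act (a : A) (x : tens A W) : tens A W := tmap (amull a) \1 x.

Lemma free_act_bilin : bilin free_act.
Proof.
split=> [x c a b|a c x y]; rewrite /free_act linearP //.
by rewrite (tmap_is_bilin _ _ _ _).1 add_lfunE scale_lfunE.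
Qed.

Lemma free_act1 x : free_act 1 x = x.
Proof. by rewrite /free_act amull1 tmap1 id_lfunE. Qed.

Lemma free_actM a b x : free_act (a * b) x = free_act a (free_act b x).
Proof. by rewrite /free_act -comp_lfunE tmap_comp comp_lfun1l amullM. Qed.

Definition free_module : module A := mkmodule free_act_bilin free_act1 free_actM.

Lemma free_act_pure a b w : act free_module a (pure b w) = pure (a * b) w.
Proof. by rewrite mkmoduleE /free_act tmap_pure lfunE id_lfunE. Qed.

Lemma free_hom_ext N (f g : 'Hom(free_module, N)) : is_hom f -> is_hom g ->
  (forall w, f (pure 1 w) = g (pure 1 w)) -> f = g.
Proof.
move=> fH gH fg; apply: (@tens_lfunP _ A W) => a w.
by rewrite -[a]mulr1 -free_act_pure fH gH fg.
Qed.

Lemma free_hom_ex N (f : 'Hom(W, N)) :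
  exists F : 'Hom(free_module, N), is_hom F /\
    forall a w, F (pure a w) = act N a (f w).
Proof.
have fB : bilin (fun a w => act N a (f w)).
  split=> [w c a b|a c v w]; first exact: (act_bilin N).1.
  by rewrite !linearP.
have [F FE] := lfun_ex (tlift_linear (fun a w => act N a (f w))).
have FE' a w : F (pure a w) = act N a (f w) by rewrite FE tlift_pure.
exists F; split=> // a x.
have -> : F (act free_module a x) = (F \o act free_module a)%VF x by rewrite comp_lfunE.
have -> : act N a (F x) = (act N a \o F)%VF x by rewrite comp_lfunE.
congr (fun_of_lfun _ x); apply: (@tens_lfunP _ A W) => b w.
by rewrite !comp_lfunE free_act_pure !FE' actME.
Qed.

Lemma free_coord_ex (j : 'I_(dim W)) :
  exists c : 'Hom(free_module, regular A), is_hom c /\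
    forall a w, c (pure a w) = v2r w 0 j *: a.
Proof.
have [|f fE] := @lfun_ex _ W (regular A) (fun w => v2r w 0 j *: (1 : A)).
  by move=> c v w; rewrite linearP !mxE scalerDl scalerA.
have [c [cH cE]] := free_hom_ex f.
by exists c; split=> // a w; rewrite cE fE regularE -scalerAr mulr1.
Qed.

Lemma free_projective : projective free_module.
Proof.
apply/projectiveP=> M N g f gH gS fH.
have [s gs] := lfun_section gS.
have [e eE] : exists e : 'Hom(W, free_module), forall w, e w = pure 1 w.
  by apply: lfun_ex => c v w; rewrite pureDr pureZr.
have [h [hH hE]] := free_hom_ex (s \o f \o e)%VF.
exists h; split=> // x; rewrite -comp_lfunE; congr (fun_of_lfun _ x).
apply: free_hom_ext => // [|w]; first exact: is_hom_comp.
by rewrite comp_lfunE hE act1E !comp_lfunE gs eE.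
Qed.

End Free.

Lemma free_cover M : exists p : 'Hom(free_module M, M),
  [/\ is_hom p, forall y, exists x, p x = y & forall a x, p (pure a x) = act M a x].
Proof.
have [p [pH pE]] := free_hom_ex (\1%VF : 'Hom(M, M)).
exists p; split=> // [y|a x]; last by rewrite pE id_lfunE.
by exists (pure 1 y); rewrite pE act1E id_lfunE.
Qed.

Lemma projective_cover M : exists K P (i : 'Hom(K, P)) (p : 'Hom(P, M)),
  projective P /\ short_exact i p.
Proof.
have [p [pH pS _]] := free_cover M; have [K [i ip]] := kernel_ses pH pS.
by exists K, (free_module M), i, p; split=> //; apply: free_projective.
Qed.

Lemma projective_regular : projective (regular A).
Proof.
apply/projectiveP=> M N g f gH gS fH; have [y gy] := gS (f 1).
have [h [hH hE]] := @hom_ex _ _ (regular A) M (fun a => act M a y) ((act_bilin M).1 y) 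
  (fun a b => etrans (congr1 (fun c => act M c y) (regularE a b)) (actME a b y)).
exists h; split=> // x; rewrite hE gH gy -fH; congr (f _).
by rewrite regularE mulr1.
Qed.

End Projective.

Section ExtVanishing.
Variables (k : fieldType) (A : falgType k).
Implicit Types K L M N P Q G I : module A.

(* Ext^1(G, I) = 0 *)
Definition ext_vanish G I : Prop :=
  forall K M (f : 'Hom(K, M)) (g : 'Hom(M, G)) (u : 'Hom(K, I)),
    short_exact f g -> is_hom u ->
    exists v : 'Hom(M, I), is_hom v /\ forall x, v (f x) = u x.

Lemma ext_vanish_projective P I : projective P -> ext_vanish P I.
Proof.
move=> PP K M f g u fg uH; have [t [tH gt]] := projective_section fg PP.
have [r [rH rf _]] := section_retraction fg tH gt.
by exists (u \o r)%VF; split=> [|x]; [apply: is_hom_comp|rewrite comp_lfunE rf].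
Qed.

(** Any extension of G by K' is the pushout of the given presentation along some map K -> K', so a
    map extended to P glues with the one given on K'. *)
Lemma ext_vanish_presentation K P G I (i : 'Hom(K, P)) (p : 'Hom(P, G)) :
    projective P -> short_exact i p ->
    (forall u : 'Hom(K, I), is_hom u ->
      exists v : 'Hom(P, I), is_hom v /\ forall x, v (i x) = u x) ->
  ext_vanish G I.
Proof.
move=> /projectiveP PP ip ext K' M f g u fg uH.
have [iH pH iI pS ipE] := (short_exactP _ _).1 ip.
have [fH gH fI gS fgE] := (short_exactP _ _).1 fg.
have [h [hH hE]] := PP M G g p gH gS pH.
have [e [eH eE]] : exists e : 'Hom(K, K'), is_hom e /\
    forall x, f (e x) = (h \o i)%VF x.
  apply: factor_inj => // [|x]; first exact: is_hom_comp.
  by apply/fgE; rewrite comp_lfunE hE (short_exact0 x ip).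
have [w [wH wE]] := ext _ (is_hom_comp uH eH).
(* [s] is onto M and its kernel consists of the pairs (- e z, i z), on which [t] vanishes. *)
have [s [sH sE]] := copair_hom_ex fH hH.
have [t [tH tE]] := copair_hom_ex uH wH.
have [y|[x y]|v [vH vE]] := factor_surj sH tH.
- have [z gz] := pS (g y); have [|x fx] := (fgE (y - h z)).1.
    by rewrite linearB /= hE gz subrr.
  by exists (x, z); rewrite sE fx subrK.
- rewrite sE tE => e0; have [|z iz] := (ipE y).1.
    by rewrite -hE -[RHS](linear0 g) -e0 linearD /= (short_exact0 x fg) add0r.
  have -> : x = - e z.
    apply: (lfun_inj_eq fI); rewrite linearN /= eE comp_lfunE iz.
    by apply/eqP; rewrite -addr_eq0 e0.
  by rewrite -iz wE comp_lfunE linearN /= addNr.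
exists v; split=> // x; rewrite -[u x]addr0 -(linear0 w) -tE -vE sE.
by rewrite linear0 addr0.
Qed.

(** In an extension Y of M by K, the preimage of L is an extension of L by K with quotient N. The
    map is extended to this preimage first and then to Y. *)
Lemma ext_vanish_extension L M N I (f : 'Hom(L, M)) (g : 'Hom(M, N)) :
  short_exact f g -> ext_vanish L I -> ext_vanish N I -> ext_vanish M I.
Proof.
move=> fg LI NI K Y i q u iq uH.
have [Y' [j [i' [q' [jg iq' iE']]]]] := ses_kernel_comp iq fg.
have [v [vH vE]] := LI _ _ _ _ _ iq' uH.
have [w [wH wE]] := NI _ _ _ _ _ jg vH.
by exists w; split=> // x; rewrite -vE -wE iE'.
Qed.

(** Adding P to the middle term turns an extension of G into an extension of G x P with the same
    kernel. *)
Lemma ext_vanish_summand G P I : ext_vanish (prod_module G P) I -> ext_vanish G I.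
Proof.
move=> GPI K M f g u fg uH.
have [fH gH fI gS fgE] := (short_exactP _ _).1 fg.
have [f' [fH' fE']] := pair_hom_ex fH (@is_hom0 _ _ K P).
have [g' [gH' gE']] : exists g' : 'Hom(prod_module M P, prod_module G P),
    is_hom g' /\ forall x, g' x = (g x.1, x.2).
  apply: hom_ex => [c x y|a x]; first by rewrite /= !linearP.
  by rewrite !prod_actE /= gH.
have [|v [vH vE]] := GPI _ _ f' g' u _ uH.
  apply/short_exactP; split=> // [x|[z1 z2]|y].
  - by rewrite fE' => -[/fI].
  - by have [y <-] := gS z1; exists (y, z2); rewrite gE'.
  rewrite gE'; split=> [[/fgE[x fx] y2]|[x <-]]; last first.
    by rewrite fE' /= (short_exact0 x fg) zero_lfunE.
  by exists x; rewrite fE' fx zero_lfunE -y2 -surjective_pairing.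
have [i [iH iE]] := pair_hom_ex (@is_hom1 _ _ M) (@is_hom0 _ _ M P).
exists (v \o i)%VF; split=> [|x]; first exact: is_hom_comp.
by rewrite comp_lfunE iE id_lfunE -vE fE' !zero_lfunE.
Qed.

(** [Q] is a summand of the free module A (x) Q. A map into it is extended coordinate by coordinate
    as a map to A, and the maps a |-> a e_j, for the basis e_j of Q, put the coordinates together
    again. *)
Lemma ext_vanish_to_projective G Q :
  ext_vanish G (regular A) -> projective Q -> ext_vanish G Q.
Proof.
move=> GA QP K M f g u fg uH.
have [p [pH pS pE]] := free_cover Q.
have [s [sH ps]] : exists s : 'Hom(Q, free_module A Q), is_hom s /\ forall x, p (s x) = x.
  have [K' [j jp]] := kernel_ses pH pS.
  exact: projective_section jp QP.
have /choice[c cP] := (@free_coord_ex _ A Q).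
have cH j : is_hom (c j) := (cP j).1; have cE j := (cP j).2.
pose d j : 'Hom(regular A, Q) := linfun (fun a : A => act Q a (vbase j)).
have dE j a : d j a = act Q a (vbase j).
  by rewrite [LHS]linfunE //; apply: (act_bilin Q).1.
have dH j : is_hom (d j) by move=> a x; rewrite !dE regularE actME.
have cd x : \sum_j d j (c j x) = p x.
  have -> : \sum_j d j (c j x) = (\sum_j (d j \o c j))%VF x.
    by rewrite sum_lfunE; apply: eq_bigr => j _; rewrite comp_lfunE.
  congr (fun_of_lfun _ x); apply: free_hom_ext => // [|w].
    by apply: is_hom_sum => j; apply: is_hom_comp.
  rewrite sum_lfunE pE act1E [RHS]vbaseE; apply: eq_bigr => j _.
  by rewrite comp_lfunE cE dE linearZ scale_lfunE act1E.
have /choice[v vP] : forall j, exists v : 'Hom(M, regular A), is_hom v /\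
    forall x, v (f x) = c j (s (u x)).
  move=> j; have [|v [vH vE]] := GA _ _ f g (c j \o s \o u)%VF fg.
    by apply: is_hom_comp => //; apply: is_hom_comp.
  by exists v; split=> // x; rewrite vE !comp_lfunE.
exists (\sum_j (d j \o v j))%VF; split=> [|x].
  by apply: is_hom_sum => j; apply: is_hom_comp => //; case: (vP j).
rewrite sum_lfunE -[RHS]ps -cd; apply: eq_bigr => j _.
by rewrite comp_lfunE (vP j).2.
Qed.

End ExtVanishing.

(** * Gorenstein projective modules *)

Section Gorenstein.
Variables (k : fieldType) (A : falgType k).
Implicit Types C K L M N P Q G I : module A.

(* G is Gorenstein projective iff it lies in such a class: this replaces complete
   resolutions by one step in each direction *)
Definition gp_class (W : module A -> Prop) : Prop :=
  forall G, W G ->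
    [/\ ext_vanish G (regular A),
        exists P G' (f : 'Hom(G, P)) (g : 'Hom(P, G')),
          [/\ projective P, W G' & short_exact f g]
      & exists G' P (f : 'Hom(G', P)) (g : 'Hom(P, G)),
          [/\ projective P, W G' & short_exact f g]].

(** [L] is a syzygy of [M]: one link of a complete resolution. *)
Let embeds L M := exists P (f : 'Hom(L, P)) (g : 'Hom(P, M)),
  projective P /\ short_exact f g.

Lemma gp_class_complete_resolution (W : module A -> Prop) G :
  gp_class W -> W G -> gorenstein_projective G.
Proof.
move=> WA WG; pose T := {M | W M}.
have /choice[nx nxP] : forall X : T, exists Y : T, embeds (sval X) (sval Y).
  move=> [X WX]; have [_ [P [Y [f [g [PP WY fg]]]]] _] := WA X WX.
  by exists (exist _ Y WY), P, f, g.
have /choice[pv pvP] : forall X : T, exists Y : T, embeds (sval Y) (sval X).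
  move=> [X WX]; have [_ _ [Y [P [f [g [PP WY fg]]]]]] := WA X WX.
  by exists (exist _ Y WY), P, f, g.
pose X0 : T := exist _ G WG.
(* [S i] will be the kernel of d^i; [G] sits at index 1 because the definition asks for G = Ker
   d^1. *)
pose S (i : int) : T := match i with
  | Posz 0 => pv X0 | Posz n.+1 => iter n nx X0 | Negz n => iter n.+2 pv X0 end.
have S_step i : embeds (sval (S i)) (sval (S (i + 1))).
  case: i => [[|n]|[|n]].
  - exact: pvP.
  - have -> : Posz n.+1 + 1 = n.+2 :> int by rewrite -PoszD addn1.
    exact: nxP.
  - exact: pvP.
  have -> : Negz n.+1 + 1 = Negz n by rewrite !NegzE -[n.+2]addn1 PoszD opprD addrNK.
  exact: pvP.
pose P i := projT1 (cid (S_step i)).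
have exf i : exists (f : 'Hom(sval (S i), P i)) (g : 'Hom(P i, sval (S (i + 1)))),
    projective (P i) /\ short_exact f g := projT2 (cid (S_step i)).
pose f i := projT1 (cid (exf i)).
have exg i : exists g : 'Hom(P i, sval (S (i + 1))),
    projective (P i) /\ short_exact (f i) g := projT2 (cid (exf i)).
pose g i := projT1 (cid (exg i)).
have PP i : projective (P i) := (projT2 (cid (exg i))).1.
have fg i : short_exact (f i) (g i) := (projT2 (cid (exg i))).2.
have fH i : is_hom (f i) by case: ((short_exactP _ _).1 (fg i)).
have gH i : is_hom (g i) by case: ((short_exactP _ _).1 (fg i)).
have fI i : forall x, f i x = 0 -> x = 0 by case: ((short_exactP _ _).1 (fg i)).
have gS i : forall z, exists y, g i y = z by case: ((short_exactP _ _).1 (fg i)).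
have fgE i : forall y, g i y = 0 <-> exists x, f i x = y.
  by case: ((short_exactP _ _).1 (fg i)).
pose d i : 'Hom(P i, P (i + 1)) := (f (i + 1) \o g i)%VF.
have dE i y : d i y = 0 <-> g i y = 0.
  by rewrite comp_lfunE; split=> [/fI//|->]; rewrite linear0.
have kd i : limg (f i) = lker (d i).
  by apply/vspaceP=> y; rewrite memv_ker; apply/idP/eqP => [/limgP/fgE/dE|/dE/fgE/limgP].
exists P, d; split=> [i|i|i u uH|].
- by split=> //; apply: is_hom_comp.
- rewrite -kd; apply/vspaceP=> y; apply/idP/idP=> /limgP[x <-]; apply/limgP.
    by exists (g i x); rewrite comp_lfunE.
  by have [z <-] := gS i x; exists z; rewrite comp_lfunE.
- split=> [ud0|[v [vH ->]]]; last first.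
    apply/lfunP=> x; rewrite zero_lfunE !comp_lfunE (short_exact0 _ (fg _)).
    by rewrite !linear0.
  (* [u] factors through the syzygy [S (i + 1 + 1)]. The factor extends to the next projective
     because the cokernel [S (i + 1 + 1 + 1)] has no extensions by A. *)
  have [x /fgE[y <-]|w [wH wE]] := factor_surj (gH (i + 1)) uH (gS _).
    have [z <-] := gS i y; have /lfunP/(_ z) := ud0.
    by rewrite zero_lfunE !comp_lfunE.
  have [ext _ _] := WA _ (proj2_sig (S (i + 1 + 1 + 1))).
  have [v [vH vE]] := ext _ _ _ _ _ (fg (i + 1 + 1)) wH.
  by exists v; split=> //; apply/lfunP=> x; rewrite !comp_lfunE vE wE.
exists (f 1); split; last exact: (kd 1).
by split; [exact: (fH 1)|exact: ((lfun_injP (f 1)).2 (fI 1))].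
Qed.

Lemma complete_resolution_gp_class G : gorenstein_projective G ->
  exists W, gp_class W /\ W G.
Proof.
case=> P [d [Pd dd dA [u0 [u0I u0E]]]].
exists (fun M => exists i (u : 'Hom(M, P i)), injective_hom u /\ limg u = lker (d i)).
split; last by exists 1, u0.
(* Indices are replaced by successors, so that the incoming differential ends literally in
   [P (j + 1)] and no transport along an equality of indices is needed. *)
have succ i : exists j, i = j + 1 :> int by exists (i - 1); rewrite subrK.
have dH i : is_hom (d i) := (Pd i).2.
have ddE i y : d (i + 1) y = 0 <-> exists x, d i x = y.
  by rewrite -limgP dd memv_ker; split=> [->|/eqP].
have presents j M (u : 'Hom(M, P (j + 1))) : injective_hom u ->
    limg u = lker (d (j + 1)) -> exists K (i : 'Hom(K, P j)) (p : 'Hom(P j, M)),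
    [/\ injective_hom i, limg i = lker (d j), short_exact i p & forall x, u (p x) = d j x].
  move=> [uH /lfun_injP uI] uE.
  have [K [i [iH iI iE]]] := kernel_ex (dH j).
  have [z|p [pH pE]] := factor_inj uH (dH j) uI.
    by apply/limgP; rewrite uE memv_ker; apply/eqP/ddE; exists z.
  exists K, i, p; split=> //.
  - by split=> //; apply/lfun_injP.
  - by apply/vspaceP=> y; rewrite memv_ker; apply/idP/eqP=> [/limgP/iE|/iE/limgP].
  apply/short_exactP; split=> // [z|y].
    have : u z \in limg u by apply/limgP; exists z.
    rewrite uE memv_ker => /eqP/ddE[x dx]; exists x.
    by apply: (lfun_inj_eq uI); rewrite pE.
  rewrite -iE -pE; split=> [->|/uI//]; exact: linear0.
move=> M [i [u [uI uE]]]; have [j ei] := succ i; subst i.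
have [K [s [p [sI sE sp pE]]]] := presents _ _ _ uI uE.
split.
(* A map [w] from K to A, composed with the surjection [p'] onto K, kills the preceding
   differential. Exactness of Hom(P, A) factors the composite through the next differential, and the
   factor extends [w]. *)
- apply: ext_vanish_presentation sp _; first by case: (Pd j).
  have [l el] := succ j; subst j; have [m em] := succ l; subst l.
  have [K' [s' [p' [_ _ sp' pE']]]] := presents _ _ _ sI sE.
  have [_ pH' _ pS' pE''] := (short_exactP _ _).1 sp'.
  move=> w wH; have [|v [vH vE]] := (dA m (w \o p')%VF (is_hom_comp wH pH')).1.
    apply/lfunP=> x; rewrite zero_lfunE !comp_lfunE.
    suff -> : p' (d m x) = 0 by rewrite linear0.
    by apply: (lfun_injP _).1 sI.2 _ _; rewrite pE'; apply/ddE; exists x.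
  exists v; split=> // x; have [y <-] := pS' x.
  by have /lfunP/(_ y) := vE; rewrite !comp_lfunE => ->; rewrite pE'.
- have [C [i [iH iI iE]]] := kernel_ex (dH (j + 1 + 1)).
  have [z|q [qH qE]] := factor_inj iH (dH (j + 1)) iI.
    by apply/iE/ddE; exists z.
  exists (P (j + 1)), C, u, q; split; first by case: (Pd (j + 1)).
    exists (j + 1 + 1), i; split; first by split=> //; apply/lfun_injP.
    by apply/vspaceP=> y; rewrite memv_ker; apply/idP/eqP=> [/limgP/iE|/iE/limgP].
  have [uH /lfun_injP uI'] := uI.
  apply/short_exactP; split=> // [z|y].
    have /ddE[x dx] : d (j + 1 + 1) (i z) = 0 by apply/iE; exists z.
    by exists x; apply: (lfun_inj_eq iI); rewrite qE.
  rewrite -limgP uE memv_ker -qE; split=> [->|/eqP/iI//].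
  by rewrite linear0.
exists K, (P j), s, p; split=> //; first by case: (Pd j).
by exists j, s.
Qed.

Lemma gorenstein_projectiveP G :
  gorenstein_projective G <-> exists W, gp_class W /\ W G.
Proof.
split=> [|[W [WA WG]]]; first exact: complete_resolution_gp_class.
exact: gp_class_complete_resolution WG.
Qed.

Lemma gp_classP : gp_class (@gorenstein_projective k A).
Proof.
move=> G /gorenstein_projectiveP[W [WA WG]].
have [eG [P [C [f [g [PP WC fg]]]]] [K [Q [i [p [QP WK ip]]]]]] := WA G WG.
split=> //; [exists P, C, f, g|exists K, Q, i, p]; split=> //;
  by apply/gorenstein_projectiveP; exists W.
Qed.

(** Adjoining [M] to the Gorenstein projective modules yields a class satisfying [gp_class], as both
    neighbours of [M] are already in it. *)
Lemma gproj_intro M : ext_vanish M (regular A) ->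
    (exists P G (f : 'Hom(M, P)) (g : 'Hom(P, G)),
      [/\ projective P, gorenstein_projective G & short_exact f g]) ->
    (exists G P (f : 'Hom(G, P)) (g : 'Hom(P, M)),
      [/\ projective P, gorenstein_projective G & short_exact f g]) ->
  gorenstein_projective M.
Proof.
move=> eM [P [C [f [g [PP GC fg]]]]] [K [Q [i [p [QP GK ip]]]]].
apply/gorenstein_projectiveP.
exists (fun N => gorenstein_projective N \/ N = M); split; last by right.
move=> N [/gp_classP[eN [P' [C' [f' [g' [PP' GC' fg']]]]]
          [K' [Q' [i' [p' [QP' GK' ip']]]]]]|->].
  split=> //; first by exists P', C', f', g'; split=> //; left.
  by exists K', Q', i', p'; split=> //; left.
split=> //; first by exists P, C, f, g; split=> //; left.
by exists K, Q, i, p; split=> //; left.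
Qed.

Lemma projective_gproj P : projective P -> gorenstein_projective P.
Proof.
move=> PP; apply/gorenstein_projectiveP; exists (@projective k A); split=> // Q QP.
have [i [p [ip _ _]]] := prod_ses Q Q.
split; first exact: ext_vanish_projective.
  by exists (prod_module Q Q), Q, i, p; split=> //; apply: projective_prod.
by exists Q, (prod_module Q Q), i, p; split=> //; apply: projective_prod.
Qed.

Lemma gproj_iso M N : isomorphic M N -> gorenstein_projective M ->
  gorenstein_projective N.
Proof.
move=> /iso_inverse[f [g [fH gH fK gK]]] /gp_classP[eM
  [P [C [a [b [PP GC ab]]]]] [K [Q [i [p [QP GK ip]]]]]].
have [aH bH aI bS abE] := (short_exactP _ _).1 ab.
have [iH pH iI pS ipE] := (short_exactP _ _).1 ip.
have fp : short_exact i (f \o p)%VF.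
  apply/short_exactP; split=> // [|z|y]; first exact: is_hom_comp.
    by have [y py] := pS (g z); exists y; rewrite comp_lfunE py gK.
  rewrite -ipE comp_lfunE; split=> [e|->]; last by rewrite linear0.
  by rewrite -[p y]fK e linear0.
apply: gproj_intro.
- apply: ext_vanish_presentation fp _ => // u uH.
  exact: eM ip uH.
- exists P, C, (a \o g)%VF, b; split=> //.
  apply/short_exactP; split=> // [|x|y]; first exact: is_hom_comp.
    by rewrite comp_lfunE => /aI gx; rewrite -[x]gK gx linear0.
  rewrite abE; split=> [[x <-]|[x <-]].
    by exists (f x); rewrite comp_lfunE fK.
  by exists (g x); rewrite comp_lfunE.
by exists K, Q, i, (f \o p)%VF; split.
Qed.

(** The extensions of Gorenstein projectives by Gorenstein projectives satisfy [gp_class], by the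
    horseshoe construction in both directions. *)
Lemma gproj_extension L M N (f : 'Hom(L, M)) (g : 'Hom(M, N)) :
    short_exact f g -> gorenstein_projective L -> gorenstein_projective N ->
  gorenstein_projective M.
Proof.
move=> fg GL GN; apply/gorenstein_projectiveP.
exists (fun M => exists L N (f : 'Hom(L, M)) (g : 'Hom(M, N)),
  [/\ gorenstein_projective L, gorenstein_projective N & short_exact f g]).
split; last by exists L, N, f, g; split.
move=> {L M N f g fg GL GN} M [L [N [f [g [GL GN fg]]]]].
have [eL [P1 [C1 [i1 [p1 [PP1 GC1 ip1]]]]] [K1 [Q1 [j1 [q1 [QP1 GK1 jq1]]]]]] :=
  gp_classP GL.
have [eN [P2 [C2 [i2 [p2 [PP2 GC2 ip2]]]]] [K2 [Q2 [j2 [q2 [QP2 GK2 jq2]]]]]] :=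
  gp_classP GN.
have [fH gH fI gS fgE] := (short_exactP _ _).1 fg.
split; first exact: ext_vanish_extension fg eL eN.
  have [i1H p1H i1I p1S ip1E] := (short_exactP _ _).1 ip1.
  have [i2H p2H i2I p2S ip2E] := (short_exactP _ _).1 ip2.
  (* Horseshoe to the right: as Ext^1(N, P1) = 0, [i1] extends to [e] on M. Then (e, i2 g) embeds M
     into P1 x P2, and the cokernel is an extension of C2 by C1. *)
  have [e [eH eE]] := ext_vanish_to_projective eN PP1 fg i1H.
  have [h [hH hE]] := pair_hom_ex eH (is_hom_comp i2H gH).
  have [|C [p hp]] := cokernel_ses hH.
    move=> x; rewrite hE comp_lfunE => -[e0 /i2I/fgE[y fy]].
    by move: e0; rewrite -fy eE => /i1I->; rewrite linear0.
  have [_ pH _ pS pE] := (short_exactP _ _).1 hp.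
  have [l [m [lm lE mE]]] := prod_ses P1 P2.
  have [lH mH _ _ _] := (short_exactP _ _).1 lm.
  have [|_ /ip1E[x <-]|a [aH aE]] := factor_surj p1H (is_hom_comp pH lH) => //.
    rewrite comp_lfunE lE; apply/pE; exists (f x).
    by rewrite hE eE comp_lfunE (short_exact0 _ fg) linear0.
  have [|_ /pE[x <-]|b [bH bE]] := factor_surj pH (is_hom_comp p2H mH) => //.
    by rewrite comp_lfunE mE hE /= comp_lfunE (short_exact0 _ ip2).
  exists (prod_module P1 P2), C, h, p; split=> //; first exact: projective_prod.
  exists C1, C2, a, b; split=> //; apply/short_exactP; split=> // [z|z|z].
  - have [x <-] := p1S z; rewrite aE comp_lfunE lE => /pE[y]; rewrite hE comp_lfunE.
    move=> [<- /i2I/fgE[w <-]]; rewrite eE; exact: short_exact0 ip1.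
  - have [y <-] := p2S z; exists (p (0, y)).
    by rewrite bE comp_lfunE mE.
  have [[x y] <-] := pS z; rewrite bE comp_lfunE mE /=; split.
    move=> /ip2E[n <-]; have [w gw] := gS n.
    exists (p1 (x - e w)); rewrite aE comp_lfunE lE; apply/eqP.
    rewrite -subr_eq0 -linearB; apply/eqP/pE; exists (- w).
    rewrite hE comp_lfunE !linearN /= gw; congr pair; last by rewrite sub0r.
    by rewrite addrAC subrr add0r.
  case=> w; have [v <-] := p1S w; rewrite aE comp_lfunE lE => e0.
  have /pE[n] : p ((v, 0) - (x, y)) = 0 by rewrite linearB /= e0 subrr.
  rewrite hE comp_lfunE => -[_] i2g; apply/ip2E; exists (- g n).
  by rewrite linearN /= i2g sub0r opprK.
have [j1H q1H j1I q1S jq1E] := (short_exactP _ _).1 jq1.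
have [j2H q2H j2I q2S jq2E] := (short_exactP _ _).1 jq2.
(* Horseshoe to the left: [h] lifts [q2] through [g], and the kernel of Q1 x Q2 -> M is an extension
   of K2 by K1. *)
have [h [hH hE]] := (projectiveP _).1 QP2 _ _ g _ gH gS q2H.
have [q [qH qE]] := copair_hom_ex (is_hom_comp fH q1H) hH.
have [|K [j jq]] := kernel_ses qH.
  move=> z; have [y qy] := q2S (g z).
  have /fgE[w fw] : g (z - h y) = 0 by rewrite linearB /= hE qy subrr.
  have [x qx] := q1S w; exists (x, y).
  by rewrite qE comp_lfunE qx fw subrK.
have [jH _ jI _ jE] := (short_exactP _ _).1 jq.
have [l [m [lm lE mE]]] := prod_ses Q1 Q2.
have [lH mH _ _ _] := (short_exactP _ _).1 lm.
have [|a [aH aE]] := factor_inj jH (is_hom_comp lH j1H) jI.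
  move=> z; apply/jE; rewrite comp_lfunE lE qE comp_lfunE (short_exact0 _ jq1).
  by rewrite !linear0 addr0.
have [|b [bH bE]] := factor_inj j2H (is_hom_comp mH jH) j2I.
  move=> z; apply/jq2E; rewrite comp_lfunE mE -hE.
  have := short_exact0 z jq; rewrite [j z]surjective_pairing qE comp_lfunE => e0.
  by rewrite -(linear0 g) -e0 linearD /= (short_exact0 _ fg) add0r.
exists K, (prod_module Q1 Q2), j, q; split=> //; first exact: projective_prod.
exists K1, K2, a, b; split=> //; apply/short_exactP; split=> // [z az0|z|z].
- have := aE z; rewrite az0 linear0 comp_lfunE lE => -[/esym].
  exact: j1I.
- have /fgE[w fw] : g (h (j2 z)) = 0 by rewrite hE (short_exact0 _ jq2).
  have [x qx] := q1S w; have /jE[y jy] : q (- x, j2 z) = 0.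
    by rewrite qE comp_lfunE !linearN /= qx fw addNr.
  by exists y; apply: (lfun_inj_eq j2I); rewrite bE comp_lfunE mE jy.
split=> [bz|[w <-]]; last first.
  by apply: j2I; rewrite bE comp_lfunE mE aE comp_lfunE lE.
have j2z : (j z).2 = 0 by rewrite -mE -comp_lfunE -bE bz linear0.
have := short_exact0 z jq; rewrite [j z]surjective_pairing j2z qE comp_lfunE linear0 addr0.
move=> /fI/jq1E[t jt]; exists t; apply: (lfun_inj_eq jI).
by rewrite aE comp_lfunE lE jt -j2z -surjective_pairing.
Qed.

(** Schanuel's argument: for a presentation of G by a projective P' with Gorenstein projective
    kernel K', the module K x P' is an extension of P by K'. It remains to split off P'. *)
Lemma gproj_kernel K P G (i : 'Hom(K, P)) (p : 'Hom(P, G)) :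
    short_exact i p -> projective P -> gorenstein_projective G ->
  gorenstein_projective K.
Proof.
move=> ip PP GG; have [_ _ [K' [P' [i' [p' [PP' GK' ip']]]]]] := gp_classP GG.
have [iH pH iI pS ipE] := (short_exactP _ _).1 ip.
have [iH' pH' iI' pS' ipE'] := (short_exactP _ _).1 ip'.
have [h [hH hE]] := (projectiveP _).1 PP' _ _ p _ pH pS pH'.
have [b [bH bE]] := copair_hom_ex iH hH.
have [|c [cH cE]] := factor_inj iH (is_hom_comp hH iH') iI.
  by move=> z; apply/ipE; rewrite comp_lfunE hE (short_exact0 _ ip').
have [|a [aH aE]] := @pair_hom_ex _ _ _ _ _ (0 - c) i' _ iH'.
  by apply: is_homB => //; apply: is_hom0.
have GE : gorenstein_projective (prod_module K P').
  apply: (@gproj_extension _ _ _ a b) GK' (projective_gproj PP).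
  apply/short_exactP; split=> // [x|z|[x y]].
  - by rewrite aE => -[_ /iI'].
  - have [y py] := pS' (p z); have /ipE[x ix] : p (z - h y) = 0.
      by rewrite linearB /= hE py subrr.
    by exists (x, y); rewrite bE ix subrK.
  rewrite bE; split=> [e0|[t]]; last first.
    rewrite aE sub0r opp_lfunE => -[<- <-].
    by rewrite linearN /= cE comp_lfunE addNr.
  have /ipE'[t it] : p' y = 0.
    by rewrite -hE -(linear0 p) -e0 linearD /= (short_exact0 _ ip) add0r.
  exists t; rewrite aE it sub0r opp_lfunE; congr pair.
  apply: (lfun_inj_eq iI); rewrite linearN /= cE comp_lfunE it.
  by apply/esym/eqP; rewrite -addr_eq0 e0.
have [eE _ [K1 [P1 [i1 [p1 [PP1 GK1 ip1]]]]]] := gp_classP GE.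
apply: gproj_intro.
- exact: ext_vanish_summand eE.
- by exists P, G, i, p; split.
have [l [lH lE]] := pair_hom_ex (@is_hom0 _ _ P' K) (@is_hom1 _ _ P').
have [m [mH mE]] := copair_hom_ex (@is_hom1 _ _ K) (@is_hom0 _ _ P' K).
have lm : short_exact l m.
  apply/short_exactP; split=> // [x|z|[x y]].
  - by rewrite lE id_lfunE => -[].
  - by exists (z, 0); rewrite mE id_lfunE zero_lfunE addr0.
  rewrite mE id_lfunE zero_lfunE addr0; split=> [->|[z]].
    by exists y; rewrite lE id_lfunE zero_lfunE.
  by rewrite lE zero_lfunE => -[].
(* The surjection of [P1] onto K x P', followed by the projection to K, has as kernel an extension
   of P' by [K1]. *)
have [N [j [s [t [jm st _]]]]] := ses_kernel_comp ip1 lm.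
exists N, P1, j, (m \o p1)%VF; split=> //.
exact: gproj_extension st GK1 (projective_gproj PP').
Qed.

(** Dual to [gproj_kernel]: an embedding of G into a projective Q with Gorenstein projective
    cokernel G' extends to P, since Ext^1(C, Q) = 0. The resulting map P -> C x Q is injective with
    cokernel G'. *)
Lemma gproj_cokernel G P C (i : 'Hom(G, P)) (p : 'Hom(P, C)) :
    short_exact i p -> gorenstein_projective G -> projective P ->
    ext_vanish C (regular A) ->
  gorenstein_projective C.
Proof.
move=> ip GG PP eC; have [_ [Q [G' [i' [p' [QP GG' ip']]]]] _] := gp_classP GG.
have [iH pH iI pS ipE] := (short_exactP _ _).1 ip.
have [iH' pH' iI' pS' ipE'] := (short_exactP _ _).1 ip'.
have [h [hH hE]] := ext_vanish_to_projective eC QP ip iH'.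
have [a [aH aE]] := pair_hom_ex pH hH.
have [s [sH sE]] : exists s : 'Hom(prod_module P Q, prod_module C Q),
    is_hom s /\ forall x, s x = (p x.1, x.2).
  apply: hom_ex => [c x y|c x]; first by rewrite /= !linearP.
  by rewrite !prod_actE /= pH.
have [|t [tH tE]] := @copair_hom_ex _ _ _ _ _ (0 - (p' \o h))%VF p' _ pH'.
  by apply: is_homB; [apply: is_hom0|apply: is_hom_comp].
have {}tE x y : t (x, y) = p' (y - h x).
  by rewrite tE sub0r opp_lfunE comp_lfunE addrC linearB.
have [[z1 z2]|[x y]|b [bH bE]] := factor_surj sH tH.
- by have [x <-] := pS z1; exists (x, z2); rewrite sE.
- rewrite sE tE => -[/ipE[z <-] ->].
  by rewrite hE sub0r linearN /= (short_exact0 _ ip') oppr0.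
have {}bE x y : b (p x, y) = p' (y - h x) by rewrite -tE -bE sE.
have GE : gorenstein_projective (prod_module C Q).
  apply: (@gproj_extension _ _ _ a b) (projective_gproj PP) GG'.
  apply/short_exactP; split=> // [x|z|[z y]].
  - rewrite aE => -[/ipE[w <-]]; rewrite hE => /iI' ->.
    by rewrite linear0.
  - have [y <-] := pS' z; exists (p 0, y).
    by rewrite bE linear0 subr0.
  have [x <-] := pS z; rewrite bE; split=> [/ipE'[w iw]|[w]].
    exists (x + i w); rewrite aE !linearD /= hE iw (short_exact0 _ ip) addr0.
    by rewrite addrC subrK.
  rewrite aE => -[pw <-]; have /ipE[v iv] : p (w - x) = 0 by rewrite linearB /= pw subrr.
  by rewrite -linearB /= -iv hE (short_exact0 _ ip').
have [_ [Q' [G'' [i2 [p2 [QP' GG'' ip2]]]]] _] := gp_classP GE.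
(* C embeds into C x Q and so into the projective [Q']; the cokernel of the composite is an
   extension of [G''] by Q. *)
have [l [m [lm _ _]]] := prod_ses C Q.
have [N [q [u [v [lq uv]]]]] := ses_cokernel_comp lm ip2.
apply: gproj_intro => //; last by exists G, P, i, p; split.
exists Q', N, (i2 \o l)%VF, q; split=> //.
exact: gproj_extension uv (projective_gproj QP) GG''.
Qed.

End Gorenstein.

(** * The tensor product over B *)

Section TensorOverB.
Variables (k : fieldType) (A B : falgType k).
Implicit Types (V W : rmodule B) (X Y Z : module (talg A B)) (M N Q : module A).

Lemma tens_ind (U W : vectType k) (P : tens U W -> Prop) :
    (forall u w, P (pure u w)) ->
    (forall c x y, P x -> P y -> P (c *: x + y)) ->
  forall x, P x.
Proof.
move=> Pp PL x; rewrite (tens_sum x).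
have P0 : P 0 by have /eqP <- : pure (0 : U) (0 : W) == 0 by rewrite pure_eq0 eqxx.
have PD y z : P y -> P z -> P (y + z) by rewrite -{2}[y]scale1r; apply: PL.
apply: (big_ind P) => // i _; apply: (big_ind P) => // j _.
by rewrite -[X in P X]addr0; apply: PL.
Qed.

Lemma ract_bilin V : bilin (fun b v => ract V b v).
Proof.
by split=> [x c a b|a c x y]; rewrite linearP // add_lfunE scale_lfunE.
Qed.

Lemma ract1E V v : ract V 1 v = v.
Proof. by rewrite ract1 id_lfunE. Qed.

Lemma ractME V a b v : ract V (a * b) v = ract V b (ract V a v).
Proof. by rewrite ractM comp_lfunE. Qed.

Section Restriction.
Variable X : module (talg A B).

Definition actA (a : A) (x : X) : X := act X (pure a 1 : talg A B) x.
Definition actB (b : B) (x : X) : X := act X (pure 1 b : talg A B) x.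

Lemma actA_bilin : bilin actA.
Proof.
split=> [x c a b|a c x y]; rewrite /actA; last exact: (act_bilin X).2.
by rewrite pureDl pureZl; apply: (act_bilin X).1.
Qed.

Lemma actB_bilin : bilin actB.
Proof.
split=> [x c a b|a c x y]; rewrite /actB; last exact: (act_bilin X).2.
by rewrite pureDr pureZr; apply: (act_bilin X).1.
Qed.

Lemma actA1 x : actA 1 x = x. Proof. exact: act1E. Qed.
Lemma actB1 x : actB 1 x = x. Proof. exact: act1E. Qed.

Lemma actAM a b x : actA (a * b) x = actA a (actA b x).
Proof. by rewrite /actA -actME talg_pureM mulr1. Qed.

Lemma actBM a b x : actB (a * b) x = actB a (actB b x).
Proof. by rewrite /actB -actME talg_pureM mulr1. Qed.

Lemma act_pureE a b x : act X (pure a b : talg A B) x = actA a (actB b x).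
Proof. by rewrite /actA /actB -actME talg_pureM mulr1 mul1r. Qed.

Lemma actAB a b x : actA a (actB b x) = actB b (actA a x).
Proof. by rewrite /actA /actB -!actME !talg_pureM !mulr1 !mul1r. Qed.

Definition resA : module A := mkmodule actA_bilin actA1 actAM.
Definition resB : module B := mkmodule actB_bilin actB1 actBM.

Lemma resAE a x : act resA a x = actA a x. Proof. exact: mkmoduleE. Qed.
Lemma resBE b x : act resB b x = actB b x. Proof. exact: mkmoduleE. Qed.

End Restriction.

Definition Alin X Y (f : 'Hom(X, Y)) : Prop := forall a x, f (actA a x) = actA a (f x).
Definition Blin X Y (f : 'Hom(X, Y)) : Prop := forall b x, f (actB b x) = actB b (f x).

Lemma is_hom_ABlin X Y (f : 'Hom(X, Y)) : is_hom f <-> Alin f /\ Blin f.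
Proof.
split=> [fH|[fA fB] l x]; first by split=> [a x|b x]; apply: fH.
elim/(@tens_ind A B): l => [a b|c l l' IH IH']; first by rewrite !act_pureE fA fB.
by rewrite !(act_bilin _).1 linearP /= IH IH'.
Qed.

Lemma is_hom_resB X Y (f : 'Hom(X, Y)) :
  Blin f <-> is_hom (f : 'Hom(resB X, resB Y)).
Proof.
by split=> fB b x; have := fB b x; rewrite !resBE.
Qed.

Lemma short_exact_resB X Y Z (f : 'Hom(X, Y)) (g : 'Hom(Y, Z)) :
  short_exact f g ->
  short_exact (f : 'Hom(resB X, resB Y)) (g : 'Hom(resB Y, resB Z)).
Proof.
move=> /short_exactP[/is_hom_ABlin[_ /is_hom_resB fB] /is_hom_ABlin[_ /is_hom_resB gB] ? ? ?].
exact/short_exactP.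
Qed.

(* (A (x) V) (x)_Lambda X is V (x)_B X, the left A-structure being that of X *)
Definition TB V X : module A := btens (AtensV A V) X.

(** This is v (x) x in V (x)_B X. Such elements span, because (a (x) v) (x) x equals the [tau] of v
    and a x. *)
Definition tau V X (v : V) (x : X) : TB V X :=
  rpure (pure 1 v : AV_rmodule A V) x.

Lemma AV_ractE V l (m : tens A V) : ract (AV_rmodule A V) l m = AV_rmul l m.
Proof. exact: (lfun2E _ _ (AV_rmul_bilin A V)). Qed.

Lemma rpure_bilin (L : falgType k) (M : rmodule L) (X : module L) : bilin (@rpure k L M X).
Proof.
split=> [x c m m'|m c x x']; rewrite /rpure.
  by rewrite pureDl pureZl linearP.
by rewrite pureDr pureZr linearP.
Qed.

Lemma rpure_tau V X (a : A) (v : V) (x : X) :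
  rpure (pure a v : AV_rmodule A V) x = tau v (actA a x).
Proof.
rewrite /tau /actA -rpure_balanced AV_ractE AV_rmul_pure tmap_pure lfunE /= mul1r.
by rewrite ract1E.
Qed.

Lemma tau_bilin V X : bilin (@tau V X).
Proof.
split=> [x c v v'|v c x x']; rewrite /tau; last exact: (rpure_bilin _ _).2.
by rewrite pureDr pureZr (rpure_bilin _ _).1.
Qed.

Lemma tau0r V X (v : V) : tau v (0 : X) = 0.
Proof.
by have := (tau_bilin V X).2 v (-1) 0 0; rewrite scaler0 addr0 scaleN1r addNr.
Qed.

Lemma tau_balanced V X (b : B) (v : V) (x : X) :
  tau (ract V b v) x = tau v (actB b x) :> TB V X.
Proof.
rewrite /tau /actB -rpure_balanced AV_ractE AV_rmul_pure tmap_pure lfunE /=.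
by rewrite mulr1.
Qed.

Lemma tau_act V X (a : A) (v : V) (x : X) : act (TB V X) a (tau v x) = tau v (actA a x).
Proof.
rewrite mkmoduleE {1}/tau /rpure btens_mulE tmap_pure id_lfunE.
have -> : lact (AtensV A V) a (pure 1 v) = pure a v.
  rewrite [LHS](lfun2E _ _ (AV_lmul_bilin A V)) /AV_lmul tmap_pure.
  by rewrite lfunE /= mulr1 id_lfunE.
exact: rpure_tau.
Qed.

Lemma tau_ind V X (P : TB V X -> Prop) :
    (forall v x, P (tau v x)) ->
    (forall c s t, P s -> P t -> P (c *: s + t)) ->
  forall t, P t.
Proof.
move=> Pt PL t; rewrite -(quotv_reprK t).
elim/(@tens_ind (AV_rmodule A V) X): (quotv_repr _ t) => [m x|c y z IHy IHz].
  rewrite -/(rpure m x); elim/(@tens_ind A V): m => [a v|c m m' IH IH'].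
    by rewrite rpure_tau.
  by rewrite (rpure_bilin _ _).1; apply: PL.
by rewrite linearP; apply: PL.
Qed.

Lemma tau_ext V X (U : vectType k) (f g : 'Hom(TB V X, U)) :
  (forall v x, f (tau v x) = g (tau v x)) -> forall t, f t = g t.
Proof.
move=> fg; apply: tau_ind => // c s t IHs IHt.
by rewrite !linearP /= IHs IHt.
Qed.

Section Lift.
Variables (V : rmodule B) (X : module (talg A B)) (U : vectType k).
Variable beta : V -> X -> U.

Definition tau_lift_fun (m : AV_rmodule A V) (x : X) : U :=
  tlift (fun (a : A) (v : V) => beta v (actA a x)) m.

(** Total in [beta], so that a map can be named before it is checked; [tau_liftE] is the universal
    property for bilinear balanced [beta]. *)
Definition tau_lift : 'Hom(TB V X, U) :=
  locked (linfun (tlift tau_lift_fun) \o quotv_repr (balance (AV_rmodule A V) X))%VF.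

Hypothesis beta_bilin : bilin beta.
Hypothesis beta_bal : forall b v x, beta (ract V b v) x = beta v (actB b x).

Lemma tau_lift_fun_pure a v x : tau_lift_fun (pure a v) x = beta v (actA a x).
Proof.
rewrite /tau_lift_fun tlift_pure //; split=> [w c a1 a2|a1 c w w'].
  by rewrite (actA_bilin X).1 beta_bilin.2.
exact: beta_bilin.1.
Qed.

Lemma tau_lift_fun_bilin : bilin tau_lift_fun.
Proof.
split=> [x c m m'|m c x x']; first exact: tlift_linear.
elim/(@tens_ind A V): m => [a v|d m m' IH IH'].
  by rewrite !tau_lift_fun_pure (actA_bilin X).2 beta_bilin.2.
have L y : tau_lift_fun (d *: m + m') y = d *: tau_lift_fun m y + tau_lift_fun m' y.
  exact: tlift_linear.
rewrite !L IH IH' !scalerDr !scalerA [d * c]mulrC.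
by rewrite -!addrA; congr (_ + _); rewrite addrCA.
Qed.

Lemma tau_liftE v x : tau_lift (tau v x) = beta v x.
Proof.
set F := linfun (tlift tau_lift_fun).
have FE m y : F (pure m y) = tau_lift_fun m y.
  by rewrite /F lfunE /= tlift_pure //; apply: tau_lift_fun_bilin.
have Fb : (balance (AV_rmodule A V) X <= lker F)%VS.
  apply: balance_sub => l m y; rewrite !FE AV_ractE.
  elim/(@tens_ind A B): l => [a b|c l l' IH IH']; last first.
    by rewrite (AV_rmul_bilin A V).1 (act_bilin X).1 tau_lift_fun_bilin.1
               tau_lift_fun_bilin.2 IH IH'.
  rewrite AV_rmul_pure act_pureE.
  elim/(@tens_ind A V): m => [a' v'|c m m' IH IH']; last first.
    by rewrite linearP /= !tau_lift_fun_bilin.1 IH IH'.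
  by rewrite tmap_pure !tau_lift_fun_pure lfunE /= beta_bal -actAM -actAB.
rewrite /tau_lift -lock comp_lfunE -/F.
have -> : F (quotv_repr _ (tau v x)) = F (pure (pure 1 v) x).
  apply/eqP; rewrite -subr_eq0 -linearB -memv_ker.
  by apply: (subvP Fb); apply: quotv_piK.
by rewrite FE tau_lift_fun_pure actA1.
Qed.

End Lift.

Definition rhom V W (j : 'Hom(V, W)) : Prop :=
  forall b v, j (ract V b v) = ract W b (j v).

Lemma rhom1 V : rhom (\1%VF : 'Hom(V, V)).
Proof. by move=> b v; rewrite !id_lfunE. Qed.

Definition TBmap V W X Y (j : 'Hom(V, W)) (f : 'Hom(X, Y)) : 'Hom(TB V X, TB W Y) :=
  tau_lift (fun v x => tau (j v) (f x)).

Lemma TBmapE V W X Y (j : 'Hom(V, W)) (f : 'Hom(X, Y)) v x :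
  rhom j -> Blin f -> TBmap j f (tau v x) = tau (j v) (f x).
Proof.
move=> jH fB; apply: (tau_liftE (beta := fun v x => tau (j v) (f x))).
  split=> [y c u u'|u c y y']; rewrite linearP; first exact: (tau_bilin _ _).1.
  exact: (tau_bilin _ _).2.
by move=> b u y; rewrite jH fB tau_balanced.
Qed.

Lemma TBmap_hom V W X Y (j : 'Hom(V, W)) (f : 'Hom(X, Y)) :
  rhom j -> is_hom f -> is_hom (TBmap j f).
Proof.
move=> jH /is_hom_ABlin[fA fB] a t; elim/tau_ind: t => [v x|c s t IHs IHt].
  by rewrite tau_act !TBmapE // tau_act fA.
by rewrite !linearP /= IHs IHt.
Qed.

Lemma TBmap_rtens_map V X Y (f : 'Hom(X, Y)) (t : TB V X) : is_hom f ->
  rtens_map (AtensV A V) f t = TBmap \1 f t.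
Proof.
move=> fH; have [_ fB] := (is_hom_ABlin _).1 fH.
elim/tau_ind: t => [v x|c s t IHs IHt]; last by rewrite !linearP /= IHs IHt.
by rewrite TBmapE ?id_lfunE ?rtens_map_pure //; apply: rhom1.
Qed.

Lemma TBmap_comp V1 V2 V3 X1 X2 X3 (j : 'Hom(V1, V2)) (j' : 'Hom(V2, V3))
    (f : 'Hom(X1, X2)) (f' : 'Hom(X2, X3)) t :
    rhom j -> rhom j' -> Blin f -> Blin f' ->
  TBmap j' f' (TBmap j f t) = TBmap (j' \o j) (f' \o f) t.
Proof.
move=> jH jH' fB fB'; rewrite -comp_lfunE; move: t; apply: tau_ext => v x.
rewrite comp_lfunE !TBmapE ?comp_lfunE // => b y; rewrite !comp_lfunE.
  by rewrite jH jH'.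
by rewrite fB fB'.
Qed.

(** A map from V (x)_B Z back to the cokernel of 1 (x) f is built from a k-linear section [s] of
    [g]. Modulo the image of 1 (x) f, the class of v (x) s z depends only on v and z, which makes it
    balanced. *)
Lemma TBmap_exact_r V X Y Z (f : 'Hom(X, Y)) (g : 'Hom(Y, Z)) :
    short_exact f g ->
  (forall t, exists s, TBmap \1 g s = t :> TB V Z) /\
  forall t : TB V Y, TBmap \1 g t = 0 <-> exists s, TBmap \1 f s = t.
Proof.
move=> fg; have [fH gH fI gS fgE] := (short_exactP _ _).1 fg.
have [_ fB] := (is_hom_ABlin _).1 fH; have [_ gB] := (is_hom_ABlin _).1 gH.
have H1 := @rhom1 V; have [s gs] := lfun_section gS; split.
  apply: tau_ind => [v x|c t1 t2 [s1 <-] [s2 <-]].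
    by exists (tau v (s x)); rewrite TBmapE // id_lfunE gs.
  by exists (c *: s1 + s2); rewrite linearP.
set I := limg (TBmap (\1 : 'Hom(V, V)) f).
pose beta (v : V) (z : Z) : quotv I := quotv_pi I (tau v (s z)).
have If v x : tau v (f x) \in I.
  by apply/limgP; exists (tau v x); rewrite TBmapE // id_lfunE.
have betaE v y : beta v (g y) = quotv_pi I (tau v y).
  apply/eqP; rewrite quotv_pi_eq -[X in _ - X]scale1r -scaleNr addrC -(tau_bilin _ _).2.
  rewrite scaleN1r addrC; have /fgE[x <-] : g (s (g y) - y) = 0.
    by rewrite linearB /= gs subrr.
  exact: If.
have bb : bilin beta.
  split=> [z c v v'|v c z z']; rewrite /beta.
    by rewrite (tau_bilin _ _).1 linearP.
  by rewrite linearP (tau_bilin _ _).2 linearP.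
have bal b v z : beta (ract V b v) z = beta v (actB b z).
  by have [y <-] := gS z; rewrite -gB !betaE tau_balanced.
move=> t; split=> [t0|[u <-]].
  apply/limgP; rewrite -[t]subr0 -quotv_pi_eq linear0.
  have : quotv_pi I t = (tau_lift beta \o TBmap \1 g)%VF t.
    move: t {t0}; apply: tau_ext => v y.
    by rewrite comp_lfunE TBmapE // id_lfunE tau_liftE // betaE.
  by rewrite comp_lfunE t0 linear0 => ->.
rewrite TBmap_comp // -[RHS](zero_lfunE _ u); move: u; apply: tau_ext => v x.
rewrite TBmapE => [|b w|b w]; last 2 first.
- by rewrite !comp_lfunE !id_lfunE.
- by rewrite !comp_lfunE fB gB.
by rewrite zero_lfunE !comp_lfunE (short_exact0 _ fg) tau0r.
Qed.

End TensorOverB.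

(** * Coinduction *)

Section Coinduction.
Variables (k : fieldType) (A B : falgType k).
Implicit Types (V W : rmodule B) (X Y Z P : module (talg A B)) (L M N Q : module A).

Lemma tau0l V X (x : X) : tau (0 : V) x = 0.
Proof.
by have := (tau_bilin V X).1 x (-1) 0 0; rewrite scaler0 addr0 scaleN1r addNr.
Qed.

(** The argument of [TBmap_exact_r] in the other variable, with a k-linear section of [p]. *)
Lemma TBmap_exact_l V' V W X (i : 'Hom(V', V)) (p : 'Hom(V, W)) :
    rhom i -> rhom p -> (forall w, exists v, p v = w) ->
    (forall v, p v = 0 <-> exists u, i u = v) ->
  (forall t, exists s, TBmap p \1 s = t :> TB W X) /\
  forall t : TB V X, TBmap p \1 t = 0 <-> exists s, TBmap i \1 s = t.
Proof.
move=> iH pH pS ipE; have [s ps] := lfun_section pS.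
have B1 : Blin (\1%VF : 'Hom(X, X)) by move=> b x; rewrite !id_lfunE.
split.
  apply: tau_ind => [w x|c t1 t2 [s1 <-] [s2 <-]].
    by exists (tau (s w) x); rewrite TBmapE // id_lfunE ps.
  by exists (c *: s1 + s2); rewrite linearP.
set I := limg (TBmap i (\1 : 'Hom(X, X))).
pose beta (w : W) (x : X) : quotv I := quotv_pi I (tau (s w) x).
have Ii v x : tau (i v) x \in I.
  by apply/limgP; exists (tau v x); rewrite TBmapE // id_lfunE.
have betaE v x : beta (p v) x = quotv_pi I (tau v x).
  apply/eqP; rewrite quotv_pi_eq -[X in _ - X]scale1r -scaleNr addrC -(tau_bilin _ _).1.
  rewrite scaleN1r addrC; have /ipE[u <-] : p (s (p v) - v) = 0.
    by rewrite linearB /= ps subrr.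
  exact: Ii.
have bb : bilin beta.
  split=> [x c w w'|w c x x']; rewrite /beta.
    by rewrite linearP (tau_bilin _ _).1 linearP.
  by rewrite (tau_bilin _ _).2 linearP.
have bal b w x : beta (ract W b w) x = beta w (actB b x).
  by have [v <-] := pS w; rewrite -pH !betaE tau_balanced.
move=> t; split=> [t0|[u <-]].
  apply/limgP; rewrite -[t]subr0 -quotv_pi_eq linear0.
  have : quotv_pi I t = (tau_lift beta \o TBmap p \1)%VF t.
    move: t {t0}; apply: tau_ext => v y.
    by rewrite comp_lfunE TBmapE // id_lfunE tau_liftE // betaE.
  by rewrite comp_lfunE t0 linear0 => ->.
elim/tau_ind: u => [v x|c u u' IH IH']; last by rewrite !linearP /= IH IH' scaler0 addr0.
rewrite !TBmapE // (_ : p (i v) = 0) ?tau0l //.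
by apply/ipE; exists v.
Qed.

Section Coind.
Variables (V : rmodule B) (N : module A).

Definition coind_act (l : talg A B) (h : 'Hom(V, N)) : 'Hom(V, N) :=
  tlift (fun (a : A) (b : B) => (act N a \o h \o ract V b)%VF) l.

Lemma coind_act_bilin : bilin coind_act.
Proof.
split=> [h c l l'|l c h h']; first exact: tlift_linear.
rewrite /coind_act /tlift scaler_sumr -big_split; apply: eq_bigr => i _ /=.
rewrite scaler_sumr -big_split; apply: eq_bigr => j _ /=.
by rewrite comp_lfunDr comp_lfunDl scalerDr -comp_lfunZr -comp_lfunZl !scalerA mulrC.
Qed.

Lemma coind_act_pure a b h :
  coind_act (pure a b) h = (act N a \o h \o ract V b)%VF.
Proof.
rewrite /coind_act tlift_pure //; split=> [c d a1 a2|c d b1 b2]; rewrite linearP.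
  by rewrite comp_lfunDl comp_lfunDl -!comp_lfunZl.
by rewrite comp_lfunDr -comp_lfunZr.
Qed.

Lemma coind_act1 h : coind_act 1 h = h.
Proof.
by rewrite -[1]/(pure 1 1) coind_act_pure act1 ract1 comp_lfun1l comp_lfun1r.
Qed.

Lemma coind_actM l l' h : coind_act (l * l') h = coind_act l (coind_act l' h).
Proof.
have [bl br] := coind_act_bilin.
elim/(@tens_ind _ A B): l => [a b|c l1 l2 IH1 IH2]; last first.
  by rewrite mulrDl -scalerAl bl IH1 IH2 bl.
elim/(@tens_ind _ A B): l' => [a' b'|c l1 l2 IH1 IH2]; last first.
  by rewrite mulrDr -scalerAr bl IH1 IH2 bl br.
rewrite talg_pureM !coind_act_pure actM ractM.
by rewrite !comp_lfunA.
Qed.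

(* Hom_k(V, N), with ((a (x) b) h)(v) = a h(v b) *)
Definition coind : module (talg A B) :=
  mkmodule coind_act_bilin coind_act1 coind_actM.

Lemma coind_actA a (h : 'Hom(V, N)) v : (actA a (h : coind) : 'Hom(V, N)) v = act N a (h v).
Proof. by rewrite /actA mkmoduleE coind_act_pure !comp_lfunE ract1E. Qed.

Lemma coind_actB b (h : 'Hom(V, N)) v : (actB b (h : coind) : 'Hom(V, N)) v = h (ract V b v).
Proof. by rewrite /actB mkmoduleE coind_act_pure !comp_lfunE act1E. Qed.

End Coind.

Lemma coind_adjunct V X N (F : 'Hom(TB V X, N)) : is_hom F ->
  exists f : 'Hom(X, coind V N), is_hom f /\
    forall x v, (f x : 'Hom(V, N)) v = F (tau v x).
Proof.
move=> FH.
have tL x : linear (fun v : V => F (tau v x)).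
  by move=> c v w; rewrite (tau_bilin _ _).1 linearP.
have /choice[f0 f0E] : forall x, exists h : 'Hom(V, N), forall v, h v = F (tau v x).
  by move=> x; apply: lfun_ex.
have [|f fE] := @lfun_ex _ X (coind V N) f0.
  move=> c x y; apply/lfunP=> v.
  by rewrite add_lfunE scale_lfunE !f0E (tau_bilin _ _).2 linearP.
have fE' x v : (f x : 'Hom(V, N)) v = F (tau v x) by rewrite fE f0E.
exists f; split=> //; apply/is_hom_ABlin; split=> [a x|b x]; apply/lfunP=> v.
  by rewrite coind_actA !fE' -FH tau_act.
by rewrite coind_actB !fE' tau_balanced.
Qed.

Lemma coind_unadjunct V X N (f : 'Hom(X, coind V N)) : is_hom f ->
  exists F : 'Hom(TB V X, N), is_hom F /\
    forall v x, F (tau v x) = (f x : 'Hom(V, N)) v.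
Proof.
move=> /is_hom_ABlin[fA fB]; pose beta (v : V) (x : X) : N := (f x : 'Hom(V, N)) v.
have bb : bilin beta.
  split=> [x c v w|v c x y]; rewrite /beta linearP //.
  by rewrite [LHS]add_lfunE scale_lfunE.
have bal b v x : beta (ract V b v) x = beta v (actB b x).
  by rewrite /beta fB coind_actB.
have FE v x : tau_lift beta (tau v x) = (f x : 'Hom(V, N)) v by rewrite tau_liftE.
exists (tau_lift beta); split=> // a t.
elim/tau_ind: t => [v x|c s t IHs IHt]; last by rewrite !linearP /= IHs IHt.
by rewrite tau_act !FE fA coind_actA.
Qed.

Lemma coind_hom_ex V M N (f : 'Hom(M, N)) : is_hom f ->
  exists F : 'Hom(coind V M, coind V N), is_hom F /\
    forall h : 'Hom(V, M), F h = (f \o h)%VF.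
Proof.
move=> fH; have [|F FE] := @lfun_ex _ (coind V M) (coind V N) 
    (fun h : 'Hom(V, M) => (f \o h)%VF : 'Hom(V, N)).
  by move=> c h h'; rewrite comp_lfunDr comp_lfunZr.
exists F; split=> //; apply/is_hom_ABlin.
by split=> [a h|b h]; apply/lfunP=> v; rewrite !FE ?coind_actA ?coind_actB !comp_lfunE
  ?coind_actA ?coind_actB // fH.
Qed.

Lemma coind_ses V L M N (f : 'Hom(L, M)) (g : 'Hom(M, N)) : short_exact f g ->
  exists (F : 'Hom(coind V L, coind V M)) (G : 'Hom(coind V M, coind V N)),
    [/\ short_exact F G, forall h : 'Hom(V, L), F h = (f \o h)%VF
      & forall h : 'Hom(V, M), G h = (g \o h)%VF].
Proof.
move=> /short_exactP[fH gH fI gS fgE].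
have [F [FH FE]] := coind_hom_ex V fH; have [G [GH GE]] := coind_hom_ex V gH.
exists F, G; split=> //; apply/short_exactP; split=> // [h Fh0|h|h].
- apply/lfunP=> v; rewrite zero_lfunE; apply: fI.
  by have /lfunP/(_ v) := Fh0; rewrite FE comp_lfunE zero_lfunE.
- have [s gs] := lfun_section gS; exists (s \o h : 'Hom(V, M))%VF.
  by rewrite GE; apply/lfunP=> v; rewrite !comp_lfunE gs.
have [r rf] := lfun_retraction fI.
split=> [Gh0|[h' <-]]; last first.
  rewrite FE GE; apply/lfunP=> v; rewrite !comp_lfunE zero_lfunE.
  by apply/fgE; exists ((h' : 'Hom(V, L)) v).
exists (r \o h : 'Hom(V, L))%VF; rewrite FE; apply/lfunP=> v; rewrite !comp_lfunE.
have /fgE[x <-] : g ((h : 'Hom(V, M)) v) = 0.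
  by have /lfunP/(_ v) := Gh0; rewrite GE comp_lfunE zero_lfunE.
by rewrite rf.
Qed.

(** A left adjoint of an exact functor preserves projectives: the lifting problem is transposed to
    one for P along Hom_k(V, M) -> Hom_k(V, N). *)
Lemma TB_projective V P : projective P -> projective (TB V P).
Proof.
move=> /projectiveP PP; apply/projectiveP=> M N g F gH gS FH.
have [K [i ig]] := kernel_ses gH gS.
have [I0 [G [IG _ GE]]] := coind_ses V ig.
have [_ GH _ GS _] := (short_exactP _ _).1 IG.
have [f [fH fE]] := coind_adjunct FH.
have [h [hH hE]] := PP _ _ G f GH GS fH.
have [H [HH HE]] := coind_unadjunct hH.
exists H; split=> // t; rewrite -comp_lfunE; move: t; apply: tau_ext => v x.
by rewrite comp_lfunE HE -fE -hE GE comp_lfunE.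
Qed.

Definition DB : rmodule B := dual (regular B).

Definition bdual (i : 'I_(dim B)) : DB :=
  linfun ((fun b => v2r b 0 i) : B -> k^o).

Lemma bdualE i b : (bdual i : 'Hom(B, k^o)) b = v2r b 0 i.
Proof.
by rewrite [LHS]linfunE // => c x y; rewrite linearP !mxE.
Qed.

Lemma DB_ractE b (phi : DB) x :
  (ract DB b phi : 'Hom(B, k^o)) x = (phi : 'Hom(B, k^o)) (b * x).
Proof.
rewrite [ract DB b phi](lfun2E _ _ (dual_mul_bilin (regular B))) /dual_mul comp_lfunE.
by rewrite regularE.
Qed.

Lemma DB_sum (phi : DB) :
  phi = \sum_i ((phi : 'Hom(B, k^o)) (vbase i) : k) *: bdual i.
Proof.
apply/lfunP=> b; rewrite sum_lfunE {1}[b]vbaseE linear_sum; apply: eq_bigr => i _.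
by rewrite linearZ scale_lfunE bdualE [RHS]mulrC.
Qed.

Section Psi.
Variable M : module A.
Local Notation H := (coind DB M).

(** The element b (x) m under Hom_k(D(B), M) = B (x) M. *)
Definition elem (m : M) (b : B) : H :=
  linfun (fun phi : DB => ((phi : 'Hom(B, k^o)) b : k) *: m).

Lemma elemE m b (phi : DB) :
  (elem m b : 'Hom(DB, M)) phi = ((phi : 'Hom(B, k^o)) b : k) *: m.
Proof.
rewrite [LHS]linfunE // => c x y.
by rewrite add_lfunE scale_lfunE scalerDl scalerA.
Qed.

Lemma elem_bilin : bilin elem.
Proof.
split=> [b c m m'|m c b b']; apply/lfunP=> phi; rewrite add_lfunE scale_lfunE !elemE.
  by rewrite scalerDr !scalerA mulrC.
by rewrite linearP scalerDl scalerA.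
Qed.

Lemma elem_actB b m b' : actB b (elem m b') = elem m (b * b').
Proof. by apply/lfunP=> phi; rewrite coind_actB !elemE DB_ractE. Qed.

Lemma elem_actA a m b : actA a (elem m b) = elem (act M a m) b.
Proof. by apply/lfunP=> phi; rewrite coind_actA !elemE linearZ. Qed.

Lemma elem_sum (h : H) : h = \sum_i elem ((h : 'Hom(DB, M)) (bdual i)) (vbase i).
Proof.
apply/lfunP=> phi; rewrite sum_lfunE {1}[phi]DB_sum linear_sum.
by apply: eq_bigr => i _; rewrite linearZ elemE.
Qed.

(* under Hom_k(D(B), M) = B (x) M, the B-linear extension of kappa *)
Definition Psi (N : module B) (kappa : 'Hom(M, N)) : 'Hom(H, N) :=
  linfun (fun h : 'Hom(DB, M) => \sum_i act N (vbase i) (kappa (h (bdual i)))).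

Lemma PsiE (N : module B) (kappa : 'Hom(M, N)) (h : 'Hom(DB, M)) :
  Psi kappa h = \sum_i act N (vbase i) (kappa (h (bdual i))).
Proof.
rewrite [LHS]linfunE // => c x y.
rewrite scaler_sumr -big_split; apply: eq_bigr => i _ /=.
by rewrite add_lfunE scale_lfunE !linearP.
Qed.

Lemma Psi_elem (N : module B) (kappa : 'Hom(M, N)) m b :
  Psi kappa (elem m b) = act N b (kappa m).
Proof.
rewrite PsiE [b in RHS]vbaseE linear_sum sum_lfunE; apply: eq_bigr => i _.
by rewrite elemE bdualE !linearZ scale_lfunE.
Qed.

Lemma Psi_actB (N : module B) (kappa : 'Hom(M, N)) b (h : H) :
  Psi kappa (actB b h) = act N b (Psi kappa h).
Proof.
rewrite [h]elem_sum.
have -> : actB b (\sum_i elem ((h : 'Hom(DB, M)) (bdual i)) (vbase i)) =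
    \sum_i elem ((h : 'Hom(DB, M)) (bdual i)) (b * vbase i).
  rewrite /actB linear_sum; apply: eq_bigr => i _; exact: elem_actB.
rewrite linear_sum [in RHS]linear_sum linear_sum; apply: eq_bigr => i _.
by rewrite /= !Psi_elem actME.
Qed.

Lemma Psi_B (N : module B) (kappa : 'Hom(M, N)) :
  is_hom (Psi kappa : 'Hom(resB H, N)).
Proof. by move=> b h; rewrite resBE; apply: Psi_actB. Qed.

Lemma Psi_elem_resB X (kappa : 'Hom(M, resB X)) m b :
  (Psi kappa : 'Hom(H, X)) (elem m b) = actB b (kappa m : X).
Proof. exact: etrans (Psi_elem kappa m b) (resBE _ _). Qed.

Lemma Psi_A X (kappa : 'Hom(M, resB X)) :
    (forall a m, kappa (act M a m) = actA a (kappa m : X)) ->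
  is_hom (Psi kappa : 'Hom(H, X)).
Proof.
move=> kA; apply/is_hom_ABlin; split; last first.
  by move=> b h; apply: etrans (Psi_actB kappa b h) _; rewrite resBE.
move=> a h; rewrite [h]elem_sum /actA !linear_sum; apply: eq_bigr => i _ /=.
have -> : act H (pure a 1) (elem ((h : 'Hom(DB, M)) (bdual i)) (vbase i)) =
  elem (act M a ((h : 'Hom(DB, M)) (bdual i))) (vbase i) by apply: elem_actA.
by rewrite !Psi_elem_resB kA -actAB.
Qed.

(** Over B this is the free module B (x) M, so it is enough to lift the images of the elements 1 (x)
    m, and that k-linearly. *)
Lemma coind_resB_projective : projective (resB H).
Proof.
apply/projectiveP=> N1 N2 g f gH gS fH; have [s gs] := lfun_section gS.
have [|e eE] := @lfun_ex _ M H (fun m => elem m 1).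
  by move=> c m m'; apply: elem_bilin.1.
exists (Psi (s \o f \o e)%VF); split=> [|h]; first exact: Psi_B.
rewrite [h]elem_sum !linear_sum; apply: eq_bigr => i _ /=.
rewrite Psi_elem gH !comp_lfunE gs eE -fH resBE.
by congr (f _); rewrite elem_actB mulr1.
Qed.

(** As a Lambda-module this is Lambda (x)_A M: the map m |-> f (1 (x) m) is lifted over A, and its
    B-linear extension by [Psi] is Lambda-linear. *)
Lemma coind_projective : projective M -> projective H.
Proof.
move=> /projectiveP MP; apply/projectiveP=> N1 N2 g f gH gS fH.
have [gA gB] := (is_hom_ABlin _).1 gH; have [fA fB] := (is_hom_ABlin _).1 fH.
have [|e eE] := @lfun_ex _ M H (fun m => elem m 1).
  by move=> c m m'; apply: elem_bilin.1.
have gH' : is_hom (g : 'Hom(resA N1, resA N2)) by move=> a x; rewrite !resAE.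
have [|kappa [kH kE]] := MP (resA N1) (resA N2) g (f \o e)%VF gH' gS.
  by move=> a x; rewrite !resAE !comp_lfunE !eE -elem_actA fA.
exists (Psi (kappa : 'Hom(M, resB N1))); split=> [|h].
  by apply: Psi_A => a m; rewrite kH resAE.
rewrite [h]elem_sum !linear_sum; apply: eq_bigr => i _ /=.
rewrite Psi_elem_resB gB kE comp_lfunE eE -fB.
by congr (f _); rewrite elem_actB mulr1.
Qed.

End Psi.

Lemma coind_cover X : exists Q (p : 'Hom(coind DB Q, X)),
  [/\ projective Q, is_hom p & forall x, exists h, p h = x].
Proof.
have [p [pH pS _]] := free_cover (resA X).
exists (free_module A (resA X)), (Psi (p : 'Hom(_, resB X))); split.
- exact: free_projective.
- by apply: Psi_A => a m; rewrite pH resAE.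
by move=> x; have [y py] := pS x; exists (elem y 1); rewrite Psi_elem_resB actB1 py.
Qed.

Lemma projective_coind_retract P : projective P ->
  exists Q (i : 'Hom(P, coind DB Q)) (p : 'Hom(coind DB Q, P)),
  [/\ projective Q, is_hom i, is_hom p & forall x, p (i x) = x].
Proof.
move=> PP; have [Q [p [QP pH pS]]] := coind_cover P.
have [K [j jp]] := kernel_ses pH pS.
have [i [iH pi]] := projective_section jp PP.
by exists Q, i, p.
Qed.

Lemma projective_resB P : projective P -> projective (resB P).
Proof.
move=> /projective_coind_retract[Q [i [p [_ iH pH pi]]]].
have [_ iB] := (is_hom_ABlin _).1 iH; have [_ pB] := (is_hom_ABlin _).1 pH.
have iH' : is_hom (i : 'Hom(resB P, resB (coind DB Q))) by apply/is_hom_resB.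
have pH' : is_hom (p : 'Hom(resB (coind DB Q), resB P)) by apply/is_hom_resB.
apply: (projective_retract iH' pH') => //.
exact: coind_resB_projective.
Qed.

End Coinduction.

(** * Modules projective over B *)

Section BProjective.
Variables (k : fieldType) (A B : falgType k).
Implicit Types (V W : rmodule B) (X Y Z P K : module (talg A B)) (M N Q : module A).

(** The sequence splits over B, and the tensored B-linear retraction is a left inverse of 1 (x)
    f. *)
Lemma TB_ses V X Y Z (f : 'Hom(X, Y)) (g : 'Hom(Y, Z)) :
    short_exact f g -> projective (resB Z) ->
  short_exact (TBmap (\1 : 'Hom(V, V)) f) (TBmap (\1 : 'Hom(V, V)) g).
Proof.
move=> fg ZP; have [t [tH gt]] := projective_section (short_exact_resB fg) ZP.
have [r [rH rf _]] := section_retraction (short_exact_resB fg) tH gt.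
have [gS fgE] := TBmap_exact_r V fg; have [fH gH _ _ _] := (short_exactP _ _).1 fg.
have [_ fB] := (is_hom_ABlin _).1 fH.
have rB : Blin (r : 'Hom(Y, X)) by apply/is_hom_resB.
apply/short_exactP; split=> //; try exact: (TBmap_hom (@rhom1 _ _ V)).
have H : forall u, (TBmap (\1 : 'Hom(V, V)) (r : 'Hom(Y, X)) \o
    TBmap (\1 : 'Hom(V, V)) f)%VF u = (\1%VF : 'End(TB V X)) u.
  apply: tau_ext => v x; have H1 := @rhom1 _ _ V.
  by rewrite comp_lfunE !TBmapE // !id_lfunE rf.
by move=> u u0; have := H u; rewrite comp_lfunE u0 linear0 id_lfunE.
Qed.

(* V (x)_B X is a retract of V (x)_k X, naturally in V *)
Lemma TBmap_inj_l V W X (i : 'Hom(V, W)) :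
    projective (resB X) -> rhom i -> (forall v, i v = 0 -> v = 0) ->
  forall t : TB V X, TBmap i \1 t = 0 -> t = 0.
Proof.
move=> XP iH iI; have [p [pH pS pE]] := free_cover (resB X).
have [K [j jp]] := kernel_ses pH pS; have [s [sH ps]] := projective_section jp XP.
(* [c u] sends b (x) x to u b (x) x. With the B-linear section [s] of B (x) X -> X, the map v (x) x
   |-> c v (s x) is a section of V (x)_k X -> V (x)_B X. *)
pose c (U : rmodule B) (u : U) : 'Hom(tens B X, tens U X) :=
  linfun (tlift (fun (b : B) (x : X) => pure (ract U b u) x)).
have cE (U : rmodule B) (u : U) b x : c U u (pure b x) = pure (ract U b u) x.
  rewrite /c lfunE /= tlift_pure //; split=> [w d a a'|a d w w'].
    by rewrite (ract_bilin U).1 pureDl pureZl.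
  by rewrite pureDr pureZr.
have cB (U : rmodule B) : bilin (fun (u : U) x => c U u (s x)).
  split=> [x d u u'|u d x x']; last by rewrite !linearP.
  elim/(@tens_ind _ B X): (s x) => [b y|e y z IHy IHz].
    by rewrite !cE linearP pureDl pureZl.
  by rewrite !linearP /= IHy IHz !scalerDr !scalerA mulrC addrACA.
have cb (U : rmodule B) b (u : U) x : c U (ract U b u) (s x) = c U u (s (actB b x)).
  have -> : s (actB b x) = act (free_module B X) b (s x) by rewrite -sH resBE.
  elim/(@tens_ind _ B X): (s x) => [b' y|e y z IHy IHz].
    by rewrite free_act_pure !cE ractME.
  by rewrite !linearP /= IHy IHz.
have [sg sgE] : exists sg : forall U : rmodule B, 'Hom(TB U X, tens U X),
    forall U u x, sg U (tau u x) = c U u (s x).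
  exists (fun U => tau_lift (fun u x => c U u (s x))) => U u x.
  exact: (tau_liftE (cB U) (cb U)).
pose m : 'Hom(tens V X, TB V X) := linfun (tlift (@tau _ _ _ V X)).
have mE v x : m (pure v x) = tau v x by rewrite /m lfunE /= tlift_pure //; apply: tau_bilin.
have msg t : m (sg V t) = t.
  rewrite -comp_lfunE -[RHS]id_lfunE; move: t; apply: tau_ext => v x.
  rewrite comp_lfunE sgE id_lfunE -{2}(ps x).
  elim/(@tens_ind _ B X): (s x) => [b y|e y z IHy IHz].
    by rewrite cE mE pE resBE tau_balanced.
  by rewrite !linearP /= IHy IHz (tau_bilin _ _).2.
have B1 : Blin (\1%VF : 'Hom(X, X)) by move=> b x; rewrite !id_lfunE.
have nat t : sg W (TBmap i \1 t) = tmap i \1 (sg V t).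
  rewrite -!comp_lfunE; move: t; apply: tau_ext => v x.
  rewrite !comp_lfunE TBmapE // !sgE id_lfunE.
  elim/(@tens_ind _ B X): (s x) => [b y|e y z IHy IHz].
    by rewrite !cE tmap_pure id_lfunE iH.
  by rewrite !linearP /= IHy IHz.
move=> t t0; have [r ri] := lfun_retraction iI.
have rK y : tmap r (\1%VF : 'Hom(X, X)) (tmap i \1 y) = y.
  rewrite -comp_lfunE tmap_comp comp_lfun1l.
  suff -> : (r \o i)%VF = \1%VF by rewrite tmap1 id_lfunE.
  by apply/lfunP=> v; rewrite comp_lfunE ri id_lfunE.
by rewrite -[t]msg -[sg V t]rK -nat t0 !linear0.
Qed.

(** A resolution is spliced from presentations chosen for all modules at once. Its syzygies are all
    projective over B, so each short exact piece stays exact under V (x)_B -, and hence so does the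
    spliced complex. *)
Lemma Tor_zero_projective_resB V X : projective (resB X) ->
  forall n, (1 <= n)%N -> Tor_zero n (AtensV A V) X.
Proof.
move=> XP [//|n _].
pose K1 Y := projT1 (cid (projective_cover Y)).
have ex1 Y : exists P (i : 'Hom(K1 Y, P)) (p : 'Hom(P, Y)), projective P /\ short_exact i p
  := projT2 (cid (projective_cover Y)).
pose P1 Y := projT1 (cid (ex1 Y)).
have ex2 Y : exists (i : 'Hom(K1 Y, P1 Y)) (p : 'Hom(P1 Y, Y)),
    projective (P1 Y) /\ short_exact i p
  := projT2 (cid (ex1 Y)).
pose i1 Y := projT1 (cid (ex2 Y)).
have ex3 Y : exists p : 'Hom(P1 Y, Y), projective (P1 Y) /\ short_exact (i1 Y) p
  := projT2 (cid (ex2 Y)).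
pose p1 Y := projT1 (cid (ex3 Y)).
have PP Y : projective (P1 Y) := (projT2 (cid (ex3 Y))).1.
have ip Y : short_exact (i1 Y) (p1 Y) := (projT2 (cid (ex3 Y))).2.
pose S n := iter n K1 X.
pose d n : 'Hom(P1 (S n.+1), P1 (S n)) := (i1 (S n) \o p1 (S n.+1))%VF.
have dH m : is_hom (d m).
  by apply: is_hom_comp; [case: ((short_exactP _ _).1 (ip (S m)))|
    case: ((short_exactP _ _).1 (ip (S m.+1)))].
have pH m : is_hom (p1 (S m)) by case: ((short_exactP _ _).1 (ip (S m))).
have pS m : forall y, exists x, p1 (S m) x = y by case: ((short_exactP _ _).1 (ip (S m))).
have iI m : forall x, i1 (S m) x = 0 -> x = 0 by case: ((short_exactP _ _).1 (ip (S m))).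
have ipE m y : p1 (S m) y = 0 <-> exists x, i1 (S m) x = y.
  by case: ((short_exactP _ _).1 (ip (S m))).
have ex m : limg (i1 (S m) \o p1 (S m.+1))%VF = lker (p1 (S m)).
  apply/vspaceP=> y; rewrite memv_ker; apply/idP/eqP=> [/limgP[x <-]|/ipE[z <-]].
    by rewrite comp_lfunE; apply/ipE; exists (p1 (S m.+1) x).
  by have [x <-] := pS m.+1 z; apply/limgP; exists x; rewrite comp_lfunE.
have kd m : lker (d m) = lker (p1 (S m.+1)).
  apply/vspaceP=> y; rewrite !memv_ker comp_lfunE; apply/eqP/eqP=> [/iI//|->].
  by rewrite linear0.
have SP m : projective (resB (S m)).
  elim: m => [//|m IHm].
  have sm := short_exact_resB (ip (S m)).
  have [t [tH pt]] := projective_section sm IHm.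
  have [r [rH ri _]] := section_retraction sm tH pt.
  have [iH _ _ _ _] := (short_exactP _ _).1 sm.
  exact: (projective_retract iH rH ri) (projective_resB (PP (S m))).
have R0 : surjective_hom (p1 (S 0)).
  by split; [apply: pH|apply/lfun_surjP/pS].
exists (@ProjResolution _ _ X (fun m => P1 (S m)) d (p1 (S 0)) (fun m => PP (S m)) dH R0
  (ex 0) (fun m => etrans (ex m.+1) (esym (kd m)))) => /=.
apply/vspaceP=> y; rewrite memv_ker (TBmap_rtens_map _ (dH n)).
have hi m : Blin (i1 (S m)).
  by apply: ((is_hom_ABlin _).1 _).2; case: ((short_exactP _ _).1 (ip (S m))).
have hp m : Blin (p1 (S m)) by apply: ((is_hom_ABlin _).1 _).2.
have H1 := @rhom1 _ _ V.
have TD m u : TBmap (\1 : 'Hom(V, V)) (d m) u =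
    TBmap \1 (i1 (S m)) (TBmap \1 (p1 (S m.+1)) u).
  by rewrite TBmap_comp // comp_lfun1l.
have [_ _ TiI _ _] := (short_exactP _ _).1 (TB_ses V (ip (S n)) (SP n)).
have [_ _ _ TpS _] := (short_exactP _ _).1 (TB_ses V (ip (S n.+2)) (SP n.+2)).
have [_ _ _ _ TE] := (short_exactP _ _).1 (TB_ses V (ip (S n.+1)) (SP n.+1)).
apply/idP/eqP=> [/limgP[x <-]|].
  rewrite (TBmap_rtens_map _ (dH n.+1)) TD TD.
  set z := TBmap \1 (i1 (S n.+1)) _; suff -> : TBmap \1 (p1 (S n.+1)) z = 0 by rewrite linear0.
  by apply/TE; exists (TBmap (\1 : 'Hom(V, V)) (p1 (S n.+2)) (x : TB V (P1 (S n.+2)))).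
rewrite TD => /TiI/TE[z <-]; have [x <-] := TpS z.
by apply/limgP; exists x; rewrite (TBmap_rtens_map _ (dH n.+1)) TD.
Qed.

(** [Tor_zero] provides information on one resolution. Injectivity is read off there, for the first
    syzygy K0, and carried over to K by comparison maps. *)
Lemma Tor1_zero_inj V X : Tor_zero 1 (AtensV A V) X ->
  forall K P (i : 'Hom(K, P)) (p : 'Hom(P, X)), projective P -> short_exact i p ->
  forall t : TB V K, TBmap \1 i t = 0 -> t = 0.
Proof.
case=> R; set d := res_d R => RE K P i p PP ip.
have H1 := @rhom1 _ _ V.
have homB Y Z (f : 'Hom(Y, Z)) : is_hom f -> Blin f by move=> /is_hom_ABlin[].
have [aH /lfun_surjP aS] := res_aug_surj R.
have dH n : is_hom (d n) by apply: res_d_hom.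
have [K0 [j ja]] := kernel_ses aH aS.
have [jH _ jI _ jaE] := (short_exactP _ _).1 ja.
have dE y : res_aug R y = 0 <-> exists x, d 0 x = y.
  by rewrite -limgP [limg _]res_exact0 memv_ker; split=> [->|/eqP].
have [|q [qH qE]] := factor_inj jH (dH 0) jI.
  by move=> z; apply/jaE/dE; exists z.
have qS z : exists x, q x = z.
  have /dE[x dx] : res_aug R (j z) = 0 := short_exact0 z ja.
  by exists x; apply: (lfun_inj_eq jI); rewrite qE.
have [K' [l lq]] := kernel_ses qH qS.
(* Since j q = d 0, a preimage of [t] under 1 (x) q lies in the kernel of 1 (x) d 0. It therefore
   comes from 1 (x) d 1, and q d 1 = 0. *)
have jinj t : TBmap (\1 : 'Hom(V, V)) j t = 0 -> t = 0.
  have [s <-] := (TBmap_exact_r V lq).1 t.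
  rewrite TBmap_comp ?comp_lfun1l; try by [|apply: homB].
  have -> : (j \o q)%VF = d 0 by apply/lfunP=> x; rewrite comp_lfunE qE.
  rewrite -(TBmap_rtens_map _ (dH 0)) => /eqP.
  rewrite -memv_ker [lker _](esym RE) => /limgP[w].
  rewrite (TBmap_rtens_map _ (dH 1)) => <-.
  rewrite TBmap_comp ?comp_lfun1l; try by [|apply: homB].
  have -> : (q \o d 1)%VF = 0.
    apply/lfunP=> x; rewrite zero_lfunE comp_lfunE; apply: jI; rewrite qE.
    by apply/eqP; rewrite -memv_ker -[lker _](@res_exact _ _ _ R 0); apply/limgP; exists x.
  rewrite -[RHS](zero_lfunE _ w); move: w; apply: tau_ext => v x.
  by rewrite TBmapE // => [|b y]; rewrite !zero_lfunE ?tau0r // /actB linear0.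
have [iH pH iI pS ipE] := (short_exactP _ _).1 ip.
have [h [hH hE]] := (projectiveP _).1 PP _ _ _ p aH aS pH.
have [h' [hH' hE']] := (projectiveP _).1 (@res_proj _ _ _ R 0) _ _ p _ pH pS aH.
have [|u [uH uE]] := factor_inj jH (is_hom_comp hH iH) jI.
  by move=> z; apply/jaE; rewrite comp_lfunE hE (short_exact0 _ ip).
have [|u' [uH' uE']] := factor_inj iH (is_hom_comp hH' jH) iI.
  by move=> z; apply/ipE; rewrite comp_lfunE hE' (short_exact0 _ ja).
(* h' h - 1 takes values in K, as a map [e], so u' u - e i is the identity of K. Tensored with V,
   both terms kill [t]: the first by [jinj], the second by assumption. *)
have [||e [eH eE]] := @factor_inj _ _ _ _ _ i ((h' \o h)%VF - \1)%VF iH _ iI.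
- by apply: is_homB; [apply: is_hom_comp|apply: is_hom1].
- move=> z; apply/ipE; rewrite add_lfunE opp_lfunE comp_lfunE id_lfunE linearB /=.
  by rewrite hE' hE subrr.
move=> t t0; have ut0 : TBmap \1 u t = 0.
  apply: jinj; rewrite TBmap_comp ?comp_lfun1l; try by [|apply: homB].
  have -> : (j \o u)%VF = (h \o i)%VF by apply/lfunP=> x; rewrite comp_lfunE uE.
  have := TBmap_comp (j := \1%VF) t H1 H1 (homB _ _ _ iH) (homB _ _ _ hH).
  by rewrite comp_lfun1l => <-; rewrite t0 linear0.
have H : t = ((TBmap (\1 : 'Hom(V, V)) u' \o TBmap \1 u)%VF -
    (TBmap (\1 : 'Hom(V, V)) e \o TBmap \1 i)%VF) t.
  rewrite -[LHS]id_lfunE; move: t {t0 ut0}; apply: tau_ext => v x.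
  rewrite id_lfunE add_lfunE opp_lfunE !comp_lfunE !TBmapE ?id_lfunE;
    try by [|apply: homB].
  rewrite -scaleN1r addrC -(tau_bilin _ _).2; congr tau.
  rewrite scaleN1r; apply: (lfun_inj_eq iI).
  rewrite linearD linearN /= eE uE' comp_lfunE uE !add_lfunE opp_lfunE !comp_lfunE id_lfunE.
  by rewrite opprB subrK.
by rewrite H add_lfunE opp_lfunE !comp_lfunE ut0 t0 !linear0 addr0.
Qed.

End BProjective.

(** * Tor-vanishing against all D(S) as projectivity over B *)

Section MonCharacterization.
Variables (k : fieldType) (A B : falgType k).
Implicit Types (V W : rmodule B) (X Y Z P K : module (talg A B)) (S M N L : module B).

Lemma dual_ractE S b (phi : dual S) x :
  (ract (dual S) b phi : 'Hom(S, k^o)) x = (phi : 'Hom(S, k^o)) (act S b x).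
Proof.
by rewrite [ract (dual S) b phi](lfun2E _ _ (dual_mul_bilin S)) /dual_mul comp_lfunE.
Qed.

Lemma dual_hom_ex M N (f : 'Hom(M, N)) : is_hom f ->
  exists F : 'Hom(dual N, dual M), rhom F /\
    forall phi : 'Hom(N, k^o), F phi = (phi \o f)%VF.
Proof.
move=> fH; have [|F FE] := @lfun_ex _ (dual N) (dual M)
    (fun phi : 'Hom(N, k^o) => (phi \o f)%VF : 'Hom(M, k^o)).
  by move=> c h h'; rewrite comp_lfunDl comp_lfunZl.
exists F; split=> // b phi; apply/lfunP=> x.
by rewrite dual_ractE !FE !comp_lfunE dual_ractE fH.
Qed.

Lemma dual_ses L M N (f : 'Hom(L, M)) (g : 'Hom(M, N)) : short_exact f g ->
  exists (i : 'Hom(dual N, dual M)) (p : 'Hom(dual M, dual L)),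
  [/\ rhom i /\ rhom p, forall phi, i phi = 0 -> phi = 0,
      forall psi, exists phi, p phi = psi
    & forall phi, p phi = 0 <-> exists psi, i psi = phi].
Proof.
move=> /short_exactP[fH gH fI gS fgE].
have [i [iH iE]] := dual_hom_ex gH; have [p [pH pE]] := dual_hom_ex fH.
have [s gs] := lfun_section gS; have [r rf] := lfun_retraction fI.
exists i, p; split=> // [phi|psi|phi].
- rewrite iE => i0; apply/lfunP=> z; have /lfunP/(_ (s z)) := i0.
  by rewrite comp_lfunE gs !zero_lfunE.
- exists ((psi : 'Hom(L, k^o)) \o r)%VF; rewrite pE; apply/lfunP=> x.
  by rewrite !comp_lfunE rf.
rewrite pE; split=> [p0|[psi <-]]; last first.
  rewrite iE; apply/lfunP=> x; rewrite !comp_lfunE zero_lfunE.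
  suff -> : g (f x) = 0 by rewrite linear0.
  by apply/fgE; exists x.
exists ((phi : 'Hom(M, k^o)) \o s)%VF; rewrite iE; apply/lfunP=> y.
rewrite !comp_lfunE; apply/eqP; rewrite -subr_eq0 -linearB; apply/eqP.
have /fgE[x <-] : g (s (g y) - y) = 0 by rewrite linearB /= gs subrr.
by have /lfunP/(_ x) := p0; rewrite comp_lfunE zero_lfunE.
Qed.

Lemma ses_dim L M N (f : 'Hom(L, M)) (g : 'Hom(M, N)) : short_exact f g ->
  \dim {:M} = (\dim {:L} + \dim {:N})%N.
Proof.
case=> -[_ f0] [_ gS] fg; rewrite -(limg_ker_dim g fullv) gS capfv -fg.
by rewrite limg_dim_eq // f0 capv0.
Qed.

(** Induction along a composition series, organized by dimension. *)
Lemma module_induction (T : module B -> Prop) :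
    (forall S, (forall x : S, x = 0) -> T S) ->
    (forall S, simple_module S -> T S) ->
    (forall L M N (f : 'Hom(L, M)) (g : 'Hom(M, N)),
      short_exact f g -> T L -> T N -> T M) ->
  forall M, T M.
Proof.
move=> T0 TS TE.
suff H n M : (\dim {:M} <= n)%N -> T M by move=> M; apply: H (leqnn _).
elim: n M => [|n IHn] M dM.
  by apply: T0; apply/vzeroP/eqP; rewrite -dimv_eq0 -leqn0.
have [M0|M0] := pselect (forall x : M, x = 0); first exact: T0.
have [MS|nU] := pselect (simple_module M); first exact: TS.
have [U [UA Un0 UnT]] : exists U : {vspace M},
    [/\ forall a, (act M a @: U <= U)%VS, U <> 0%VS & U <> fullv].
  apply: contrapT => H; apply: nU; split=> [/vzeroP //|U UA].
  have [->|U0] := pselect (U = 0%VS); [by left|right].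
  by apply: contrapT => UT; apply: H; exists U.
have [||a x|L [f [fH fI fE]]] := @submodule_ex _ _ M (fun x => x \in U).
- exact: mem0v.
- by move=> c x y xU yU; rewrite memvD // memvZ.
- by move=> xU; apply: (subvP (UA a)); apply: memv_img.
have [N [g fg]] := cokernel_ses fH fI.
have dE := ses_dim fg; have [_ _ _ _ fgE] := (short_exactP _ _).1 fg.
have L0 : (0 < \dim {:L})%N.
  rewrite lt0n dimv_eq0; apply/eqP=> /vzeroP LZ; apply: Un0; apply/vspaceP=> x.
  rewrite memv0; apply/idP/eqP=> [/fE[z <-]|->]; last exact: mem0v.
  by rewrite (LZ z) linear0.
have N0 : (0 < \dim {:N})%N.
  rewrite lt0n dimv_eq0; apply/eqP=> /vzeroP NZ; apply: UnT; apply/vspaceP=> x.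
  by rewrite memvf; apply/fE/fgE; apply: NZ.
apply: TE fg _ _; apply: IHn; move: dM; rewrite dE => dM.
  by rewrite -ltnS; apply: leq_trans dM; rewrite -addn1 leq_add2l.
by rewrite -ltnS; apply: leq_trans dM; rewrite -add1n leq_add2r.
Qed.

(** The evaluation D(K) (x)_B K -> k extends k-linearly to D(K) (x)_B P. Such an extension is a
    B-linear map from P to DD(K) = K, and it retracts [i], so the presentation splits over B. *)
Lemma TB_inj_split X K P (i : 'Hom(K, P)) (p : 'Hom(P, X)) :
    short_exact i p -> projective (resB P) ->
    (forall t : TB (dual (resB K)) K, TBmap \1 i t = 0 -> t = 0) ->
  projective (resB X).
Proof.
move=> ip PP iI; have [iH pH _ pS ipE] := (short_exactP _ _).1 ip.
have [_ iB] := (is_hom_ABlin _).1 iH; have [_ pB] := (is_hom_ABlin _).1 pH.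
set V := dual (resB K).
have dR b (phi : V) (x : K) :
    (ract V b phi : 'Hom(K, k^o)) x = (phi : 'Hom(K, k^o)) (actB b x).
  by rewrite -resBE; exact: (@dual_ractE (resB K) b phi x).
pose beta (phi : V) (x : K) : k^o := (phi : 'Hom(K, k^o)) x.
have bb : bilin beta.
  by split=> [x c phi psi|phi c x y]; rewrite /beta ?add_lfunE ?scale_lfunE ?linearP.
have bal b phi x : beta (ract V b phi) x = beta phi (actB b x).
  by rewrite /beta dR.
have [r ri] := lfun_retraction iI.
pose E (phi : V) (y : P) : k^o := tau_lift beta (r (tau phi y)).
have Ei phi x : E phi (i x) = (phi : 'Hom(K, k^o)) x.
  have H1 := @rhom1 _ _ V.
  have -> : E phi (i x) = tau_lift beta (r (TBmap \1 i (tau phi x))).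
    by rewrite TBmapE // id_lfunE.
  by rewrite ri tau_liftE.
have EbB b phi y : E (ract V b phi) y = E phi (actB b y) by rewrite /E tau_balanced.
have El y : linear (E^~ y) by move=> c f g; rewrite /E (tau_bilin _ _).1 !linearP.
have Er phi : linear (E phi) by move=> c x y; rewrite /E (tau_bilin _ _).2 !linearP.
have crd j : linear (fun x : K => v2r x 0 j : k^o) by move=> c x y; rewrite linearP !mxE.
pose e j : V := linfun (fun x : K => v2r x 0 j : k^o).
have eE j x : (e j : 'Hom(K, k^o)) x = v2r x 0 j by rewrite [LHS]linfunE.
(* [q y] is the vector of K on which each functional phi takes the value E phi y, written in
   coordinates. *)
have [q qE] : exists q : 'Hom(P, K), forall y, q y = \sum_j (E (e j) y : k) *: vbase j.
  apply: lfun_ex => c x y; rewrite scaler_sumr -big_split; apply: eq_bigr => j _ /=.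
  by rewrite Er scalerDl scalerA.
have Eq phi y : E phi y = (phi : 'Hom(K, k^o)) (q y).
  have phiE : phi = \sum_j ((phi : 'Hom(K, k^o)) (vbase j) : k) *: e j.
    apply/lfunP=> x; rewrite sum_lfunE {1}[x]vbaseE linear_sum; apply: eq_bigr => j _.
    by rewrite linearZ scale_lfunE eE [RHS]mulrC.
  have [F FE] := lfun_ex (El y).
  rewrite -FE {1}phiE linear_sum qE linear_sum; apply: eq_bigr => j _.
  by rewrite !linearZ /= FE [LHS]mulrC.
have sep (x y : K) :
    (forall phi : V, (phi : 'Hom(K, k^o)) x = (phi : 'Hom(K, k^o)) y) -> x = y.
  by move=> H; apply/v2r_inj/rowP=> j; rewrite -!eE H.
have qi x : q (i x) = x by apply: sep => phi; rewrite -Eq Ei.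
have qB b y : q (actB b y) = actB b (q y).
  by apply: sep => phi; rewrite -Eq -EbB Eq dR.
have qH : is_hom (q : 'Hom(resB P, resB K)) by apply/is_hom_resB.
have pH' : is_hom (p : 'Hom(resB P, resB X)) by apply/is_hom_resB.
have [t [tH pt]] := retraction_section (short_exact_resB ip) qH qi.
exact: projective_retract tH pH' pt PP.
Qed.

Lemma MonP X : Mon B A X <-> projective (resB X).
Proof.
split=> [XM|XP S _ n n1]; last exact: Tor_zero_projective_resB.
have [K [P [i [p [PP ip]]]]] := projective_cover X.
apply: (TB_inj_split ip (projective_resB PP)).
have [iH _ _ _ _] := (short_exactP _ _).1 ip.
have [_ iB] := (is_hom_ABlin _).1 iH.
(* Only the module under the dual is generalized; the map [i] from K to P stays fixed. *)
move: (resB K); apply: module_induction => [S S0|S /XM/(_ 1 isT)/Tor1_zero_inj|].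
- move=> t _; elim/tau_ind: t => [phi x|c s t -> ->]; last by rewrite scaler0 addr0.
  suff -> : phi = 0 by rewrite tau0l.
  by apply/lfunP=> y; rewrite (S0 y) !linear0.
- by apply; [exact: PP|exact: ip].
move=> L M N f g /dual_ses[a [b [[aH bH] aI bS abE]]] TL TN t t0.
have H1 V := @rhom1 _ _ V.
have B1 Y : Blin (\1%VF : 'Hom(Y, Y)) by move=> c x; rewrite !id_lfunE.
have comm V W (j : 'Hom(V, W)) (s : TB V K) : rhom j ->
    TBmap \1 i (TBmap j \1 s) = TBmap j \1 (TBmap \1 i s).
  by move=> jH; rewrite !TBmap_comp // !comp_lfun1l !comp_lfun1r.
(* Chase through D(N) -> D(M) -> D(L) tensored with K and with P: [t] comes from D(N) (x)_B K, and
   D(N) (x)_B P embeds into D(M) (x)_B P because P is projective over B. *)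
have /(TBmap_exact_l K aH bH bS abE).2[s sE] : TBmap b \1 t = 0.
  by apply: TL; rewrite comm // t0 linear0.
rewrite -sE (_ : s = 0) ?linear0 //; apply: TN.
apply: (TBmap_inj_l (projective_resB PP) aH aI).
by rewrite -comm // sE.
Qed.

End MonCharacterization.

(** * Selfinjective algebras *)

Section Selfinjective.
Variables (k : fieldType) (A : falgType k).
Implicit Types (M N Q : module A) (T U L K I : {vspace A}).

Lemma ex_min (T : Type) (P : T -> Prop) (m : T -> nat) : (exists x, P x) ->
  exists x, P x /\ forall y, P y -> (m x <= m y)%N.
Proof.
case=> x; have [n] := ubnP (m x); elim: n x => // n IHn x lt Px.
have [[y [Py yx]]|H] := pselect (exists y, P y /\ (m y < m x)%N).
  by apply: (IHn y) => //; apply: leq_trans yx _.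
exists x; split=> // y Py; rewrite leqNgt; apply/negP => yx.
by apply: H; exists y.
Qed.

Lemma lann_ex U : exists L : {vspace A}, forall x, x \in L <-> forall u, u \in U -> x * u = 0.
Proof.
apply: subspace_ex => [u _|c x y xU yU u uU]; first by rewrite mul0r.
by rewrite mulrDl -scalerAl xU // yU // scaler0 addr0.
Qed.

Lemma rann_ex U : exists L : {vspace A}, forall x, x \in L <-> forall u, u \in U -> u * x = 0.
Proof.
apply: subspace_ex => [u _|c x y xU yU u uU]; first by rewrite mulr0.
by rewrite mulrDr -scalerAr xU // yU // scaler0 addr0.
Qed.

Definition lann U := projT1 (cid (lann_ex U)).
Definition rann U := projT1 (cid (rann_ex U)).

Lemma lannP U x : x \in lann U <-> forall u, u \in U -> x * u = 0.
Proof. exact: (projT2 (cid (lann_ex U))). Qed.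

Lemma rannP U x : x \in rann U <-> forall u, u \in U -> u * x = 0.
Proof. exact: (projT2 (cid (rann_ex U))). Qed.

Definition left_ideal U := forall a x, x \in U -> a * x \in U.
Definition right_ideal U := forall a x, x \in U -> x * a \in U.

Lemma left_ideal_lann U : left_ideal (lann U).
Proof. by move=> a x /lannP xU; apply/lannP=> u uU; rewrite -mulrA xU ?mulr0. Qed.

Lemma right_ideal_lann U : left_ideal U -> right_ideal (lann U).
Proof.
move=> UL a x /lannP xU; apply/lannP=> u uU.
by rewrite -mulrA xU // UL.
Qed.

Lemma left_ideal_cap U T : left_ideal U -> left_ideal T -> left_ideal (U :&: T).
Proof. by move=> UL TL a x; rewrite !memv_cap => /andP[xU xT]; rewrite UL ?TL. Qed.

Lemma rannS U T : (U <= T)%VS -> (rann T <= rann U)%VS.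
Proof. by move=> /subvP UT; apply/subvP=> x /rannP xT; apply/rannP=> u /UT/xT. Qed.

Lemma lannS U T : (U <= T)%VS -> (lann T <= lann U)%VS.
Proof. by move=> /subvP UT; apply/subvP=> x /lannP xT; apply/lannP=> u /UT/xT. Qed.

Lemma regular_quotient L : left_ideal L ->
  exists (C : module A) (p : 'Hom(regular A, C)), is_hom p /\ forall x, p x = 0 <-> x \in L.
Proof.
move=> LL.
have [||a x|C [p [pH _ pE]]] := @quotient_ex _ _ (regular A) (fun x => x \in L).
- exact: mem0v.
- by move=> c x y xU yU; rewrite memvD // memvZ.
- by rewrite regularE; apply: LL.
by exists C, p.
Qed.

Lemma orbit_hom_ex M (m : M) : exists f : 'Hom(regular A, M),
  is_hom f /\ forall a, f a = act M a m.
Proof.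
apply: hom_ex => [|a x]; first exact: (act_bilin M).1.
by rewrite regularE actME.
Qed.

Lemma hom_regular_mull M (f : 'Hom(M, regular A)) a x :
  is_hom f -> f (act M a x) = a * (f x : A).
Proof. by move=> fH; rewrite fH regularE. Qed.

Hypothesis A_inj : selfinjective A.

Lemma extend_to_regular M N (g : 'Hom(M, N)) (h : 'Hom(M, regular A)) :
    is_hom g -> is_hom h -> (forall x, g x = 0 -> h x = 0) ->
  exists f : 'Hom(N, regular A), is_hom f /\ forall x, f (g x) = h x.
Proof.
move=> gH hH gh; have [I [q [i [qH iH qS iI iq]]]] := image_ex gH.
have [x|h' [hH' hE']] := factor_surj qH hH qS.
  by move=> qx; apply: gh; rewrite -iq qx linear0.
have [|f [fH fE]] := A_inj (g := i) _ hH'; first by split=> //; apply/lfun_injP.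
exists f; split=> // x; rewrite -hE' -fE comp_lfunE.
by rewrite iq.
Qed.

(** For a basis u_i of I, the map a |-> (a u_i)_i has kernel lann I. If x annihilates this kernel
    from the right, then a |-> a x extends along the map, which writes x as a sum of terms u_i y_i
    in I. *)
Lemma rann_lann I : right_ideal I -> rann (lann I) = I.
Proof.
move=> IR; apply/vspaceP=> x; apply/idP/idP=> [/rannP xI|xI]; last first.
  by apply/rannP=> u /lannP; apply.
pose W : vectType k := subvs_of I; pose F := free_module A W.
have [|g0 g0E] := @lfun_ex _ (regular A) F
    (fun a : A => \sum_i pure (a * vsval (vbase i : W)) (vbase i : W)).
  move=> c a b; rewrite scaler_sumr -big_split; apply: eq_bigr => i _ /=.
  by rewrite mulrDl -scalerAl pureDl pureZl.
have gH : is_hom g0.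
  move=> a b; rewrite !g0E linear_sum; apply: eq_bigr => i _ /=.
  by rewrite free_act_pure regularE mulrA.
have [h [hH hE]] := @orbit_hom_ex (regular A) x.
have [a ga0|f [fH fE]] := extend_to_regular gH hH.
  rewrite hE regularE; apply: xI; apply/lannP=> u uI.
  have aj j : a * vsval (vbase j : W) = 0.
    have [c [cH cE]] := free_coord_ex A j.
    have : c (g0 a) = 0 by rewrite ga0 linear0.
    rewrite g0E linear_sum (bigD1 j) //= big1 => [|i ij].
      by rewrite cE /vbase r2vK mxE !eqxx scale1r addr0.
    by rewrite cE /vbase r2vK mxE eqxx eq_sym (negPf ij) scale0r.
  rewrite -(vsprojK uI) [vsproj I u]vbaseE linear_sum mulr_sumr big1 // => i _.
  by rewrite linearZ /= -scalerAr aj scaler0.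
have -> : x = f (g0 1) by rewrite fE hE regularE mul1r.
rewrite g0E linear_sum; apply: memv_suml => i _ /=.
have -> : f (pure (1 * vsval (vbase i : W)) (vbase i : W)) =
    vsval (vbase i : W) * (f (pure 1 (vbase i : W)) : A).
  by rewrite -hom_regular_mull // free_act_pure mulr1 mul1r.
by apply: IR; apply: subvsP.
Qed.

(** L cap L' is the kernel of A -> A/L x A/L'. Right multiplication by y extends along this map, and
    its values at (1, 0) and (0, 1) are the two summands of y. *)
Lemma rann_cap L L' : left_ideal L -> left_ideal L' ->
  (rann (L :&: L') <= rann L + rann L')%VS.
Proof.
move=> LL LL'; apply/subvP=> y /rannP yL.
have [C [p [pH pE]]] := regular_quotient LL.
have [C' [p' [pH' pE']]] := regular_quotient LL'.
have [g [gH gE]] := pair_hom_ex pH pH'; have [h [hH hE]] := @orbit_hom_ex (regular A) y.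
have [x|f [fH fE]] := extend_to_regular gH hH.
  rewrite gE => -[/pE xL /pE' xL']; rewrite hE regularE; apply: yL.
  by rewrite memv_cap xL xL'.
have -> : y = f (p 1, 0) + f (0, p' 1).
  rewrite -linearD /= (_ : (p 1, 0) + (0, p' 1) = g 1).
    by rewrite fE hE regularE mul1r.
  by rewrite gE; congr pair; rewrite ?addr0 ?add0r.
apply: memv_add; apply/rannP=> u uL.
  rewrite -hom_regular_mull // prod_actE /= -pH linear0 regularE mulr1.
  by rewrite (pE u).2 // (linear0 f).
rewrite -hom_regular_mull // prod_actE /= -pH' linear0 regularE mulr1.
by rewrite (pE' u).2 // (linear0 f).
Qed.

Definition smallest_rann K T :=
  [/\ left_ideal T, rann T = K &
    forall L, left_ideal L -> rann L = K -> (T <= L)%VS].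

(** By [rann_cap] the left ideals with right annihilator K are closed under intersection, so one of
    least dimension lies in all the others. *)
Lemma smallest_rann_ex K L : left_ideal L -> rann L = K ->
  exists T, smallest_rann K T.
Proof.
move=> LL LK.
have [|T [[TL TK] Tmin]] := @ex_min _ (fun T => left_ideal T /\ rann T = K) (fun T => \dim T).
  by exists L.
exists T; split=> // M ML MK.
have TML := left_ideal_cap TL ML.
have TMK : rann (T :&: M) = K.
  apply/eqP; rewrite eqEsubv; apply/andP; split.
    by apply: subv_trans (rann_cap TL ML) _; rewrite TK MK addvv.
  by rewrite -{1}TK; apply: rannS; apply: capvSl.
have /eqP <- : (T :&: M == T)%VS.
  by rewrite eqEdim capvSl Tmin.
exact: capvSr.
Qed.

(** For a in A let L be the set of x with x a in T. Right multiplication by z in rann L factors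
    through x |-> x a mod T, so z lies in a K, hence in K. Thus T cap L still has right annihilator
    K, and minimality puts T inside L. *)
Lemma smallest_rann_ideal K T :
  left_ideal K -> smallest_rann K T -> right_ideal T.
Proof.
move=> KL [TL TK Tmin] a.
have [||L LE] := @subspace_ex _ A (fun x => x * a \in T).
- by rewrite mul0r mem0v.
- by move=> c x y xT yT; rewrite mulrDl -scalerAl memvD // memvZ.
have LL : left_ideal L by move=> b x /LE xT; apply/LE; rewrite -mulrA TL.
suff : (T <= T :&: L)%VS by move=> /subvP sT x /sT; rewrite memv_cap => /andP[_ /LE].
apply: Tmin; first exact: left_ideal_cap.
apply/eqP; rewrite eqEsubv; apply/andP; split; last first.
  by rewrite -{1}TK; apply: rannS; apply: capvSl.
apply: subv_trans (rann_cap TL LL) _; rewrite TK subv_add subvv /=.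
apply/subvP=> z /rannP zL.
have [C [p [pH pE]]] := regular_quotient TL.
have [r [rH rE]] := @orbit_hom_ex (regular A) a.
have [h [hH hE]] := @orbit_hom_ex (regular A) z.
have [x|f [fH fE]] := extend_to_regular (is_hom_comp pH rH) hH.
  rewrite comp_lfunE rE => /pE; rewrite regularE => xaT.
  by rewrite hE regularE; apply/zL/LE.
have fp b : f (p b) = b * (f (p 1) : A).
  by rewrite -hom_regular_mull // -pH regularE mulr1.
have -> : z = a * (f (p 1) : A).
  by rewrite -fp -[z]mul1r -regularE -hE -fE comp_lfunE rE regularE mul1r.
apply: KL; rewrite -TK; apply/rannP=> u uT.
by rewrite -fp (pE u).2 // linear0.
Qed.

(* From two-sided ideals T' < T with rann T' = lann T one constructs T'' < T'
   with rann T'' = lann T', so finite dimension rules such pairs out. *)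
Lemma no_ideal_descent T T' : left_ideal T -> right_ideal T ->
    left_ideal T' -> right_ideal T' -> (T' <= T)%VS -> rann T' = lann T ->
  T' = T.
Proof.
have [n] := ubnP (\dim T'); elim: n T T' => // n IHn T T' ltn TL TR TL' TR' sT TT'.
apply: contrapT => neT.
(* The next ideal in the chain is the smallest left ideal whose right annihilator is lann T'; it
   lies in T' because rann T' = lann T is contained in lann T'. *)
have [U UU] := smallest_rann_ex (@left_ideal_lann _)
  (rann_lann (right_ideal_lann TL')).
have UR := smallest_rann_ideal (@left_ideal_lann _) UU.
have [UL UK Umin] := UU.
have sUT' : (U <= T')%VS.
  apply: subv_trans (capvSr U T'); apply: Umin; first exact: left_ideal_cap.
  apply/eqP; rewrite eqEsubv; apply/andP; split.
    apply: subv_trans (rann_cap UL TL') _; rewrite UK TT' subv_add subvv /=.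
    exact: lannS.
  by rewrite -{1}UK; apply: rannS; apply: capvSl.
(* U = T' would give lann T' = rann T' = lann T, hence T' = T by taking right annihilators. *)
have neU : U <> T'.
  move=> e; apply: neT; rewrite -(rann_lann TR') -(rann_lann TR).
  by rewrite -UK e TT'.
apply: (neU); apply: IHn => //; rewrite -ltnS; apply: leq_trans ltn.
rewrite ltnS ltn_neqAle dimvS // andbT; apply/negP => /eqP dU.
by apply: neU; apply/eqP; rewrite eqEdim sUT' dU leqnn.
Qed.

(** The smallest left ideal T with rann T = 0 is two-sided, and lann A = 0 as well, so
    [no_ideal_descent] applies to T inside A. *)
Lemma rann_eq0 L : left_ideal L -> rann L = 0%VS -> L = fullv.
Proof.
move=> LL L0; have [T TT] := smallest_rann_ex LL L0.
have left0 : left_ideal 0%VS by move=> a x; rewrite !memv0 => /eqP->; rewrite mulr0.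
have TR := smallest_rann_ideal left0 TT; have [TL T0 Tmin] := TT.
suff TF : T = fullv by apply/eqP; rewrite eqEsubv subvf -TF Tmin.
apply: no_ideal_descent => //; try by move=> *; apply: memvf.
  exact: subvf.
rewrite T0; apply/esym/vspaceP=> x; rewrite memv0; apply/idP/eqP=> [/lannP x0|->].
  by rewrite -[x]mulr1 x0 ?memvf.
exact: mem0v.
Qed.

(** The annihilator L of m is proper, so some nonzero z has L z = 0. Then a m |-> a z is well
    defined on A m, and it extends to M. *)
Lemma regular_cogenerates M (m : M) : m != 0 ->
  exists f : 'Hom(M, regular A), is_hom f /\ f m != 0.
Proof.
move=> m0; have [||L LE] := @subspace_ex _ A (fun a => act M a m = 0).
- by rewrite linear0 zero_lfunE.
- by move=> c x y xm ym; rewrite (act_bilin M).1 xm ym scaler0 addr0.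
have LL : left_ideal L by move=> a x /LE xm; apply/LE; rewrite actME xm linear0.
have [[z [zL z0]]|H] := pselect (exists z, z \in rann L /\ z != 0); last first.
  have L0 : rann L = 0%VS.
    apply/eqP; rewrite -subv0; apply/subvP=> z zL; rewrite memv0.
    by apply: contrapT => /negP z0; apply: H; exists z.
  have : (1 : A) \in L by rewrite (rann_eq0 LL L0) memvf.
  by move=> /LE; rewrite act1E => e; rewrite e eqxx in m0.
have [g [gH gE]] := orbit_hom_ex m; have [h [hH hE]] := @orbit_hom_ex (regular A) z.
have [x|f [fH fE]] := extend_to_regular gH hH.
  by rewrite gE => /LE xL; rewrite hE regularE; apply: (rannP _ _).1 xL.
exists f; split=> //.
by rewrite -[m]act1E -gE fE hE regularE mul1r.
Qed.

(** A map to a projective with kernel of least dimension is injective: otherwise a map to A that is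
    nonzero on a kernel element could be added as a further component. *)
Lemma selfinjective_embeds M : exists Q (f : 'Hom(M, Q)),
  [/\ projective Q, is_hom f & forall x, f x = 0 -> x = 0].
Proof.
pose T := {Q : module A & 'Hom(M, Q)}.
have [|[Q f] [[/= QP fH] fmin]] := @ex_min T
    (fun F => projective (projT1 F) /\ is_hom (projT2 F))
    (fun F => \dim (lker (projT2 F))).
  exists (existT _ (regular A) (0 : 'Hom(M, regular A))).
  split; first exact: projective_regular.
  exact: is_hom0.
exists Q, f; split=> // x fx; apply: contrapT => /eqP x0.
have [g [gH gx]] := regular_cogenerates x0; have [h [hH hE]] := pair_hom_ex fH gH.
have /= := fmin (existT _ _ h) (conj (projective_prod QP (@projective_regular _ A)) hH).
apply/negP; rewrite -ltnNge ltn_neqAle; apply/andP.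
have sK : (lker h <= lker f)%VS.
  by apply/subvP=> y; rewrite !memv_ker hE => /eqP[-> _].
split; last exact: dimvS.
rewrite (dimv_leqif_eq sK); apply: contra gx => /eqP eK.
have : x \in lker h by rewrite eK memv_ker fx.
by rewrite memv_ker hE => /eqP[_ ->].
Qed.

Lemma selfinjective_gproj M : gorenstein_projective M.
Proof.
apply/gorenstein_projectiveP; exists (fun _ => True); split=> // N _; split.
- move=> K Y f g u fg uH; have [fH gH fI _ _] := (short_exactP _ _).1 fg.
  by apply: extend_to_regular => // x /fI->; rewrite linear0.
- have [Q [f [QP fH fI]]] := selfinjective_embeds N.
  have [C [p fp]] := cokernel_ses fH fI.
  by exists Q, C, f, p.
have [K [P [i [p [PP ip]]]]] := projective_cover N.
by exists K, P, i, p.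
Qed.

End Selfinjective.

(** * The Frobenius structure *)

Section RightModules.
Variables (k : fieldType) (B : falgType k).
Implicit Types V W : rmodule B.

Lemma mkrmoduleE (V : vectType k) (e : B -> V -> V) (eL : bilin e) e1 eM b v :
  ract (mkrmodule eL e1 eM) b v = e b v.
Proof. exact: lfun2E. Qed.

Section RQuotient.
Variables (V : rmodule B) (U : {vspace V}).
Hypothesis UB : forall b v, v \in U -> ract V b v \in U.

Definition rquot_act (b : B) (q : quotv U) : quotv U :=
  quotv_pi U (ract V b (quotv_repr U q)).

Lemma rquot_actE b v : rquot_act b (quotv_pi U v) = quotv_pi U (ract V b v).
Proof. by apply/eqP; rewrite quotv_pi_eq -linearB UB ?quotv_piK. Qed.

Lemma rquot_act_bilin : bilin rquot_act.
Proof.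
split=> [q c a b|a c x y]; last by rewrite /rquot_act !linearP.
by rewrite /rquot_act (ract_bilin V).1 linearP.
Qed.

Lemma rquot_act1 q : rquot_act 1 q = q.
Proof. by rewrite -(quotv_reprK q) rquot_actE ract1E. Qed.

Lemma rquot_actM a b q : rquot_act (a * b) q = rquot_act b (rquot_act a q).
Proof. by rewrite -(quotv_reprK q) !rquot_actE ractME. Qed.

Definition rquotient : rmodule B := mkrmodule rquot_act_bilin rquot_act1 rquot_actM.

End RQuotient.

Lemma rcokernel_ex V W (j : 'Hom(V, W)) : rhom j ->
  exists (C : rmodule B) (p : 'Hom(W, C)),
    [/\ rhom p, forall z, exists y, p y = z & forall y, p y = 0 <-> exists x, j x = y].
Proof.
move=> jH; have UB b w : w \in limg j -> ract W b w \in limg j.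
  by move=> /limgP[v <-]; apply/limgP; exists (ract V b v).
exists (rquotient UB), (quotv_pi (limg j)); split=> [b w|z|y].
- by rewrite mkrmoduleE rquot_actE.
- by exists (quotv_repr _ z); rewrite quotv_reprK.
rewrite -limgP -{2}[y]subr0 -quotv_pi_eq linear0; by split=> /eqP.
Qed.

Section RCoinduced.
Variable W : vectType k.

Definition rcoind_act (b : B) (h : 'Hom(B, W)) : 'Hom(B, W) := (h \o amull b)%VF.

Lemma rcoind_act_bilin : bilin rcoind_act.
Proof.
split=> [h c a b|b c h h']; apply/lfunP=> x.
  by rewrite add_lfunE scale_lfunE !comp_lfunE !lfunE /= mulrDl -scalerAl linearP.
by rewrite add_lfunE scale_lfunE !comp_lfunE add_lfunE scale_lfunE.
Qed.

Lemma rcoind_act1 h : rcoind_act 1 h = h.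
Proof. by rewrite /rcoind_act amull1 comp_lfun1r. Qed.

Lemma rcoind_actM a b h : rcoind_act (a * b) h = rcoind_act b (rcoind_act a h).
Proof. by apply/lfunP=> x; rewrite !comp_lfunE !lfunE /= mulrA. Qed.

(* Hom_k(B, W), with (h b)(x) = h(b x) *)
Definition rcoind : rmodule B := mkrmodule rcoind_act_bilin rcoind_act1 rcoind_actM.

Lemma rcoindE b (h : rcoind) x :
  (ract rcoind b h : 'Hom(B, W)) x = (h : 'Hom(B, W)) (b * x).
Proof. by rewrite mkrmoduleE comp_lfunE lfunE. Qed.

End RCoinduced.

Lemma rcoind_embed V : exists j : 'Hom(V, rcoind V),
  [/\ rhom j, forall v, j v = 0 -> v = 0 &
      forall v b, (j v : 'Hom(B, V)) b = ract V b v].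
Proof.
have /choice[j0 j0E] : forall v : V, exists h : 'Hom(B, V), forall b, h b = ract V b v.
  by move=> v; apply: lfun_ex; apply: (ract_bilin V).1.
have [|j jE] := @lfun_ex _ V (rcoind V) j0.
  by move=> c v w; apply/lfunP=> b; rewrite add_lfunE scale_lfunE !j0E linearP.
exists j; split=> [b v|v jv0|v b]; last by rewrite jE j0E.
  by apply/lfunP=> x; rewrite rcoindE !jE !j0E ractME.
have := congr1 (fun h : 'Hom(B, V) => h 1) jv0.
by rewrite jE j0E ract1E zero_lfunE.
Qed.

(* the embedding v |-> (b |-> v b) of V into Hom_k(B, V), factored through copies
   of D(B) indexed by a basis of V *)
Lemma rcoind_coord V : exists (l : 'I_(dim V) -> 'Hom(V, DB B))
    (t : 'I_(dim V) -> 'Hom(DB B, rcoind V)),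
  [/\ forall i, rhom (l i), forall i, rhom (t i) &
    forall v b, (\sum_i t i (l i v) : 'Hom(B, V)) b = ract V b v].
Proof.
have crd i (v : V) : linear (fun b => v2r (ract V b v) 0 i : k^o).
  by move=> c a b; rewrite (ract_bilin V).1 linearP !mxE.
pose l0 i (v : V) : DB B := linfun (fun b => v2r (ract V b v) 0 i : k^o).
have l0E i v b : (l0 i v : 'Hom(B, k^o)) b = v2r (ract V b v) 0 i.
  by rewrite [LHS]linfunE.
have /choice[l lE] : forall i, exists l : 'Hom(V, DB B), forall v, l v = l0 i v.
  move=> i; apply: lfun_ex => c v w; apply/lfunP=> b.
  by rewrite add_lfunE scale_lfunE !l0E !linearP !mxE.
pose t0 i (phi : DB B) : 'Hom(B, V) :=
  linfun (fun b => ((phi : 'Hom(B, k^o)) b : k) *: (vbase i : V)).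
have t0E i phi b : t0 i phi b = ((phi : 'Hom(B, k^o)) b : k) *: (vbase i : V).
  by rewrite [LHS]linfunE // => c x y; rewrite linearP scalerDl scalerA.
have /choice[t tE] : forall i, exists t : 'Hom(DB B, rcoind V), forall phi, t phi = t0 i phi.
  move=> i; apply: lfun_ex => c f g; apply/lfunP=> b.
  by rewrite add_lfunE scale_lfunE !t0E add_lfunE scale_lfunE scalerDl scalerA.
exists l, t; split=> [i b v|i b phi|v b].
- by apply/lfunP=> x; rewrite DB_ractE !lE !l0E ractME.
- by apply/lfunP=> x; rewrite rcoindE !tE !t0E DB_ractE.
rewrite sum_lfunE [RHS]vbaseE; apply: eq_bigr => i _.
by rewrite tE t0E lE l0E.
Qed.

End RightModules.

(** * Projective and injective objects of Mon(B, A-Gproj) and Mon(B, A) *)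

Section Frobenius.
Variables (k : fieldType) (A B : falgType k).
Implicit Types (V W : rmodule B) (X Y Z P K : module (talg A B)) (M N Q : module A).

Local Notation gp := (@gorenstein_projective k A).
Local Notation MonG := (MonL B gp).

Lemma MonGP X : MonG X <-> projective (resB X) /\ forall V, gp (TB V X).
Proof. by rewrite -MonP. Qed.

Lemma projective_zero (C : falgType k) (M : module C) : (forall x : M, x = 0) -> projective M.
Proof.
move=> M0; apply/projectiveP=> M1 N1 g f _ _ _; exists 0; split; first exact: is_hom0.
by move=> x; rewrite (M0 x) !linear0.
Qed.

Lemma projective_Mon P : projective P -> Mon B A P.
Proof. by move=> /(@projective_resB k A B) PP; apply/MonP. Qed.

Lemma projective_MonG P : projective P -> MonG P.
Proof.
move=> PP; apply/MonGP; split; first exact: projective_resB.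
by move=> V; apply/projective_gproj/TB_projective.
Qed.

Lemma resB_iso X Y : isomorphic X Y -> projective (resB X) -> projective (resB Y).
Proof.
move=> /iso_inverse[f [g [fH gH fK gK]]].
have [_ /is_hom_resB fB] := (is_hom_ABlin _).1 fH.
have [_ /is_hom_resB gB] := (is_hom_ABlin _).1 gH.
exact: projective_retract gB fB gK.
Qed.

Lemma resB_kernel K P X (i : 'Hom(K, P)) (p : 'Hom(P, X)) : short_exact i p ->
  projective (resB P) -> projective (resB X) -> projective (resB K).
Proof.
move=> /(@short_exact_resB _ _ _ _ _ _ _ _) ip PP XP.
have [t [tH pt]] := projective_section ip XP.
have [r [rH ri _]] := section_retraction ip tH pt.
have [iH _ _ _ _] := (short_exactP _ _).1 ip.
exact: projective_retract iH rH ri PP.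
Qed.

Lemma TB_iso V X Y : isomorphic X Y -> isomorphic (TB V X) (TB V Y).
Proof.
move=> /iso_inverse[f [g [fH gH fK gK]]]; have H1 := @rhom1 _ _ V.
have [_ fB] := (is_hom_ABlin _).1 fH; have [_ gB] := (is_hom_ABlin _).1 gH.
have K1 t : TBmap (\1 : 'Hom(V, V)) g (TBmap \1 f t) = t.
  rewrite -[RHS]id_lfunE -comp_lfunE; move: t; apply: tau_ext => v x.
  by rewrite comp_lfunE !TBmapE // !id_lfunE fK.
have K2 t : TBmap (\1 : 'Hom(V, V)) f (TBmap \1 g t) = t.
  rewrite -[RHS]id_lfunE -comp_lfunE; move: t; apply: tau_ext => v x.
  by rewrite comp_lfunE !TBmapE // !id_lfunE gK.
have TH := TBmap_hom H1 fH.
exists (TBmap \1 f); split; split=> //.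
  by apply/lfun_injP=> t t0; rewrite -[t]K1 t0 linear0.
by apply/lfun_surjP=> t; exists (TBmap \1 g t).
Qed.

Lemma exact_subcategory_MonG : exact_subcategory MonG.
Proof.
split=> [X /vzeroP X0|X Y XY /MonGP[XP XG]|X Y Z f g fg /MonGP[XP XG] /MonGP[ZP ZG]];
  apply/MonGP; split.
- exact: projective_zero.
- move=> V; apply/projective_gproj/projective_zero.
  apply: tau_ind => [v x|c s t -> ->]; last by rewrite scaler0 addr0.
  by rewrite (X0 x) tau0r.
- exact: resB_iso XY XP.
- by move=> V; apply: gproj_iso (XG V); apply: TB_iso.
- exact: projective_extension (short_exact_resB fg) XP ZP.
by move=> V; apply: gproj_extension (TB_ses V fg ZP) (XG V) (ZG V).
Qed.

Lemma Mon_cover X : Mon B A X -> exists K P (i : 'Hom(K, P)) (p : 'Hom(P, X)),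
  [/\ projective P, Mon B A K & short_exact i p].
Proof.
move=> /MonP XP; have [K [P [i [p [PP ip]]]]] := projective_cover X.
exists K, P, i, p; split=> //; apply/MonP.
exact: resB_kernel ip (projective_resB PP) XP.
Qed.

Lemma MonG_cover X : MonG X -> exists K P (i : 'Hom(K, P)) (p : 'Hom(P, X)),
  [/\ projective P, MonG K & short_exact i p].
Proof.
move=> /MonGP[XP XG]; have [K [P [i [p [PP ip]]]]] := projective_cover X.
exists K, P, i, p; split=> //; apply/MonGP; split.
  exact: resB_kernel ip (projective_resB PP) XP.
move=> V; exact: gproj_kernel (TB_ses V ip XP) (TB_projective PP) (XG V).
Qed.

(** Covers by projectives inside [C] are conflations, so a projective object splits off a projective
    module. Stated for any such [C] to serve both categories. *)
Lemma projective_objectP (C : module (talg A B) -> Prop) P :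
    (forall P, projective P -> C P) ->
    (forall X, C X -> exists K P (i : 'Hom(K, P)) (p : 'Hom(P, X)),
      [/\ projective P, C K & short_exact i p]) ->
  projective_object C P <-> projective P.
Proof.
move=> Cproj Ccov; split=> [[CP PL]|PP].
  have [K [Q [i [p [QP CK ip]]]]] := Ccov P CP.
  have [|s [sH /lfunP ps]] := PL K Q P i p \1%VF _ (@is_hom1 _ _ P).
    by split=> //; apply: Cproj.
  have [_ pH _ _ _] := (short_exactP _ _).1 ip.
  apply: (projective_retract sH pH) QP => x.
  by have := ps x; rewrite comp_lfunE id_lfunE.
split=> [|X Y Z f g u [_ _ _ fg] uH]; first exact: Cproj.
have [_ gH _ gS _] := (short_exactP _ _).1 fg.
have [v [vH vE]] := (projectiveP _).1 PP _ _ g u gH gS uH.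
by exists v; split=> //; apply/lfunP=> x; rewrite comp_lfunE vE.
Qed.

Lemma projective_injective_MonG P : projective P -> injective_object MonG P.
Proof.
move=> PP; split=> [|X Y Z f g u]; first exact: projective_MonG.
move=> [_ _ /MonGP[ZP ZG] fg] uH.
(* P is a retract of Hom_k(D(B), Q), so it is enough to extend i u, and its transpose is a map into
   the projective A-module Q. *)
have [Q [i [p [QP iH pH pi]]]] := projective_coind_retract PP.
have [U [UH UE]] := coind_unadjunct (is_hom_comp iH uH).
have [eZ _ _] := gp_classP (ZG (DB B)).
have [v [vH vE]] := ext_vanish_to_projective eZ QP (TB_ses _ fg ZP) UH.
have [w [wH wE]] := coind_adjunct vH.
exists (p \o w)%VF; split; first exact: is_hom_comp.
apply/lfunP=> x; rewrite !comp_lfunE.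
have [fH _ _ _ _] := (short_exactP _ _).1 fg; have [_ fB] := (is_hom_ABlin _).1 fH.
suff -> : w (f x) = i (u x) by rewrite pi.
apply/lfunP=> phi; rewrite wE -[RHS](_ : U (tau phi x) = _); last by rewrite UE comp_lfunE.
by rewrite -vE TBmapE // ?id_lfunE //; apply: rhom1.
Qed.

(** A B-linear map out of Hom_k(D(B), Q) = B (x) Q is [Psi] of a k-linear map [kappa] on Q. With [s]
    a B-linear section of B (x) X -> X, [kappa] is chosen to send iota (phi (x) x) to (phi (x) 1)(s
    x). Summing over dual bases then rebuilds s x, whose image in X is x. *)
Lemma coind_DB_retraction X Q (iota : 'Hom(TB (DB B) X, Q)) (f : 'Hom(X, coind (DB B) Q)) :
    projective (resB X) -> (forall t, iota t = 0 -> t = 0) ->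
    (forall x phi, (f x : 'Hom(DB B, Q)) phi = iota (tau phi x)) ->
  exists q : 'Hom(coind (DB B) Q, X), Blin q /\ forall x, q (f x) = x.
Proof.
move=> XP iI fE; have [rho rhoE] := lfun_retraction iI.
have [p [pH pS pE]] := free_cover (resB X).
have [K [j jp]] := kernel_ses pH pS; have [s [sH ps]] := projective_section jp XP.
pose c (phi : DB B) : 'Hom(tens B X, X) :=
  linfun (tlift (fun (b : B) (x : X) => ((phi : 'Hom(B, k^o)) b : k) *: x)).
have cE phi b x : c phi (pure b x) = ((phi : 'Hom(B, k^o)) b : k) *: x.
  rewrite /c lfunE /= tlift_pure //; split=> [w d a a'|a d w w'].
    by rewrite linearP scalerDl scalerA.
  by rewrite scalerDr !scalerA mulrC.
pose beta (phi : DB B) (x : X) : X := c phi (s x).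
have bb : bilin beta.
  split=> [x d f1 f2|phi d x x']; last by rewrite /beta !linearP.
  rewrite /beta; elim/(@tens_ind _ B X): (s x) => [b y|e y z IHy IHz].
    by rewrite !cE add_lfunE scale_lfunE scalerDl scalerA.
  by rewrite !linearP /= IHy IHz !scalerDr !scalerA mulrC addrACA.
have bal b phi x : beta (ract (DB B) b phi) x = beta phi (actB b x).
  rewrite /beta; have -> : s (actB b x) = act (free_module B X) b (s x) by rewrite -sH resBE.
  elim/(@tens_ind _ B X): (s x) => [b' y|e y z IHy IHz].
    by rewrite free_act_pure !cE DB_ractE.
  by rewrite !linearP /= IHy IHz.
pose kappa : 'Hom(Q, resB X) := (tau_lift beta \o rho)%VF.
have kE phi x : kappa (iota (tau phi x)) = c phi (s x).
  by rewrite /kappa comp_lfunE rhoE tau_liftE.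
exists (Psi kappa); split.
  by move=> b h; apply: etrans (Psi_actB kappa b h) _; rewrite resBE.
move=> x; apply: etrans (PsiE kappa (f x)) _; rewrite -[RHS]ps.
transitivity (\sum_i act (resB X) (vbase i) (c (bdual i) (s x))).
  by apply: eq_bigr => i _; rewrite fE kE.
elim/(@tens_ind _ B X): (s x) => [b y|e y z IHy IHz].
  rewrite pE {2}[b]vbaseE linear_sum sum_lfunE; apply: eq_bigr => i _.
  by rewrite cE bdualE !linearZ scale_lfunE.
rewrite linearP /= -IHy -IHz scaler_sumr -big_split; apply: eq_bigr => i _ /=.
by rewrite !linearP.
Qed.

Lemma MonG_embed X : MonG X -> exists P Z (f : 'Hom(X, P)) (g : 'Hom(P, Z)),
  [/\ projective P, MonG Z & short_exact f g].
Proof.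
move=> /MonGP[XP XG].
have [_ [Q [G' [iota [pi [QP GG' ip]]]]] _] := gp_classP (XG (DB B)).
have [iH pH iI pS ipE] := (short_exactP _ _).1 ip.
have [f [fH fE]] := coind_adjunct iH.
have [q [qB qf]] := coind_DB_retraction XP iI fE.
pose H : module (talg A B) := coind (DB B) Q.
have HP : projective H by apply: coind_projective.
have fI x : f x = 0 -> x = 0 by move=> fx; rewrite -[x]qf fx linear0.
have [Z [g fg]] := cokernel_ses fH fI.
have [_ gH _ gS _] := (short_exactP _ _).1 fg.
have [_ fB] := (is_hom_ABlin _).1 fH; have [_ /is_hom_resB gB] := (is_hom_ABlin _).1 gH.
have ZP : projective (resB Z).
  have [t [tH gt]] := retraction_section (short_exact_resB fg) ((is_hom_resB _).1 qB) qf.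
  by apply: (projective_retract tH gB gt); apply: coind_resB_projective.
exists H, Z, f, g; split=> //; apply/MonGP; split=> // V.
have THP : projective (TB V H) by apply: TB_projective.
have Tfg := TB_ses V fg ZP.
apply: (gproj_cokernel Tfg (XG V) THP).
(* It remains to extend an A-map [u] from V (x)_B X to A along 1 (x) f. *)
apply: (ext_vanish_presentation THP Tfg) => u uH.
have H1 U := @rhom1 _ B U.
have B1 Y : Blin (\1%VF : 'Hom(Y, Y)) by move=> b x; rewrite !id_lfunE.
have hom1 Y := @is_hom1 _ _ (Y : module (talg A B)).
have [j [jH jI jE]] := rcoind_embed V.
have [V' [p [pH' pS' jpE]]] := rcokernel_ex jH.
(* [u] is extended to Hom_k(B, V) (x)_B X, where the cokernel V' (x)_B X is Gorenstein projective by
   the hypothesis on X. *)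
have [u1 [u1H u1E]] : exists u1 : 'Hom(TB (rcoind B V) X, regular A),
    is_hom u1 /\ forall t, u1 (TBmap j \1 t) = u t.
  have [eV _ _] := gp_classP (XG V').
  have [TS TE] := TBmap_exact_l X jH pH' pS' jpE.
  apply: eV uH; apply/short_exactP; split; last exact: TE.
  - exact: TBmap_hom.
  - exact: TBmap_hom.
  - exact: TBmap_inj_l.
  exact: TS.
have [l [t [lH tH ltE]]] := rcoind_coord V.
have [eG _ _] := gp_classP GG'.
(* On each copy of D(B) in Hom_k(B, V), the restriction of [u1] extends along [iota] to Q, as the
   cokernel of [iota] is Gorenstein projective. *)
have /choice[w wP] : forall i, exists w : 'Hom(Q, regular A), is_hom w /\
    forall s, w (iota s) = u1 (TBmap (t i) \1 s).
  move=> i; have [|w [wH wE]] := eG _ _ _ _ (u1 \o TBmap (t i) (\1 : 'Hom(X, X)))%VF ip.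
    by apply: is_hom_comp => //; apply: TBmap_hom.
  by exists w; split=> // s; rewrite wE comp_lfunE.
(* [E] is the counit D(B) (x)_B Hom_k(D(B), Q) -> Q. It takes phi (x) f x to iota (phi (x) x), where
   [w] is known. *)
have [E [EH EE]] := coind_unadjunct (hom1 H).
exists (\sum_i (w i \o (E \o TBmap (l i) \1)))%VF; split.
  apply: is_hom_sum => i; apply: is_hom_comp; first by case: (wP i).
  by apply: is_hom_comp => //; apply: TBmap_hom.
move=> s; rewrite -comp_lfunE; move: s; apply: tau_ext => v x.
rewrite comp_lfunE TBmapE // id_lfunE sum_lfunE.
transitivity (u1 (tau (\sum_i t i (l i v)) x)).
  have tauL : linear (fun w0 : rcoind B V => tau w0 x) by apply: (tau_bilin _ _).1.
  have [F FE] := lfun_ex tauL; rewrite -FE !linear_sum; apply: eq_bigr => i _ /=.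
  rewrite !comp_lfunE TBmapE // EE !id_lfunE fE (wP i).2 TBmapE //.
  by rewrite FE id_lfunE.
have -> : \sum_i t i (l i v) = j v by apply/lfunP=> b; rewrite ltE jE.
by rewrite -u1E TBmapE // id_lfunE.
Qed.

Lemma injective_objectP P : injective_object MonG P <-> projective P.
Proof.
split=> [[CP PL]|]; last exact: projective_injective_MonG.
have [Q [Z [f [g [QP CZ fg]]]]] := MonG_embed CP.
have [|r [rH /lfunP rf]] := PL P Q Z f g \1%VF _ (@is_hom1 _ _ P).
  by split=> //; apply: projective_MonG.
have [fH _ _ _ _] := (short_exactP _ _).1 fg.
apply: (projective_retract fH rH) QP => x.
by have := rf x; rewrite comp_lfunE id_lfunE.
Qed.

Lemma projective_object_MonG P : projective_object MonG P <-> projective P.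
Proof. by apply: projective_objectP; [apply: projective_MonG|apply: MonG_cover]. Qed.

Lemma projective_object_Mon P : projective_object (Mon B A) P <-> projective P.
Proof. by apply: projective_objectP; [apply: projective_Mon|apply: Mon_cover]. Qed.

Lemma frobenius_MonG : frobenius MonG.
Proof.
split; first exact: exact_subcategory_MonG.
- move=> Z CZ; have [K [P [i [p [PP CK ip]]]]] := MonG_cover CZ.
  exists K, P, i, p; split; last exact/projective_object_MonG.
  by split=> //; apply: projective_MonG.
- move=> X CX; have [P [Z [f [g [PP CZ fg]]]]] := MonG_embed CX.
  exists P, Z, f, g; split; last exact/injective_objectP.
  by split=> //; apply: projective_MonG.
by move=> X; rewrite projective_object_MonG injective_objectP.
Qed.

Lemma coind_injective_selfinjective :
  injective_object (Mon B A) (coind (DB B) (regular A)) -> selfinjective A.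
Proof.
move=> [_ inj] M N g f [gH /lfun_injP gI] fH.
have [C [p gp]] := cokernel_ses gH gI.
have [F [G [FG FE GE]]] := coind_ses (DB B) gp.
have [f' [fH' fE']] := coind_hom_ex (DB B) fH.
have MonC (R : module A) : Mon B A (coind (DB B) R) by apply/MonP/coind_resB_projective.
have [|v [vH vE]] := inj _ _ _ F G f' _ fH'; first by split.
(* Evaluation at such a phi undoes m |-> 1 (x) m, so it turns the extension between coinduced
   modules into one between the A-modules themselves. *)
have [phi phi1] : exists phi : DB B, (phi : 'Hom(B, k^o)) 1 = 1.
  have /rV0Pn[i i0] : v2r (1 : B) != 0.
    by apply/eqP => e; have := oner_neq0 B; rewrite -[1]v2rK e linear0 eqxx.
  exists ((v2r (1 : B) 0 i)^-1 *: bdual i).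
  by rewrite scale_lfunE bdualE; apply: mulVf.
have [vA _] := (is_hom_ABlin _).1 vH.
have [||h [hH hE]] := @hom_ex _ _ N (regular A)
    (fun n => (v (elem n 1) : 'Hom(DB B, regular A)) phi).
- by move=> c x y; rewrite (elem_bilin B N).1 linearP add_lfunE scale_lfunE.
- by move=> a x; rewrite -elem_actA vA coind_actA.
exists h; split=> //; apply/lfunP=> m; rewrite comp_lfunE hE.
have -> : elem (g m) 1 = F (elem m 1).
  by rewrite FE; apply/lfunP=> psi; rewrite comp_lfunE !elemE linearZ.
rewrite -[v (F _)]comp_lfunE vE fE' comp_lfunE elemE.
by rewrite phi1 scale1r.
Qed.

End Frobenius.

Theorem proposition3p10 (k : fieldType) (A B : falgType k) :
  [/\ frobenius (MonL B (@gorenstein_projective k A)),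
      forall P : module (talg A B),
        projective_object (MonL B (@gorenstein_projective k A)) P /\
        injective_object (MonL B (@gorenstein_projective k A)) P
        <-> projective P,
      frobenius (Mon B A) <-> selfinjective A
    & selfinjective A <->
      (forall X : module (talg A B),
         Mon B A X <-> MonL B (@gorenstein_projective k A) X)].
Proof.
have MonE : (forall X : module (talg A B),
    Mon B A X <-> MonL B (@gorenstein_projective k A) X) ->
    Mon B A = MonL B (@gorenstein_projective k A).
  by move=> E; apply/funext=> X; apply/propext.
have self_Mon : selfinjective A -> forall X : module (talg A B),
    Mon B A X <-> MonL B (@gorenstein_projective k A) X.
  move=> A_inj X; split=> [XM|[]//]; split=> // V; exact: selfinjective_gproj.
have coindP : projective (coind (DB B) (regular A)).
  by apply: coind_projective; apply: projective_regular.
split; first exact: frobenius_MonG.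
- by move=> P; rewrite projective_object_MonG injective_objectP; split=> [[]|].
- split=> [[_ _ _ PI]|A_inj]; last first.
    by rewrite (MonE (self_Mon A_inj)); apply: frobenius_MonG.
  by apply/(@coind_injective_selfinjective k A B)/PI/projective_object_Mon.
split=> // E; apply: (@coind_injective_selfinjective k A B).
by rewrite MonE //; apply/injective_objectP.
Qed.
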